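(* Let $\mu$ be a fragmentation measure on $\mathcal{C}$. For $i\in\mathbb{N}$ let $\epsilon_i=(\{i\},\mathbb{N}\setminus\{i\})$ and $\epsilon'_i=(\mathbb{N}\setminus\{i\},\{i\})$ (compositions of $\mathbb{N}$ with two blocks, in the indicated order), and set $\epsilon=\sum_{i}\delta_{\epsilon_i}$, $\epsilon'=\sum_i\delta_{\epsilon'_i}$; these are two exchangeable measures on $\mathcal{C}$. Then there exist $c_l\ge 0$, $c_r\ge 0$ and a dislocation measure $\nu$ on $\mathcal{U}$ such that $$\mu=c_l\,\epsilon+c_r\,\epsilon'+P^{\nu}.$$ Besides, the restriction of $\mu$ to $\{\Gamma\in\mathcal{C}: U_\Gamma=\,]0,1[\,\}$ is $c_l\epsilon+c_r\epsilon'$, and the restriction of $\mu$ to $\{\Gamma\in\mathcal{C}: U_\Gamma\neq\,]0,1[\,\}$ is $P^\nu$.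
   Context: Compositions. For $n\in\mathbb{N}=\{1,2,\dots\}$ let $[n]=\{1,\dots,n\}$. A composition of $[n]$ is a finite ordered sequence $(A_1,\dots,A_k)$ of disjoint non-empty subsets (blocks) of $[n]$ with union $[n]$; $\mathcal{C}_n$ is the set of compositions of $[n]$. The restriction $\gamma_{A}$ of a composition to a set $A$ is obtained by intersecting the blocks with $A$, keeping their order and deleting empty blocks. $\mathcal{C}$ is the projective limit of $(\mathcal{C}_n)$ under the restriction maps $\mathcal{C}_n\to\mathcal{C}_{n-1}$, with the product topology; its elements are called compositions of $\mathbb{N}$ (equivalently, total preorders on $\mathbb{N}$: $i\sim j$ if $i,j$ are in the same block, $i\prec j$ if the block of $i$ is before the block of $j$). $\mathbf{1}_n$ and $\mathbf{1}_{\mathbb{N}}$ denote the compositions of $[n]$ and $\mathbb{N}$ with a single block. A measure $\mu$ on $\mathcal{C}$ is exchangeable if for every $n$, every permutation $\sigma$ of $[n]$ and every $\gamma\in\mathcal{C}_n$, $\mu(\Gamma_{[n]}=\gamma)=\mu(\Gamma_{[n]}=\sigma(\gamma))$, where $\sigma$ acts on the elements of the blocks and keeps the order of the blocks. Open sets. $\mathcal{U}$ is the set of open subsets of $]0,1[$ with the distance $d(U,V)=\|\chi_U-\chi_V\|_\infty$, $\chi_U(x)=\min\{|x-y|: y\in[0,1]\setminus U\}$, $x\in[0,1]$. For $U\in\mathcal{U}$, $P^U$ is the law on $\mathcal{C}$ of the random composition obtained from i.i.d. uniform variables $(X_i)_{i\ge1}$ on $[0,1]$ as follows: $i\sim j$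 if $i=j$ or $X_i,X_j$ belong to the same component interval of $U$; otherwise $i\prec j$ if $X_i<X_j$ and $i\succ j$ if $X_i>X_j$. For a measure $\nu$ on $\mathcal{U}$, $P^\nu=\int_{\mathcal{U}}P^U\,\nu(dU)$. Asymptotic open set. If $\Gamma\in\mathcal{C}$ and $\Gamma_{[n]}$ has successive block sizes $(n_1,\dots,n_k)$, let $U_n=\bigcup_{i=1}^k\,\bigl]\tfrac{n_1+\dots+n_{i-1}}{n},\tfrac{n_1+\dots+n_i}{n}\bigr[$. The asymptotic open set $U_\Gamma$ is the limit in $(\mathcal{U},d)$ of $U_n$ when it exists; it exists almost surely for an exchangeable random composition, and almost everywhere for a fragmentation measure. A fragmentation measure is a (possibly infinite) exchangeable measure $\mu$ on $\mathcal{C}$ such that $\mu(\{\mathbf{1}_{\mathbb{N}}\})=0$ and $\mu(\{\gamma\in\mathcal{C}:\gamma_{[n]}\ne\mathbf{1}_n\})<\infty$ for all $n\in\mathbb{N}$. A dislocation measure is a measure $\nu$ on $\mathcal{U}$ with $\nu(\{]0,1[\})=0$ and $\int_{\mathcal{U}}(1-s_1)\,\nu(dU)<\infty$, where $s_1$ is the length of the largest interval component of $U$. *)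

(* Defs.v *)
From HB Require Import structures.
From mathcomp Require Import all_boot all_order all_algebra perm.
From mathcomp Require Import finmap.
From mathcomp Require Import ring lra.
From mathcomp Require Import all_classical all_reals all_analysis.

Set Implicit Arguments.
Unset Strict Implicit.
Unset Printing Implicit Defensive.

Import Order.TTheory GRing.Theory Num.Theory.
Import numFieldNormedType.Exports.

Local Open Scope classical_set_scope.
Local Open Scope ring_scope.

(* The integers 1, 2, ... of N are represented by 0, 1, ... : nat, and [n] by
   'I_n. *)

Definition is_composition n (g : seq {set 'I_n}) : bool :=
  uniq g && finset.partition [set:: g]%SET [set: 'I_n]%SET.

(* A compatible sequence of compositions of the sets [n] is the same thing as a
   total preorder on N, where [cle G i j] means that the block of i is
   equal to, or before, the block of j. *)
Record compN := CompN {
  cle :> nat -> nat -> bool ;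
  cle_total : total cle ;
  cle_trans : transitive cle }.

HB.instance Definition _ := gen_eqMixin compN.
HB.instance Definition _ := gen_choiceMixin compN.

Definition one_compN : compN.
Proof. by exists (fun _ _ => true). Defined.

HB.instance Definition _ := isPointed.Build compN one_compN.

(* The restriction of G to [n]: enumerate [n] along G, replace each element by
   its block, and keep one copy of each block (equal blocks are consecutive). *)
Definition restr n (G : compN) : seq {set 'I_n} :=
  undup [seq [set j : 'I_n | G i j && G j i]%SET
        | i : 'I_n <- sort (fun i j : 'I_n => G i j) (enum 'I_n)].

Lemma cle_refl (G : compN) : reflexive G.
Proof. by move=> i; have := cle_total G i i; rewrite orbb. Qed.

Lemma restr_is_composition n (G : compN) : is_composition (restr n G).
Proof.
rewrite /is_composition undup_uniq /=.
have memP (B : {set 'I_n}) : reflect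
    (exists i : 'I_n, B = [set j : 'I_n | G i j && G j i]%SET)
    (B \in [set:: restr n G]%SET).
  rewrite inE mem_undup; apply: (iffP mapP) => [[i _ ->]|[i ->]].
    by exists i.
  by exists i => //; rewrite mem_sort mem_enum.
apply/and3P; split.
- apply/eqP/setP => i; rewrite inE; apply/bigcupP.
  exists [set j : 'I_n | G i j && G j i]%SET; last by rewrite inE cle_refl.
  by apply/memP; exists i.
- apply/finset.trivIsetP => A B /memP[i ->] /memP[j ->]; apply: contraR.
  move=> /pred0Pn[k /=]; rewrite !inE => /andP[/andP[ik ki] /andP[jk kj]].
  have ij := cle_trans ik kj; have ji := cle_trans jk ki.
  apply/eqP/setP => l; rewrite !inE; apply/idP/idP => /andP[a b].
    by rewrite (cle_trans ji a) (cle_trans b ij).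
  by rewrite (cle_trans ij a) (cle_trans b ji).
- apply/memP => -[i /setP/(_ i)]; by rewrite !inE cle_refl.
Qed.

Lemma restr_order n (G : compN) :
  pairwise (fun A B : {set 'I_n} =>
    [forall i in A, forall j in B, G i j && ~~ G j i]) (restr n G).
Proof.
pose c (i : 'I_n) := [set j : 'I_n | G i j && G j i]%SET.
pose le (A B : {set 'I_n}) := [exists i, exists j,
  [&& A == c i, B == c j & G i j]].
have : pairwise le (restr n G).
  apply: (subseq_pairwise (undup_subseq _)); rewrite pairwise_map.
  apply: (sub_pairwise (r := fun i j : 'I_n => G i j)).
    move=> i j ij; apply/existsP; exists i; apply/existsP; exists j.
    by rewrite !eqxx.
  rewrite -sorted_pairwise; last by move=> ? ? ?; exact: cle_trans.
  by apply: sort_sorted => i j; exact: cle_total.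
have := undup_uniq [seq c i | i <- sort (fun i j : 'I_n => G i j) (enum 'I_n)].
rewrite uniq_pairwise -/(restr n G) => nl ll.
have : pairwise [rel A B | (A != B) && le A B] (restr n G).
  by rewrite pairwise_relI nl ll.
apply: sub_pairwise => A B /andP[AB /existsP[i /existsP[j]]].
move=> /and3P[/eqP Ai /eqP Bj ij].
apply/forall_inP => k; rewrite Ai inE => /andP[ik ki].
apply/forall_inP => l; rewrite Bj inE => /andP[jl lj].
rewrite (cle_trans ki (cle_trans ij jl))/=; apply: contra AB => lk.
have ji := cle_trans jl (cle_trans lk ki).
apply/eqP/setP => m; rewrite Ai Bj !inE; apply/idP/idP => /andP[a b].
  by rewrite (cle_trans ji a) (cle_trans b ij).
by rewrite (cle_trans ij a) (cle_trans b ji).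
Qed.

(* The cylinders form a countable base of the projective limit topology, so
   the sigma-algebra that they generate is the Borel one. *)
Definition cylinders : set (set compN) :=
  [set A | exists n (g : seq {set 'I_n}), A = [set G | restr n G = g]].

HB.instance Definition _ := @isMeasurable.Build (sigma_display cylinders) compN
  <<s cylinders >> (@sigma_algebra0 _ setT cylinders)
  (@sigma_algebraC _ cylinders) (@sigma_algebra_bigcup _ setT cylinders).

Definition exchangeable (R : realType) (mu : set compN -> \bar R) : Prop :=
  forall n (s : {perm 'I_n}) (g : seq {set 'I_n}), (0 < n)%N ->
    is_composition g ->
    mu [set G | restr n G = g] =
    mu [set G | restr n G = [seq [set s i | i in B]%SET | B : {set 'I_n} <- g]].

Definition fragmentation_measure (R : realType)
    (mu : {measure set compN -> \bar R}) : Prop :=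
  [/\ exchangeable mu,
      mu [set one_compN] = 0%E &
      forall n, (0 < n)%N ->
        (mu [set G | restr n G != [:: [set: 'I_n]%SET]] < +oo)%E].

Definition eps_l_point (i : nat) : compN.
Proof.
exists (fun a b => (a == i) || (b != i)).
- by move=> a b; case: (a == i); case: (b == i).
- by move=> b a c; case: (a == i); case: (b == i); case: (c == i).
Defined.

Definition eps_r_point (i : nat) : compN.
Proof.
exists (fun a b => (a != i) || (b == i)).
- by move=> a b; case: (a == i); case: (b == i).
- by move=> b a c; case: (a == i); case: (b == i); case: (c == i).
Defined.

Definition eps_l (R : realType) : {measure set compN -> \bar R} :=
  mseries (fun i => @dirac _ compN (eps_l_point i) R) 0.

Definition eps_r (R : realType) : {measure set compN -> \bar R} :=
  mseries (fun i => @dirac _ compN (eps_r_point i) R) 0.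

Record open01 (R : realType) := Open01 {
  oset :> set R ;
  oset_open : open oset ;
  oset_sub : oset `<=` `]0, 1[ }.

HB.instance Definition _ (R : realType) := gen_eqMixin (open01 R).
HB.instance Definition _ (R : realType) := gen_choiceMixin (open01 R).

Lemma open01_ext (R : realType) (U V : open01 R) :
  oset U = oset V -> U = V.
Proof.
case: U V => [U oU sU] [V oV sV] /= UV; rewrite UV in oU sU *.
by congr Open01; exact: Prop_irrelevance.
Qed.

Section open01_metric.
Variable R : realType.
Implicit Types U V W : open01 R.

(* The infimum is a minimum: the complement is compact and contains 0. *)
Definition chi U (x : R) : R := inf [set `|x - y| | y in `[0, 1] `\` U].

Definition dist01 U V : R := sup [set `|chi U x - chi V x| | x in `[0, 1]].

Lemma compl01_0 U : (`[0, 1] `\` U) 0.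
Proof.
split; first by rewrite /= in_itv /= lexx ler01.
by move=> /oset_sub; rewrite /= in_itv /= ltxx.
Qed.

Lemma chi_lbound U x : has_lbound [set `|x - y| | y in `[0, 1] `\` U].
Proof. by exists 0 => _ [y _ <-]. Qed.

Lemma chi_ge0 U x : 0 <= chi U x.
Proof.
by apply: lb_le_inf => [|_ [y _ <-]//]; exists `|x - 0|, 0; [exact: compl01_0|].
Qed.

Lemma chi_le1 U x : x \in `[0, 1] -> chi U x <= 1.
Proof.
rewrite in_itv /= => /andP[x0 x1].
apply: (@le_trans _ _ `|x - 0|); last by rewrite subr0 ger0_norm.
by apply: (ge_inf (chi_lbound U x)); exists 0 => //; exact: compl01_0.
Qed.

Lemma dist01_ubound U V :
  has_ubound [set `|chi U x - chi V x| | x in `[0, 1]].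
Proof.
exists 1 => _ [x x01 <-]; rewrite ler_norml.
have := chi_ge0 U x; have := chi_ge0 V x.
by have := chi_le1 U x01; have := chi_le1 V x01; lra.
Qed.

Lemma dist01_ge U V x : x \in `[0, 1] -> `|chi U x - chi V x| <= dist01 U V.
Proof. by move=> x01; apply: (ub_le_sup (dist01_ubound U V)); exists x. Qed.

Lemma dist01_le U V r :
  (forall x, x \in `[0, 1] -> `|chi U x - chi V x| <= r) -> dist01 U V <= r.
Proof.
move=> h; apply: ge_sup => [|_ [x x01 <-]]; last exact: h.
by exists `|chi U 0 - chi V 0|, 0 => //; rewrite /= in_itv /= lexx ler01.
Qed.

Lemma dist01xx U : dist01 U U = 0.
Proof.
apply/eqP; rewrite eq_le; apply/andP; split.
  by apply: dist01_le => x _; rewrite subrr normr0.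
apply: le_trans (dist01_ge U U (_ : 0 \in `[0, 1])) => //.
by rewrite /= in_itv /= lexx ler01.
Qed.

Lemma dist01_sym U V : dist01 U V = dist01 V U.
Proof. by rewrite /dist01; under eq_imagel do rewrite distrC. Qed.

Lemma dist01_triangle V U W : dist01 U W <= dist01 U V + dist01 V W.
Proof.
apply: dist01_le => x x01.
apply: le_trans (lerD (dist01_ge U V x01) (dist01_ge V W x01)).
by rewrite -[chi U x - chi W x](subrKA (chi V x)) ler_normD.
Qed.

Lemma dist01_eq0 U V : dist01 U V = 0 -> U = V.
Proof.
suff sub U1 V1 : dist01 U1 V1 = 0 -> oset U1 `<=` oset V1.
  move=> UV; apply: open01_ext; apply/seteqP; split; apply: sub => //.
  by rewrite dist01_sym.
move=> d0 x Ux; apply: contrapT => Vx.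
have x01 : x \in `[0, 1] by apply: subset_itv_oo_cc; exact: oset_sub Ux.
have V0 : chi V1 x <= 0.
  by apply: (ge_inf (chi_lbound V1 x)); exists x => //; rewrite subrr normr0.
have /nbhs_ballP[e /= e0 eU] : nbhs x (oset U1).
  by apply: open_nbhs_nbhs; split => //; exact: oset_open.
have : e <= chi U1 x.
  apply: lb_le_inf => [|_ [y [_ Uy] <-]].
    by exists `|x - 0|, 0 => //; exact: compl01_0.
  by rewrite leNgt; apply: contra_notN Uy => xy; exact: eU.
have := dist01_ge U1 V1 x01; rewrite d0 ler_norml; move: e0 V0; lra.
Qed.

HB.instance Definition _ := isMetric.Build R (open01 R)
  dist01xx dist01_eq0 dist01_sym dist01_triangle.

Definition full01 : open01 R.
Proof. by exists `]0, 1[%classic => //; exact: interval_open. Defined.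

HB.instance Definition _ := isPointed.Build (open01 R) full01.

HB.instance Definition _ := @isMeasurable.Build
  (sigma_display (@open (open01 R))) (open01 R)
  <<s @open (open01 R) >> (@sigma_algebra0 _ setT (@open (open01 R)))
  (@sigma_algebraC _ (@open (open01 R)))
  (@sigma_algebra_bigcup _ setT (@open (open01 R))).

End open01_metric.

(* Junk value at n = 0, where division by 0 is 0. *)
Definition Un_set (R : realType) n (G : compN) : set R :=
  let m := [seq #|B| | B : {set 'I_n} <- restr n G] in
  \bigcup_(k in `I_(size m))
    `](sumn (take k m))%:R / n%:R, (sumn (take k.+1 m))%:R / n%:R[%classic.

Lemma sumn_restr n (G : compN) :
  sumn [seq #|B| | B : {set 'I_n} <- restr n G] = n.
Proof.
have /andP[ug pg] := restr_is_composition n G.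
rewrite sumnE big_map big_uniq //= -[RHS]card_ord -cardsT.
by rewrite (finset.card_partition pg); apply: eq_bigl => B; rewrite inE.
Qed.

Lemma Un_set_open (R : realType) n (G : compN) : open (@Un_set R n G).
Proof. by apply: bigcup_open => k _; exact: interval_open. Qed.

Lemma Un_set_sub (R : realType) n (G : compN) :
  @Un_set R n G `<=` `]0, 1[%classic.
Proof.
move=> x [k _] /=; rewrite !in_itv /= => /andP[ax xb].
apply/andP; split; first by apply: le_lt_trans ax; rewrite divr_ge0.
apply: (lt_le_trans xb); case: n => [|n] in k G xb ax *.
  by rewrite invr0 mulr0.
rewrite ler_pdivrMr ?ltr0n// mul1r ler_nat.
rewrite -[leqRHS](sumn_restr n.+1 G) -[in leqRHS](cat_take_drop k.+1 (map _ _)).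
by rewrite sumn_cat leq_addr.
Qed.

Definition Un (R : realType) n (G : compN) : open01 R :=
  Open01 (@Un_set_open R n G) (@Un_set_sub R n G).

Definition is_asymptotic_open (R : realType) (G : compN) (U : open01 R) : Prop :=
  (fun n => Un R n G) @ \oo --> U.

Definition asymp_full (R : realType) : set compN :=
  [set G | is_asymptotic_open G (full01 R)].

(* U_G exists and is not ]0, 1[. *)
Definition asymp_not_full (R : realType) : set compN :=
  [set G | exists2 U : open01 R, is_asymptotic_open G U & U <> full01 R].

Section composition_of_open.
Variables (R : realType) (U : open01 R) (x : nat -> R).

(* Either i, j are in the same block, or x i < x j; for distinct i and j with
   x i = x j outside U, a null event for i.i.d. uniform x, we choose i ~ j. *)
Definition open_cle (i j : nat) : bool :=
  (x i <= x j) || `[< connected_component U (x i) (x j) >].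

Lemma open_cle_total : total open_cle.
Proof.
move=> i j; rewrite /open_cle.
by case/orP: (le_total (x i) (x j)) => ->; rewrite ?orbT.
Qed.

Lemma component_between a b c : connected_component U a b ->
  (a <= c <= b) || (b <= c <= a) -> connected_component U a c.
Proof.
move=> ab /orP[] acb; have aa := connected_component_trans ab
    (connected_component_sym ab);
  have /connected_intervalP itv := @component_connected _ (oset U) a.
- exact: itv aa ab _ acb.
- exact: itv ab aa _ acb.
Qed.

Lemma open_cle_trans : transitive open_cle.
Proof.
move=> j i k; rewrite /open_cle => /orP[ij|/asboolP ij] /orP[jk|/asboolP jk].
- by rewrite (le_trans ij jk).
- have [//|ki /=] := leP (x i) (x k); apply/asboolP.
  apply/connected_component_sym.
  apply: component_between (connected_component_sym jk) _.
  by rewrite (ltW ki) ij.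
- have [//|ki /=] := leP (x i) (x k); apply/asboolP.
  by apply: component_between ij _; rewrite jk (ltW ki) orbT.
- by apply/orP; right; apply/asboolP; exact: connected_component_trans jk.
Qed.

Definition comp_of_open : compN := CompN open_cle_total open_cle_trans.

End composition_of_open.

Section iid_uniform.
Context d (Omega : measurableType d) (R : realType) (P : probability Omega R).
Variable X : nat -> {RV P >-> R}.

Definition independent : Prop :=
  forall (J : {fset nat}) (B : nat -> set R), (forall i, measurable (B i)) ->
    P (\bigcap_(i in [set` J]) (X i @^-1` B i)) =
    (\prod_(i <- J) P (X i @^-1` B i))%E.

Definition iid_uniform : Prop :=
  independent /\ forall i (B : set R), measurable B ->
    distribution P (X i) B = uniform_prob (@ltr01 R) B.

(* P^U. *)
Definition law_open (U : open01 R) (A : set compN) : \bar R :=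
  P [set w | A (comp_of_open U (fun i => X i w))].

(* P^nu. *)
Definition law_mix (nu : {measure set (open01 R) -> \bar R}) (A : set compN) :
  \bar R := (\int[nu]_U law_open U A)%E.

End iid_uniform.

(* [connected_component U x] is empty when x is not in U, so the value is 0 when
   U is empty. *)
Definition largest_component (R : realType) (U : open01 R) : \bar R :=
  ereal_sup [set lebesgue_measure (connected_component U x) | x in [set: R]].

Definition dislocation_measure (R : realType)
    (nu : {measure set (open01 R) -> \bar R}) : Prop :=
  nu [set full01 R] = 0%E /\
  (\int[nu]_U (1 - largest_component U) < +oo)%E.

(* Main.v *)
(* Let lam be a finite exchangeable measure on C. Since P^(U_n(Gamma)) is sampling
   with replacement from [n], whereas lam is invariant under sampling without
   replacement, lam(A) is the limit of the integrals of
   P^(U_n(Gamma))(A) for every event A on finitely many indices. Under P^U the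
   distance of U_n to U is at most the Glivenko-Cantelli discrepancy of the uniform
   sample, whatever U is; hence U_n converges lam-almost everywhere, and, P^U being
   continuous in U, lam is the mixture of the laws P^(U_Gamma).
   For a fragmentation measure mu, this applies to the restriction of mu to
   {Gamma_[k] <> 1_k}, read on the indices beyond k. Exchanging these with the first
   k indices and letting k tend to infinity gives the part U_Gamma <> ]0,1[. On
   U_Gamma = ]0,1[, almost surely no two disjoint pairs of indices are both
   separated, which leaves only the compositions epsilon_i and epsilon'_i. *)
Require Import Defs.
From HB Require Import structures.
From mathcomp Require Import all_boot all_order all_algebra perm.
From mathcomp Require Import finmap zify ring lra.
From mathcomp Require Import all_classical all_reals all_analysis.
From mathcomp Require Import measurable_realfun.

Set Implicit Arguments.
Unset Strict Implicit.
Unset Printing Implicit Defensive.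

Import Order.TTheory GRing.Theory Num.Theory.
Import numFieldNormedType.Exports.

Local Open Scope classical_set_scope.
Local Open Scope ring_scope.

(** * Compositions, restrictions and permutations *)

(** The measure mu may be infinite. Restricting it to {Gamma_[k] <> 1_k} makes it finite but
    destroys the symmetry in the first k indices; reading only the indices beyond k restores full
    exchangeability and leaves U_Gamma unchanged, because U_Gamma ignores finitely many indices. In
    the resulting identity A concerns the late indices and the condition of being nontrivial the
    early ones. A permutation exchanges the roles: A then concerns the first m indices, and the
    condition the next k. On U_Gamma <> ]0,1[ this condition holds for all large k, since a
    composition with a single block beyond some index has a full asymptotic open set. So nu is the
    image of mu, restricted to U_Gamma <> ]0,1[, under Gamma |-> U_Gamma. The convergence of U_n has
    to be known before there is any mixture to speak of: what allows this is that a bound on P^U(A)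
    uniform in U passes to lam(A). Integrability of 1 - s_1 follows from 1 - s_1 <= 4 P^U(Gamma_[2]
    <> 1_2), as the right side integrates to at most 4 mu(Gamma_[2] <> 1_2). *)

Lemma compN_ext (G H : compN) : (forall i j, G i j = H i j) -> G = H.
Proof.
case: G H => [G tG rG] [H tH rH] /= GH.
have e : G = H by apply/funext => i; apply/funext => j.
by subst H; congr CompN; exact: Prop_irrelevance.
Qed.

Lemma pull_total (f : nat -> nat) (G : compN) :
  total (fun i j => G (f i) (f j)).
Proof. by move=> i j; exact: cle_total. Qed.

Lemma pull_trans (f : nat -> nat) (G : compN) :
  transitive (fun i j => G (f i) (f j)).
Proof. by move=> j i k; exact: cle_trans. Qed.

(** The map f need not be injective: finite permutations, the shift [addn k] and sampling with
    repetition are all instances. *)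
Definition pull (f : nat -> nat) (G : compN) : compN :=
  CompN (@pull_total f G) (@pull_trans f G).

Lemma pull_comp f g G : pull f (pull g G) = pull (g \o f) G.
Proof. exact: compN_ext. Qed.

Definition agree n (G H : compN) : Prop :=
  forall i j, (i < n)%N -> (j < n)%N -> G i j = H i j.

Definition block_of n (G : compN) (i : 'I_n) : {set 'I_n} :=
  [set j : 'I_n | G i j && G j i]%SET.

Lemma mem_restr n (G : compN) (B : {set 'I_n}) :
  reflect (exists i : 'I_n, B = block_of G i) (B \in restr n G).
Proof.
rewrite mem_undup; apply: (iffP mapP) => [[i _ ->]|[i ->]]; first by exists i.
by exists i => //; rewrite mem_sort mem_enum.
Qed.

(** By [restr_order] the blocks are listed in strictly increasing order, so the position of the
    block of i recovers the preorder on [n]. This is what lets the list be forgotten in favour of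
    [agree]. *)
Lemma restr_find n (G : compN) (i j : 'I_n) :
  G i j = (find (fun B : {set 'I_n} => i \in B) (restr n G)
           <= find (fun B : {set 'I_n} => j \in B) (restr n G))%N.
Proof.
set s := restr n G.
have hasP (k : 'I_n) : has (fun B : {set 'I_n} => k \in B) s.
  apply/hasP; exists (block_of G k); first by apply/mem_restr; exists k.
  by rewrite inE cle_refl.
have fP (k : 'I_n) := nth_find finset.set0 (hasP k).
have lt (k l : 'I_n) : (find (fun B : {set 'I_n} => k \in B) s <
    find (fun B : {set 'I_n} => l \in B) s)%N -> G k l && ~~ G l k.
  move=> kl; have /(pairwiseP finset.set0) := restr_order n G.
  move=> /(_ _ _ _ _ kl).
  rewrite !inE -!has_find !hasP => /(_ isT isT) /forall_inP /(_ _ (fP k)).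
  by move=> /forall_inP /(_ _ (fP l)).
have [ij|ji|ij] := ltngtP.
- by have /andP[->] := lt _ _ ij.
- by have /andP[_ /negbTE ->] := lt _ _ ji.
have := fP i; have := fP j; rewrite ij.
set B := nth _ _ _ => jB iB.
have /mem_restr[k Bk] : B \in s by apply: mem_nth; rewrite -has_find.
move: iB jB; rewrite Bk !inE => /andP[_ ik] /andP[kj _].
exact: cle_trans ik kj.
Qed.

Lemma restr_agree n (G H : compN) : restr n G = restr n H <-> agree n G H.
Proof.
split => [GH i j ni nj|GH].
  have := restr_find G (Ordinal ni) (Ordinal nj).
  by rewrite GH -(restr_find H (Ordinal ni) (Ordinal nj)).
rewrite /restr; congr undup.
have -> : (fun i j : 'I_n => G i j) = (fun i j : 'I_n => H i j).
  by apply/funext => i; apply/funext => j; rewrite GH.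
by apply: eq_map => i; apply/setP => j; rewrite !inE !GH.
Qed.

(** The action of s on the blocks is [pull] along the inverse of s, whence the hypothesis on f. Both
    lists are sorted for one strict order and have the same members, hence are equal. *)
Lemma restr_pull n (G : compN) (s : {perm 'I_n}) (f : nat -> nat) :
  (forall i : 'I_n, f (s i) = i) ->
  restr n (pull f G) = [seq [set s i | i in B]%SET | B : {set 'I_n} <- restr n G].
Proof.
move=> fs.
(* Nonemptiness is part of the relation because a comparison with the empty set holds vacuously,
   which would spoil irreflexivity and transitivity. *)
pose lt (A B : {set 'I_n}) := [&& A != finset.set0, B != finset.set0 &
  [forall i in A, forall j in B, pull f G i j && ~~ pull f G j i]].
have fsV (i : 'I_n) : f i = (s^-1%g i : 'I_n) by rewrite -{1}[i](permKV s) fs.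
have clsE (i : 'I_n) : [set s k | k in block_of G i]%SET = block_of (pull f G) (s i).
  apply/setP => k; rewrite inE /= fs fsV; apply/imsetP/idP.
    by move=> [l]; rewrite inE => lG ->; rewrite permK.
  by move=> kG; exists (s^-1%g k); rewrite ?inE ?permKV.
have cls0 (H : compN) (i : 'I_n) : block_of H i != finset.set0.
  by apply/set0Pn; exists i; rewrite inE cle_refl.
apply: (@irr_sorted_eq _ lt).
- move=> B A C /and3P[A0 B0 /forall_inP AB] /and3P[_ C0 /forall_inP BC].
  apply/and3P; split => //; have [b bB] := set0Pn _ B0.
  apply/forall_inP => i iA; apply/forall_inP => j jC.
  have /forall_inP/(_ _ bB)/andP[ib bi] := AB _ iA.
  have /forall_inP/(_ _ jC)/andP[bj jb] := BC _ bB.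
  rewrite (cle_trans ib bj)/=; apply: contra jb => ji.
  exact: cle_trans ji ib.
- move=> A; apply/negP => /and3P[/set0Pn[i iA] _ /forall_inP/(_ _ iA)].
  by move=> /forall_inP/(_ _ iA); rewrite cle_refl.
- apply: pairwise_sorted.
  apply: (@sub_in_pairwise _ (mem (restr n (pull f G))) _ _ _ _ _ (restr_order n _)).
    move=> A B /mem_restr[i ->] /mem_restr[j ->] AB.
    by rewrite /lt !cls0.
  exact/allP.
- apply: pairwise_sorted; rewrite pairwise_map.
  apply: (@sub_in_pairwise _ (mem (restr n G)) _ _ _ _ _ (restr_order n _)).
    move=> A B /mem_restr[i ->] /mem_restr[j ->] AB.
    rewrite /lt/= !clsE !cls0/= -!clsE.
    apply/forall_inP => _ /imsetP[k kA ->]; apply/forall_inP => _ /imsetP[l lB ->].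
    by rewrite !fs; move: AB => /forall_inP/(_ _ kA)/forall_inP/(_ _ lB).
  exact/allP.
- move=> B; apply/mem_restr/mapP => [[i ->]|[C /mem_restr[i ->] ->]].
    exists (block_of G (s^-1%g i)); first by apply/mem_restr; exists (s^-1%g i).
    by rewrite clsE permKV.
  by exists (s i).
Qed.

(** Events on the first n indices. They take the place of the cylinders of [restr n]: they generate
    the same sigma-algebra, and they are stable under intersection and under preimages by [pull]. *)
Definition finitary n : set (set compN) :=
  [set A | forall G H, agree n G H -> A G -> A H].

Lemma agree_sym n G H : agree n G H -> agree n H G.
Proof. by move=> GH i j ni nj; rewrite GH. Qed.

Lemma agree_leq m n G H : (m <= n)%N -> agree n G H -> agree m G H.
Proof. by move=> mn GH i j im jm; apply: GH; exact: leq_trans mn. Qed.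

Lemma finitary_leq m n A : (m <= n)%N -> finitary m A -> finitary n A.
Proof. by move=> mn fA G H /(agree_leq mn); exact: fA. Qed.

Lemma finitaryI n A B : finitary n A -> finitary n B -> finitary n (A `&` B).
Proof. by move=> fA fB G H GH [/(fA _ _ GH) ? /(fB _ _ GH)]. Qed.

Lemma finitary_pull n m f A : (forall i, (i < m)%N -> (f i < n)%N) ->
  finitary m A -> finitary n (pull f @^-1` A).
Proof.
by move=> fmn fA G H GH; apply: fA => i j im jm /=; apply: GH; exact: fmn.
Qed.

Lemma cylinder_finitary n g : finitary n [set G | restr n G = g].
Proof. by move=> G H /restr_agree GH /= <-. Qed.

(** The values of [restr n] lie in a countable type, so a finitary event is a countable union of
    cylinders. *)
Lemma finitary_measurable n A : finitary n A -> measurable A.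
Proof.
move=> fA; pose B (g : seq {set 'I_n}) : set compN :=
  [set G | restr n G = g /\ exists2 H, A H & restr n H = g].
have -> : A = \bigcup_g B g.
  apply/seteqP; split => [G AG|G [g _ [<- [H AH /restr_agree]]]].
    by exists (restr n G) => //; split => //; exists G.
  by move=> /fA; exact.
suff mB g : measurable (B g).
  pose C (o : option (seq {set 'I_n})) := if o is Some g then B g else set0.
  have mC o : measurable (C o) by case: o => [g|]; [exact: mB|exact: measurable0].
  have -> : \bigcup_g B g = \bigcup_k C (choice.unpickle k).
    apply/seteqP; split => G [g _].
      by move=> Bg; exists (choice.pickle g) => //; rewrite choice.pickleK.
    by case: (choice.unpickle g) => //= h Bh; exists h.
  by apply: bigcupT_measurable => k; exact: mC.
have [[H AH gH]|nH] := pselect (exists2 H, A H & restr n H = g).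
  apply: sub_sigma_algebra; exists n, g; apply/seteqP; split => G /=.
    by case.
  by move=> Gg; split => //; exists H.
suff -> : B g = set0 by [].
by apply/seteqP; split => // G [].
Qed.

Lemma measurable_finitaryE :
  (@measurable _ compN) = <<s [set A | exists n, finitary n A] >>.
Proof.
apply/seteqP; split; last first.
  apply: smallest_sub; first exact: sigma_algebra_measurable.
  by move=> A [n]; exact: finitary_measurable.
apply: smallest_sub; first exact: smallest_sigma_algebra.
move=> _ [n [g ->]]; apply: sub_sigma_algebra; exists n.
exact: cylinder_finitary.
Qed.

Lemma measurable_set1_compN (G : compN) : measurable [set G].
Proof.
have -> : [set G] = \bigcap_n [set H | agree n G H].
  apply/seteqP; split => [H -> n _ //|H GH].
  by apply: compN_ext => i j; rewrite (GH (maxn i j).+1) //; lia.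
apply: bigcapT_measurable => n; apply: (@finitary_measurable n) => H K HK GH i j ni nj.
by rewrite GH// HK.
Qed.

Lemma measurable_pull f : measurable_fun setT (pull f).
Proof.
apply: (measurability [set A | exists n, finitary n A]).
  exact: measurable_finitaryE.
move=> _ [A [n fA] <-]; rewrite setTI.
apply: (@finitary_measurable (\max_(i < n) (f i)).+1).
apply: finitary_pull fA => i ni; rewrite ltnS.
by have /= := @leq_bigmax _ (fun i : 'I_n => f i) (Ordinal ni).
Qed.

(** For n > 0 this is {Gamma_[n] <> 1_n}, by [restr_one]; it is empty for n = 0. A single failing
    comparison is enough: by totality the reverse one then holds, and i, j are in different
    blocks. *)
Definition nontriv n : set compN :=
  [set G | exists i j, [/\ (i < n)%N, (j < n)%N & ~~ G i j]].

Lemma nontriv_finitary n : finitary n (nontriv n).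
Proof.
by move=> G H GH [i [j [ni nj Gij]]]; exists i, j; split => //; rewrite -GH.
Qed.

Lemma nontriv_measurable n : measurable (nontriv n).
Proof. exact: finitary_measurable (@nontriv_finitary n). Qed.

Lemma nontriv_leq m n : (m <= n)%N -> nontriv m `<=` nontriv n.
Proof.
move=> mn G [i [j [im jm Gij]]]; exists i, j.
by split => //; exact: leq_trans mn.
Qed.

Lemma bigcup_nontriv : \bigcup_n nontriv n = ~` [set one_compN].
Proof.
apply/seteqP; split => [G [n _ [i [j [_ _ Gij]]]] /= G1|G /= G1].
  by move: Gij; rewrite G1.
apply: contrapT => nG; apply: G1; apply: compN_ext => i j /=.
apply: contrapT => /negP Gij; apply: nG.
by exists (maxn i j).+1 => //; exists i, j; split => //; lia.
Qed.

Lemma restr_one n (G : compN) : (0 < n)%N ->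
  restr n G != [:: [set: 'I_n]%SET] <-> nontriv n G.
Proof.
move=> n0.
have one : restr n one_compN = [:: [set: 'I_n]%SET].
  rewrite /restr.
  have undup1 (T : eqType) (x : T) t : t != [::] -> all (pred1 x) t -> undup t = [:: x].
    elim: t => //= y t IH _ /andP[/eqP -> tx]; case: ifPn => [xt|xt].
      by apply: IH => //; case: t xt {tx}.
    by case: t xt tx {IH} => //= z t; rewrite inE negb_or eq_sym => /andP[/negbTE ->].
  apply: undup1.
    rewrite -size_eq0 size_map size_sort size_enum_ord; lia.
  by apply/allP => _ /mapP[i _ ->]; apply/eqP/setP => j; rewrite !inE.
rewrite -one; split => [|[i [j [ni nj Gij]]]]; last first.
  by apply/eqP => /restr_agree/(_ _ _ ni nj); rewrite (negbTE Gij).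
apply: contra_neqP => nG; apply/restr_agree => i j ni nj /=.
by apply: contrapT => /negP Gij; apply: nG; exists i, j.
Qed.

(** Permutations of N with finite support; surjectivity follows, see [finperm_surj]. *)
Definition finperm (f : nat -> nat) : Prop :=
  injective f /\ exists N, forall n, (N <= n)%N -> f n = n.

Lemma finperm_lt f N : injective f -> (forall n, (N <= n)%N -> f n = n) ->
  forall i, (i < N)%N -> (f i < N)%N.
Proof.
move=> fI fN i iN; rewrite ltnNge; apply/negP => Nfi.
by have := fI _ _ (fN _ Nfi); lia.
Qed.

Definition perm_nat n (s : {perm 'I_n}) (i : nat) : nat :=
  if insub i is Some j then s j else i.

Lemma perm_nat_ord n (s : {perm 'I_n}) (i : 'I_n) : perm_nat s i = s i.
Proof. by rewrite /perm_nat valK. Qed.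

Lemma perm_nat_ge n (s : {perm 'I_n}) i : (n <= i)%N -> perm_nat s i = i.
Proof. by move=> ni; rewrite /perm_nat insubF// ltnNge ni. Qed.

Lemma perm_nat_finperm n (s : {perm 'I_n}) : finperm (perm_nat s).
Proof.
split; last by exists n; exact: perm_nat_ge.
have lt i : (perm_nat s i < n)%N = (i < n)%N.
  have [ni|ni] := ltnP i n; last by rewrite perm_nat_ge// ltnNge ni.
  by have := ltn_ord (s (Ordinal ni)); rewrite -(perm_nat_ord s (Ordinal ni)).
move=> i j ij; have := lt i; rewrite ij lt.
have [nj|nj] := ltnP j n => /esym ni; last first.
  by move: ij; rewrite !perm_nat_ge// leqNgt ni.
move: ij; rewrite (perm_nat_ord s (Ordinal nj)).
rewrite (perm_nat_ord s (Ordinal ni)) => /val_inj/perm_inj.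
by move=> /(congr1 val).
Qed.

Lemma finperm_perm f N : injective f -> (forall n, (N <= n)%N -> f n = n) ->
  exists s : {perm 'I_N}, forall i : 'I_N, f (s i) = i.
Proof.
move=> fI fN; pose g (i : 'I_N) := Ordinal (finperm_lt fI fN (ltn_ord i)).
have gI : injective g by move=> i j /(congr1 val) /fI /val_inj.
by exists (perm gI)^-1%g => i; rewrite -{2}[i](permKV (perm gI)) permE.
Qed.

Lemma finperm_surj f : finperm f -> forall i, exists j, f j = i.
Proof.
move=> [fI [N fN]] i; have [iN|/fN fi] := ltnP i N; last by exists i.
have [s fs] := finperm_perm fI fN.
by exists (s (Ordinal iN)); rewrite fs.
Qed.

(** The values form a finite type, so that its level sets cut a finitary event into finitely many
    disjoint atoms. *)
Definition cle_mat n (G : compN) : {ffun 'I_n * 'I_n -> bool} :=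
  [ffun p : 'I_n * 'I_n => G p.1 p.2].

Lemma cle_mat_agree n (G H : compN) : cle_mat n G = cle_mat n H <-> agree n G H.
Proof.
split => [/ffunP GH i j ni nj|GH].
  by have := GH (Ordinal ni, Ordinal nj); rewrite !ffunE.
by apply/ffunP => p; rewrite !ffunE GH.
Qed.

Lemma finitary_bigcup n (A : set compN) : finitary n A ->
  A = \bigcup_(x in cle_mat n @` A) [set G | cle_mat n G = x].
Proof.
move=> fA; apply/seteqP; split => [G AG|G [_ [H AH <-] /= /cle_mat_agree HG]].
  by exists (cle_mat n G) => //; exists G.
exact: fA (agree_sym HG) AH.
Qed.

Section exchangeable_pull.
Variables (R : realType) (mu : {measure set compN -> \bar R}).

(** Exchangeability is a statement about single cylinders. Each atom of A is such a cylinder, and f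
    permutes [M] once M bounds its support. *)
Lemma exchangeable_pull : exchangeable mu ->
  forall f n A, finperm f -> finitary n A -> mu (pull f @^-1` A) = mu A.
Proof.
(* M bounds both the indices used by A and the support of f; the successor makes it positive, as
   [exchangeable] requires. *)
move=> emu f n A [fI [N fN]] fA; pose M := (maxn n N).+1.
have fM m : (M <= m)%N -> f m = m by move=> ?; apply: fN; lia.
have {}fA : finitary M A by apply: finitary_leq fA; lia.
have cyl (x : {ffun 'I_M * 'I_M -> bool}) : finitary M [set G : compN | cle_mat M G = x].
  by move=> G H /cle_mat_agree GH /=; rewrite GH.
have tri (F : compN -> compN) :
    trivIset (cle_mat M @` A) (fun x => [set G | cle_mat M (F G) = x]).
  by move=> x y _ _ [G [/= <- <-]].
rewrite [in RHS](finitary_bigcup fA) [in LHS](finitary_bigcup fA) preimage_bigcup.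
rewrite !measure_fin_bigcup//; last 5 first.
- exact: finite_finset.
- by move=> x _; apply: finitary_measurable (cyl x).
- exact: finite_finset.
- exact: (tri (pull f)).
- move=> x _; apply: (@finitary_measurable M); apply: finitary_pull (cyl x).
  exact: finperm_lt.
apply: eq_fsbigr => x /set_mem[G _ <-].
have -> : [set H | cle_mat M H = cle_mat M G] = [set H | restr M H = restr M G].
  apply/seteqP; split => H /= => [/cle_mat_agree/restr_agree//|].
  by move=> /restr_agree/cle_mat_agree.
have [s fs] := finperm_perm fI fM.
apply: etrans (esym (emu M (s^-1)%g _ isT (restr_is_composition M G))).
congr (mu _).
apply/seteqP; split => H /=.
  move=> <-; rewrite (restr_pull _ fs) -map_comp.
  rewrite -[LHS]map_id; apply: eq_map => B /=; rewrite -imset_comp.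
  by rewrite -[LHS]imset_id; apply: eq_imset => i /=; rewrite permK.
move=> HG; rewrite (restr_pull _ fs) HG -map_comp.
rewrite -[RHS]map_id; apply: eq_map => B /=; rewrite -imset_comp.
by rewrite -[RHS]imset_id; apply: eq_imset => i /=; rewrite permKV.
Qed.

Lemma pull_exchangeable :
  (forall f A, finperm f -> measurable A -> mu (pull f @^-1` A) = mu A) ->
  exchangeable mu.
Proof.
move=> pmu n s g n0 _.
rewrite -(pmu _ [set G | restr n G = map _ g] (perm_nat_finperm s^-1%g)); last first.
  exact: finitary_measurable (@cylinder_finitary _ _).
congr (mu _); apply/seteqP; split => G /=.
  by move=> <-; apply: restr_pull => i; rewrite perm_nat_ord permK.
rewrite (@restr_pull _ _ s) => [|i]; last by rewrite perm_nat_ord permK.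
apply: inj_map; apply: imset_inj; exact: perm_inj.
Qed.

End exchangeable_pull.

(** The sets [nontriv n], of finite mass, exhaust only the complement of [one_compN]. The singleton
    is therefore added to the pi-system and to the exhausting sequence, and its mass has to be
    compared separately. *)
Lemma compN_measure_unique (R : realType) (m1 m2 : {measure set compN -> \bar R}) :
  (forall n A, finitary n A -> m1 A = m2 A) ->
  m1 [set one_compN] = m2 [set one_compN] ->
  (m1 [set one_compN] < +oo)%E -> (forall n, m1 (nontriv n) < +oo)%E ->
  forall A, measurable A -> m1 A = m2 A.
Proof.
move=> fin one oneoo ntoo A mA.
pose GG : set (set compN) := [set A | (exists n, finitary n A) \/ A = [set one_compN]].
pose g k := if k is n.+1 then nontriv n else [set one_compN].
apply: (@measure_unique _ _ _ GG g) => //.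
- rewrite measurable_finitaryE; apply/seteqP; split.
    apply: sub_smallest2r; first exact: smallest_sigma_algebra.
    by move=> B ?; left.
  rewrite -measurable_finitaryE; apply: smallest_sub.
    exact: sigma_algebra_measurable.
  move=> B [[n /finitary_measurable//]|->]; exact: measurable_set1_compN.
- have one1 n B : finitary n B -> GG ([set one_compN] `&` B).
    move=> fB; have [B1|B1] := pselect (B one_compN).
      by right; apply/seteqP; split => G; [case|move=> ->].
    left; exists 0%N; suff -> : [set one_compN] `&` B = set0 by [].
    by apply/seteqP; split => G // [-> ].
  move=> B C [[n fB]|->] [[m fC]|->].
  + left; exists (maxn n m).
    by apply: finitaryI; [apply: finitary_leq fB|apply: finitary_leq fC]; lia.
  + by rewrite setIC; exact: one1 fB.
  + exact: one1 fC.
  + by right; rewrite setIid.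
- by case=> [|n]; [right|left; exists n; exact: nontriv_finitary].
- apply/seteqP; split => // G _.
  have [->|/eqP G1] := eqVneq G one_compN; first by exists 0%N.
  have : (~` [set one_compN]) G by [].
  by rewrite -bigcup_nontriv => -[n _ Gn]; exists n.+1.
- by move=> B [[n fB]|-> //]; exact: fin fB.
- by case.
Qed.

Section fragmentation.
Variables (R : realType) (mu : {measure set compN -> \bar R}).
Hypothesis fmu : fragmentation_measure mu.

Lemma frag_nontriv n : (mu (nontriv n) < +oo)%E.
Proof.
case: fmu => _ _ fin; case: n => [|n].
  have -> : nontriv 0 = set0 by apply/seteqP; split => // G [i [j []]].
  by rewrite measure0 ltry.
have := fin n.+1 isT; congr (mu _ < _)%E.
by apply/seteqP; split => G /restr_one; exact.
Qed.

Lemma pull_one f : finperm f -> pull f @^-1` [set one_compN] = [set one_compN].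
Proof.
move=> ff; apply/seteqP; split => [G /= fG|G /= ->]; last exact: compN_ext.
apply: compN_ext => i j.
have [k <-] := finperm_surj ff i; have [l <-] := finperm_surj ff j.
by have /= -> := congr1 (fun H : compN => H k l) fG.
Qed.

(** Exchangeability extends from finitary to measurable events by uniqueness, applied to mu and its
    image under [pull f]; both vanish on [one_compN], which [pull f] fixes. *)
Lemma frag_pull f A : finperm f -> measurable A -> mu (pull f @^-1` A) = mu A.
Proof.
case: (fmu) => emu one0 _ ff mA; apply/esym.
apply: (@compN_measure_unique R mu (pushforward mu (pull f))).
- exact: measurable_pull.
- move=> mf n B fB; rewrite /= (_ : pushforward _ _ _ = mu B)//.
  exact: exchangeable_pull emu _ _ _ ff fB.
- by move=> mf; rewrite /= /pushforward pull_one.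
- by rewrite one0 ltry.
- exact: frag_nontriv.
- by [].
Qed.

End fragmentation.

Section eps_exchangeable.
Variable R : realType.

(** A finite permutation only permutes the atoms, hence reindexes the sum of Dirac masses. *)
Lemma mseries_dirac_exchangeable (e : nat -> compN) :
  (forall f i, finperm f -> pull f (e (f i)) = e i) ->
  exchangeable (mseries (fun i => @dirac _ compN (e i) R) 0).
Proof.
move=> fe; apply: pull_exchangeable => f A ff mA.
have mE B : mseries (fun i => @dirac _ compN (e i) R) 0 B =
    (\esum_(i in setT) \d_(e i) B)%E by rewrite -nneseries_esumT.
apply: etrans (etrans (mE _) _) (esym (mE _)).
rewrite [LHS](@reindex_esum _ _ _ setT setT f); last first.
  split => // [i j _ _|i _]; first by case: ff => + _; exact.
  by have [j <-] := finperm_surj ff i; exists j.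
by apply: eq_esum => i _; rewrite !diracE -[in RHS](fe f i ff).

Qed.

Lemma eps_l_exchangeable : exchangeable (eps_l R).
Proof.
apply: mseries_dirac_exchangeable => f i [fI _]; apply: compN_ext => a b /=.
by rewrite !(inj_eq fI).
Qed.

Lemma eps_r_exchangeable : exchangeable (eps_r R).
Proof.
apply: mseries_dirac_exchangeable => f i [fI _]; apply: compN_ext => a b /=.
by rewrite !(inj_eq fI).
Qed.

End eps_exchangeable.

(** * The metric space of open sets *)

Section hausdorff.
Variable R : realType.
Implicit Types U V : open01 R.

Lemma cvg_dist01 (F : nat -> open01 R) U :
  F @ \oo --> U <->
  forall e, 0 < e -> exists N, forall n, (N <= n)%N -> dist01 U (F n) < e.
Proof.
split => [/cvg_ballP FU e e0|FU].
  by have [N _ FN] := FU e e0; exists N => n /FN.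
by apply/cvg_ballP => e e0; have [N FN] := FU e e0; exists N.
Qed.

Lemma chi_dist_le U V x : x \in `[0, 1] -> chi V x <= chi U x + dist01 U V.
Proof. by move=> /(dist01_ge U V); rewrite ler_norml => /andP[+ _]; lra. Qed.

Lemma chi_lt U x r : chi U x < r -> exists2 y, (`[0, 1] `\` U) y & `|x - y| < r.
Proof.
have S0 : [set `|x - y| | y in `[0, 1] `\` U] !=set0.
  by exists `|x - 0|, 0 => //; exact: compl01_0.
by move=> /(inf_lt S0)[_ [y Uy <-] xy]; exists y.
Qed.

Lemma chi_le U x y : (`[0, 1] `\` U) y -> chi U x <= `|x - y|.
Proof. by move=> Uy; apply: (ge_inf (chi_lbound U x)); exists y. Qed.

Lemma chi_eq0 U x : (`[0, 1] `\` U) x -> chi U x = 0.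
Proof.
move=> Ux; apply/eqP; rewrite eq_le chi_ge0 andbT.
by rewrite -[leRHS](normr0 R) -(subrr x); exact: chi_le.
Qed.

Lemma chi_gt0 U x : oset U x -> 0 < chi U x.
Proof.
move=> Ux; have /nbhs_ballP[e /= e0 eU] : nbhs x (oset U).
  by apply: open_nbhs_nbhs; split => //; exact: oset_open.
apply: lt_le_trans e0 _; rewrite leNgt; apply/negP => /chi_lt[y [_ Uy] xy].
exact/Uy/eU.
Qed.

Lemma chi_lip U x y : chi U x <= chi U y + `|x - y|.
Proof.
rewrite -lerBlDr leNgt; apply/negP => /chi_lt[z Uz yz].
have := chi_le x Uz; have := ler_distD y x z; lra.
Qed.

Lemma lipschitz1_continuous (f : R -> R) :
  (forall x y, f x <= f y + `|x - y|) -> continuous f.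
Proof.
move=> lf x; apply/cvgrPdist_lt => e e0; near=> y.
have xy : `|x - y| < e by near: y; exact: (@cvgr_dist_lt _ _ _ (nbhs x) _ idfun x).
rewrite ltr_norml; have := lf x y; have := lf y x; rewrite (distrC y x); lra.
Unshelve. all: by end_near.
Qed.

Lemma chi_continuous U : continuous (chi U).
Proof. exact/lipschitz1_continuous/chi_lip. Qed.

(** [chi U] is the distance to the complement of U, so [dist01] is controlled by the Hausdorff
    distance between complements. Nearly every later estimate of [dist01] goes through this;
    [dist01_near] is the converse. *)
Lemma dist01_hausdorff U V h :
  (forall y, (`[0, 1] `\` U) y -> exists2 z, (`[0, 1] `\` V) z & `|y - z| <= h) ->
  (forall y, (`[0, 1] `\` V) y -> exists2 z, (`[0, 1] `\` U) z & `|y - z| <= h) ->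
  dist01 U V <= h.
Proof.
have sub U1 V1 x : (forall y, (`[0, 1] `\` U1) y ->
    exists2 z, (`[0, 1] `\` V1) z & `|y - z| <= h) -> chi V1 x - h <= chi U1 x.
  move=> UV; rewrite leNgt; apply/negP => /chi_lt[y /UV[z Vz yz] xy].
  have := chi_le x Vz; have := ler_distD y x z; lra.
move=> UV VU; apply: dist01_le => x _; rewrite ler_norml.
by have := sub _ _ x UV; have := sub _ _ x VU; lra.
Qed.

Lemma dist01_near U V y r : dist01 U V < r -> (`[0, 1] `\` U) y ->
  exists2 z, (`[0, 1] `\` V) z & `|y - z| < r.
Proof.
move=> UV Uy; apply: chi_lt; apply: le_lt_trans UV.
by have [y01 _] := Uy; have := chi_dist_le U V y01; rewrite (chi_eq0 Uy) add0r.
Qed.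

(** [chi U] has a positive minimum on the compact segment, and an open set closer to U than this
    minimum cannot miss a point of the segment. *)
Lemma open01_itv_stable U a b : (forall c, a <= c <= b -> oset U c) ->
  exists2 e, 0 < e & forall V, dist01 U V < e -> forall c, a <= c <= b -> oset V c.
Proof.
move=> abU; have [ab|ba] := leP a b; last first.
  by exists 1 => // V _ c /andP[ac cb]; lra.
have [c cab cmin] := EVT_min ab (continuous_subspaceT (@chi_continuous U)).
have Uc : oset U c by apply: abU; move: cab; rewrite in_itv.
exists (chi U c); first exact: chi_gt0.
move=> V UV x abx; have Ux := abU _ abx.
have x01 : x \in `[0, 1] by apply: subset_itv_oo_cc; exact: oset_sub Ux.
apply: contrapT => Vx.
have Vx0 : chi V x = 0 by apply: chi_eq0; split.
have := chi_dist_le V U x01; rewrite Vx0 add0r dist01_sym => xc.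
have := cmin x; rewrite in_itv /= => /(_ abx); lra.
Qed.

(** The functions [chi (V n)] converge uniformly on [0, 1] to some f, and the limit set consists of
    the points of ]0, 1[ where f does not vanish. The work is to find a zero of f near each point of
    the complement of [V n]. *)
Lemma open01_complete (V : nat -> open01 R) :
  (forall e, 0 < e -> exists N, forall m n, (N <= m)%N -> (N <= n)%N ->
    dist01 (V m) (V n) < e) ->
  exists U, V @ \oo --> U.
Proof.
move=> cV.
(* The Cauchy estimate holds only on [0, 1]; composing with the projection onto [0, 1] gives a limit
   defined and 1-Lipschitz on all of R. *)
pose clamp (x : R) := Num.min 1 (Num.max 0 x).
have clamp01 x : clamp x \in `[0, 1].
  rewrite in_itv /= /clamp; case: (leP 0 x) => x0; case: (leP 1 _) => x1; lra.
have clampE x : x \in `[0, 1] -> clamp x = x.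
  rewrite in_itv /= /clamp; case: (leP 0 x) => x0; case: (leP 1 _) => x1; lra.
have clamp_lip x y : `|clamp x - clamp y| <= `|x - y|.
  rewrite /clamp; have := ler_norm (x - y); have := ler_norm (y - x).
  rewrite (distrC y x) ler_norml.
  by case: (leP 0 x) => ?; case: (leP 1 _) => ?;
    case: (leP 0 y) => ?; case: (leP 1 _) => ?; lra.
pose g x n := chi (V n) (clamp x).
have cg x : cvgn (g x).
  apply/cauchy_cvgP/cauchy_ballP => e e0; have [N VN] := cV e e0.
  exists (g x @` [set n | (N <= n)%N], g x @` [set n | (N <= n)%N]).
    by split; exists N => // n Nn; exists n.
  move=> [_ _] /= [[m Nm <-] [n Nn <-]].
  by apply: (le_lt_trans (dist01_ge _ _ (clamp01 x))); exact: VN.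
pose f x := limn (g x).
have fle e N : (forall m n, (N <= m)%N -> (N <= n)%N -> dist01 (V m) (V n) < e) ->
    forall n x, (N <= n)%N -> x \in `[0, 1] -> `|f x - chi (V n) x| <= e.
  move=> VN n x Nn x01.
  have gx : (fun m => `|g x m - chi (V n) x|) @ \oo --> `|f x - chi (V n) x|.
    by apply: cvg_norm; apply: cvgB; [exact: cg|exact: cvg_cst].
  apply: (ler_cvg_to gx (cvg_cst e)); exists N => // m /= Nm.
  by rewrite /g clampE//; apply: le_trans (dist01_ge _ _ x01) (ltW (VN _ _ Nm Nn)).
have f_lip x y : f x <= f y + `|x - y|.
  have gxy : (fun n => g y n + `|x - y|) @ \oo --> f y + `|x - y|.
    by apply: cvgD; [exact: cg|exact: cvg_cst].
  apply: (ler_cvg_to (cg x) gxy); near=> n.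
  by apply: (le_trans (chi_lip (V n) (clamp x) (clamp y))); rewrite lerD2l.
have fc := lipschitz1_continuous f_lip.
have f01 y : (forall n, (`[0, 1] `\` V n) y) -> f y = 0.
  move=> Vy; have [y01 _] := Vy 0%N.
  apply: cvg_lim => //; apply: cvg_near_cst; near=> n.
  by rewrite /g clampE// chi_eq0.
pose K : set R := `]0, 1[ `&` [set x | f x != 0].
have Ko : open K.
  apply: openI; first exact: interval_open.
  have -> : [set x | f x != 0] = f @^-1` [set~ 0].
    by apply/seteqP; split => x /= /eqP.
  by apply: open_comp => [x _|]; [exact: fc|exact/closed_openC/closed_eq].
pose U := Open01 Ko (@subIsetl _ _ _).
have UE y : (`[0, 1] `\` U) y <-> y \in `[0, 1] /\ f y = 0.
  split=> [[y01 Uy]|[y01 fy]]; last by split => // -[_ /=]; rewrite fy eqxx.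
  split => //; have [->|y0] := eqVneq y 0.
    by apply: f01 => n; exact: compl01_0.
  have [->|y1] := eqVneq y 1.
    apply: f01 => n; split; first by rewrite /= in_itv /= ler01 lexx.
    by move=> /oset_sub; rewrite /= in_itv /= ltxx andbF.
  apply: contrapT => /eqP fy; apply: Uy; split => //=.
  move: y01; rewrite /= !in_itv /= => /andP[].
  by rewrite !le_eqVlt (negbTE y1) eq_sym (negbTE y0) /= => -> ->.
exists U; apply/cvg_dist01 => e e0.
have [N VN] := cV (e / 5) ltac:(lra).
exists N => n Nn; apply: (@le_lt_trans _ _ (e / 2)); last by lra.
have fn := fle _ _ VN.
apply: dist01_hausdorff => [y /UE[y01 fy]|x Vx].
  have yn : chi (V n) y < e / 2.
    by have := fn n y Nn y01; rewrite fy sub0r normrN ler_norml; lra.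
  have [z] := chi_lt yn.
  by exists z => //; exact: ltW.
have [x01 _] := Vx.
have fx : f x <= e / 5.
  by have := fn n x Nn x01; rewrite (chi_eq0 Vx) subr0 ler_norml => /andP[].
(* [a, b] is the window of radius e / 2 around x inside [0, 1]. If the minimum [f z] over it were
   positive, a later [V m] would have a complement point y in the window, and [f y <= f z / 2] would
   contradict minimality. *)
pose a := Num.max 0 (x - e / 2); pose b := Num.min 1 (x + e / 2).
have ab y : (y \in `[a, b]) = (y \in `[0, 1]) && (`|x - y| <= e / 2).
  rewrite !in_itv /= /a /b ge_max le_min ler_norml; apply/idP/idP => ?; lra.
have xab : x \in `[a, b] by rewrite ab x01 subrr normr0; lra.
have aleb : a <= b by move: xab; rewrite in_itv => /andP[]; exact: le_trans.
have [z zab zmin] := EVT_min aleb (continuous_subspaceT fc).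
have /andP[z01 xz] : (z \in `[0, 1]) && (`|x - z| <= e / 2) by rewrite -ab.
exists z => //; apply/UE; split => //; apply: contrapT => /eqP fz.
have fz0 : 0 < f z.
  rewrite lt_def fz; apply: limr_ge; first exact: cg.
  by near=> m; exact: chi_ge0.
have d0 : 0 < Num.min (f z / 2) (e / 8) by rewrite lt_min; lra.
have [M VM] := cV _ d0.
pose m := maxn N M.
have xm : chi (V m) x < e / 2.
  by have := fle _ _ VN m x (leq_maxl _ _) x01; rewrite ler_norml; lra.
have [y Vy xy] := chi_lt xm.
have [y01 _] := Vy.
have := fle _ _ VM m y (leq_maxr _ _) y01; rewrite (chi_eq0 Vy) subr0 => fy.
have := zmin y; rewrite ab y01 (ltW xy) => /(_ isT).
move: fy; rewrite le_min => /andP[+ _]; rewrite ler_norml; lra.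
Unshelve. all: by end_near.
Qed.

End hausdorff.

(** * The open set of a finite composition *)

Definition count_lt n (p : pred nat) : nat := count p (iota 0 n).

Lemma card_count_lt n (p : pred nat) : #|[set j : 'I_n | p j]%SET| = count_lt n p.
Proof. by rewrite cardsE cardE size_filter /count_lt -val_enum_ord count_map enumT. Qed.

Lemma count_lt_leq n p : (count_lt n p <= n)%N.
Proof. by rewrite -{2}(size_iota 0 n) count_size. Qed.

Lemma count_lt_sub n (p q : pred nat) :
  (forall j, (j < n)%N -> p j -> q j) -> (count_lt n p <= count_lt n q)%N.
Proof.
move=> pq; rewrite -!card_count_lt; apply: subset_leq_card; apply/fintype.subsetP => j.
by rewrite !inE; exact: pq.
Qed.

Lemma count_lt_lt n (p q : pred nat) j : (j < n)%N -> q j -> ~~ p j ->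
  (forall j, (j < n)%N -> p j -> q j) -> (count_lt n p < count_lt n q)%N.
Proof.
move=> jn qj pj pq; rewrite -!card_count_lt; apply: proper_card; apply/properP; split.
  by apply/fintype.subsetP => k; rewrite !inE; exact: pq.
by exists (Ordinal jn); rewrite inE.
Qed.

Lemma count_lt_eq n (p q : pred nat) :
  (forall j, (j < n)%N -> p j = q j) -> count_lt n p = count_lt n q.
Proof. by move=> pq; apply/eqP; rewrite eqn_leq !count_lt_sub// => j /pq ->. Qed.

Lemma sumn_take_restr n (G : compN) k : (k <= size (restr n G))%N ->
  sumn (take k [seq #|B| | B : {set 'I_n} <- restr n G]) =
  #|[set j : 'I_n | (find (fun B : {set 'I_n} => j \in B) (restr n G) < k)%N]%SET|.
Proof.
set s := restr n G => ks; pose fd (j : 'I_n) := find (fun B : {set 'I_n} => j \in B) s.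
elim: k ks => [|k IH] ks.
  rewrite take0; apply/esym/eqP; rewrite cards_eq0.
  by apply/eqP/setP => j; rewrite !inE.
have nthE : nth finset.set0 s k = [set j | fd j == k]%SET.
  apply/setP => j; rewrite inE.
  have /mem_restr[i Bi] : nth finset.set0 s k \in s by exact: mem_nth.
  have hj : has (fun B : {set 'I_n} => j \in B) s.
    by apply/hasP; exists (block_of G j); [apply/mem_restr; exists j|rewrite inE cle_refl].
  apply/idP/eqP => [jB|<-]; last exact: nth_find hj.
  have fdj : (fd j < size s)%N by rewrite -has_find.
  apply/eqP; rewrite -(nth_uniq finset.set0 fdj ks) ?undup_uniq//.
  have := nth_find finset.set0 hj.
  have /mem_restr[l Bl] : nth finset.set0 s (fd j) \in s by exact: mem_nth.
  rewrite -/(fd j) Bl Bi in jB *; move: jB.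
  rewrite !inE => /andP[ij ji] /andP[lj jl].
  apply/eqP/setP => m; rewrite !inE; apply/idP/idP => /andP[a b].
    by rewrite (cle_trans ij (cle_trans jl a)) (cle_trans (cle_trans b lj) ji).
  by rewrite (cle_trans lj (cle_trans ji a)) (cle_trans (cle_trans b ij) jl).
rewrite (take_nth 0%N) ?size_map// -cats1 sumn_cat IH; last exact: ltnW.
rewrite /= addn0 (nth_map finset.set0)// nthE.
rewrite -cardsUI [X in (_ + X)%N](_ : _ = 0%N) ?addn0; last first.
  apply/eqP; rewrite cards_eq0; apply/eqP/setP => j; rewrite !inE -/(fd j).
  by case: ltngtP.
by apply: eq_card => j; rewrite !inE -/(fd j) ltnS orbC -leq_eqVlt.
Qed.

Section Un_geometry.
Variable R : realType.

(** The interval of the block of i runs from the number of indices strictly before i to the number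
    of indices before or tied with i, both divided by n. From here on, block lists give way to
    counts. *)
Lemma Un_setP n (G : compN) (x : R) : Un_set n G x <->
  exists2 i, (i < n)%N &
    (count_lt n (fun j => ~~ G i j))%:R / n%:R < x < (count_lt n (fun j => G j i))%:R / n%:R.
Proof.
set s := restr n G; pose fd (j : 'I_n) := find (fun B : {set 'I_n} => j \in B) s.
have fdE (i j : 'I_n) : G i j = (fd i <= fd j)%N by exact: restr_find.
have hasP (k : 'I_n) : has (fun B : {set 'I_n} => k \in B) s.
  by apply/hasP; exists (block_of G k); [apply/mem_restr; exists k|rewrite inE cle_refl].
have fds (i : 'I_n) : (fd i < size s)%N by rewrite -has_find.
have lo (i : 'I_n) : sumn (take (fd i) [seq #|B| | B : {set 'I_n} <- s]) =
    count_lt n (fun j => ~~ G i j).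
  rewrite sumn_take_restr; last exact: ltnW.
  by rewrite -card_count_lt; apply: eq_card => j; rewrite !inE fdE -ltnNge.
have hi (i : 'I_n) : sumn (take (fd i).+1 [seq #|B| | B : {set 'I_n} <- s]) =
    count_lt n (fun j => G j i).
  rewrite sumn_take_restr//.
  by rewrite -card_count_lt; apply: eq_card => j; rewrite !inE fdE.
split => [[k /=]|[i ni]].
  rewrite size_map -/s => ks.
  have /mem_restr[i Bi] : nth finset.set0 s k \in s by exact: mem_nth.
  have -> : k = fd i.
    have : i \in nth finset.set0 s k by rewrite Bi inE cle_refl.
    have := nth_find finset.set0 (hasP i).
    have /mem_restr[l Bl] : nth finset.set0 s (fd i) \in s by exact: mem_nth.
    rewrite -/(fd i) => ifd ik.
    apply/eqP; rewrite -(nth_uniq finset.set0 ks (fds i)) ?undup_uniq//.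
    move: ifd ik; rewrite Bl Bi; rewrite !inE => /andP[lj jl] /andP[ij ji].
    apply/eqP/setP => m; rewrite !inE; apply/idP/idP => /andP[a b].
      by rewrite (cle_trans lj (cle_trans ji a)) (cle_trans (cle_trans b ij) jl).
    by rewrite (cle_trans ij (cle_trans jl a)) (cle_trans (cle_trans b lj) ji).
  rewrite in_itv /= lo hi => xi; exists i => //.
move=> xi; exists (fd (Ordinal ni)); first by rewrite /= size_map.
by rewrite /= in_itv /= lo hi.
Qed.

Definition downset (G : compN) (D : pred nat) : Prop :=
  forall a b, D b -> G a b -> D a.

(** With [compl_Un_count_lt]: for n > 0, the complement of U_n in [0, 1] is exactly the set of
    fractions #(D in [n]) / n, D a down-set of G. Such a count cannot fall strictly inside a block,
    which D contains entirely or not at all. *)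
Lemma count_lt_compl_Un n (G : compN) (D : pred nat) : downset G D ->
  (`[0, 1] `\` Un R n G) ((count_lt n D)%:R / n%:R).
Proof.
move=> dD; split.
  rewrite /= in_itv /= divr_ge0//=; case: n => [|n]; first by rewrite invr0 mulr0.
  by rewrite ler_pdivrMr ?ltr0n// mul1r ler_nat count_lt_leq.
move=> /Un_setP[i ni /andP[]]; have n0 : (0 : R) < n%:R by rewrite ltr0n; lia.
rewrite !ltr_pM2r ?invr_gt0// !ltr_nat => lo hi.
have [Di|Di] := boolP (D i).
  have : (count_lt n (fun j => G j i) <= count_lt n D)%N; last by lia.
  by apply: count_lt_sub => j _; exact: dD.
have : (count_lt n D <= count_lt n (fun j => ~~ G i j))%N; last by lia.
by apply: count_lt_sub => j _ Dj; apply: contra Di; exact: dD.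
Qed.

(** D collects the indices whose block ends at or before z. *)
Lemma compl_Un_count_lt n (G : compN) (z : R) : (0 < n)%N -> (`[0, 1] `\` Un R n G) z ->
  exists2 D : pred nat, downset G D & z = (count_lt n D)%:R / n%:R.
Proof.
move=> n0 [/= z01 Uz]; have n0' : (0 : R) < n%:R by rewrite ltr0n.
pose lo i := count_lt n (fun j => ~~ G i j); pose hi i := count_lt n (fun j => G j i).
pose D : pred nat := fun j => (hi j)%:R / n%:R <= z :> R.
have dD : downset G D.
  move=> a b; rewrite /D => Db ab; apply: le_trans Db.
    apply: ler_wpM2r; first by rewrite invr_ge0 ltW.
  rewrite ler_nat; apply: count_lt_sub => j _ ja.
  exact: cle_trans ja ab.
exists D => //; apply/eqP; rewrite eq_le; apply/andP; split.
  have [/forallP all|/forallPn[i0 Di0]] := boolP [forall i : 'I_n, D i].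
    have -> : count_lt n D = n.
      rewrite -[RHS](card_ord n) -cardsT -card_count_lt; apply: eq_card => j.
      by rewrite !inE all.
    by rewrite divff ?lt0r_neq0//; move: z01; rewrite in_itv => /andP[].
  (* This index lies in the first block outside D. Its interval ends after z and does not contain z,
     so it starts at or after z; and all that comes strictly before it belongs to D. *)
  pose i := [arg min_(i < i0 | ~~ D i) lo i]%N.
  have [Di loi] : ~~ D i /\ forall j : 'I_n, ~~ D j -> (lo i <= lo j)%N.
    by rewrite /i; case: arg_minnP.
  have lozi : z <= (lo i)%:R / n%:R.
    rewrite leNgt; apply: contra_notN Uz => zi; apply/Un_setP; exists i => //.
    by rewrite zi /=; move: Di; rewrite /D -ltNge.
  apply: le_trans lozi _; apply: ler_wpM2r; first by rewrite invr_ge0 ltW.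
  rewrite ler_nat.
  apply: count_lt_sub => j jn; apply: contraNT => Dj.
  have := loi (Ordinal jn) Dj; apply: contraTT => ij.
  rewrite -ltnNge; apply: (@count_lt_lt _ _ _ j) => //.
    by rewrite /= cle_refl.
  move=> k _; apply: contra => ik; apply: cle_trans ik.
  by have := cle_total G i j; rewrite (negbTE ij).
have [/forallP all|/forallPn[i0 /negPn Di0]] := boolP [forall i : 'I_n, ~~ D i].
  have -> : count_lt n D = 0%N.
    by rewrite -card_count_lt; apply: eq_card0 => j; rewrite !inE; apply/negbTE/all.
  by rewrite mul0r; move: z01; rewrite in_itv => /andP[].
(* An index of the last block inside D: that block ends at or before z, and D has no element beyond
   it. *)
pose i := [arg max_(i > i0 | D i) hi i]%N.
have [Di hii] : D i /\ forall j : 'I_n, D j -> (hi j <= hi i)%N.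
  by rewrite /i; case: arg_maxnP.
move: (Di); rewrite {1}/D; apply: le_trans; apply: ler_wpM2r; first by rewrite invr_ge0 ltW.
rewrite ler_nat.
apply: count_lt_sub => j jn Dj; have := hii (Ordinal jn) Dj; apply: contraTT => ji.
rewrite -ltnNge; have ij : G i j by have := cle_total G i j; rewrite (negbTE ji) orbF.
apply: (@count_lt_lt _ _ _ j) => //; first exact: cle_refl.
by move=> k _ ki; exact: cle_trans ki ij.
Qed.

(** Cuts are matched through down-sets. If D is a down-set of G, then [D \o f] is one of [pull f G];
    conversely a down-set of [pull f G] is [D' \o f], with D' the down-set of G generated by its
    image under f. The counts differ by at most k. *)
Lemma dist01_pull n k f (G : compN) : (0 < n)%N ->
  (forall p, (count_lt n p <= count_lt n (p \o f) + k)%N) ->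
  (forall p, (count_lt n (p \o f) <= count_lt n p + k)%N) ->
  dist01 (Un R n (pull f G)) (Un R n G) <= k%:R / n%:R.
Proof.
move=> n0 pf fp; have n0' : (0 : R) < n%:R by rewrite ltr0n.
have close p :
    `|(count_lt n p)%:R / n%:R - (count_lt n (p \o f))%:R / n%:R| <= k%:R / n%:R :> R.
  rewrite -mulrBl normrM normfV (gtr0_norm n0') ler_pM2r ?invr_gt0// ler_norml.
  have := pf p; have := fp p; rewrite -!(ler_nat R) !natrD; lra.
apply: dist01_hausdorff => y /(compl_Un_count_lt n0)[D dD ->].
  pose D' : pred nat := fun a => `[< exists2 b, D b & G a (f b) >].
  have dD' : downset G D'.
    move=> a b /asboolP[c Dc bc] ab; apply/asboolP; exists c => //.
    exact: cle_trans ab bc.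
  exists ((count_lt n D')%:R / n%:R); first exact: count_lt_compl_Un.
  have -> : count_lt n D = count_lt n (D' \o f).
    apply: count_lt_eq => j _ /=; apply/idP/asboolP => [Dj|[b Db jb]].
      by exists j => //; exact: cle_refl.
    exact: dD Db jb.
  by rewrite distrC.
exists ((count_lt n (D \o f))%:R / n%:R); last exact: close.
by apply: count_lt_compl_Un => a b /= Db ab; exact: dD Db ab.
Qed.

Lemma count_lt_finperm f N n (p : pred nat) : injective f ->
  (forall n, (N <= n)%N -> f n = n) -> (N <= n)%N -> count_lt n (p \o f) = count_lt n p.
Proof.
move=> fI fN Nn; rewrite /count_lt -count_map.
suff /seq.permP : perm_eq [seq f i | i <- iota 0 n] (iota 0 n) by exact.
apply: uniq_perm; rewrite ?iota_uniq// ?map_inj_uniq ?iota_uniq//.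
have fn m : (n <= m)%N -> f m = m by move=> ?; apply: fN; lia.
move=> i; rewrite mem_iota /=; apply/mapP/idP => [[j]|ni].
  by rewrite mem_iota /= => /(finperm_lt fI fn) ? ->.
have [s fs] := finperm_perm fI fn.
by exists (val (s (Ordinal ni))); rewrite ?fs// mem_iota /= ltn_ord.
Qed.

Lemma count_lt_shift k n (p : pred nat) :
  (count_lt n p <= count_lt n (p \o addn k) + k)%N /\
  (count_lt n (p \o addn k) <= count_lt n p + k)%N.
Proof.
have e : (count p (iota 0 k) + count_lt n (p \o addn k) =
    count_lt n p + count p (iota n k))%N.
  have -> : count_lt n (p \o addn k) = count p (iota k n).
    by rewrite -[in RHS](addn0 k) iotaDl count_map.
  rewrite /count_lt -!count_cat; have := iotaD 0 k n; have := iotaD 0 n k.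
  by rewrite !add0n addnC => <- ->.
have := count_size p (iota 0 k); have := count_size p (iota n k).
by rewrite !size_iota; lia.
Qed.

Lemma cvg_dist01_eq (F F' : nat -> open01 R) (k : nat) (U : open01 R) :
  (forall n, (0 < n)%N -> dist01 (F n) (F' n) <= k%:R / n%:R) ->
  F @ \oo --> U -> F' @ \oo --> U.
Proof.
move=> FF' /cvg_dist01 FU; apply/cvg_dist01 => e e0.
have [N FN] := FU (e / 2) ltac:(lra).
pose M := (Num.bound (k%:R / (e / 2) : R)).+1; exists (maxn N M) => n Nn.
have n0 : (0 < n)%N by lia.
have n0' : (0 : R) < n%:R by rewrite ltr0n.
have kn : k%:R / n%:R < e / 2.
  rewrite ltr_pdivrMr// mulrC -ltr_pdivrMr; last lra.
  apply: lt_le_trans (_ : M%:R <= _); last by rewrite ler_nat; lia.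
  apply: (@lt_trans _ _ (Num.bound (k%:R / (e / 2)))%:R).
    by apply: archi_boundP; rewrite divr_ge0//; lra.
  by rewrite ltr_nat.
apply: le_lt_trans (dist01_triangle (F n) _ _) _.
have := FN n ltac:(lia); have := FF' n n0; lra.
Qed.

Lemma asymp_finperm f (G : compN) (U : open01 R) : finperm f ->
  is_asymptotic_open (pull f G) U <-> is_asymptotic_open G U.
Proof.
move=> ff; have [fI [N fN]] := ff.
have d n : (0 < n)%N -> dist01 (Un R n (pull f G)) (Un R n G) <= N%:R / n%:R.
  move=> n0; have [Nn|nN] := leqP N n.
    have cE p : count_lt n (p \o f) = count_lt n p by exact: count_lt_finperm fN Nn.
    by apply: dist01_pull => // p; rewrite cE leq_addr.
  apply: dist01_pull => // p; have := count_lt_leq n p; have := count_lt_leq n (p \o f); lia.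
split; apply: cvg_dist01_eq => n n0; first exact: d.
by rewrite dist01_sym; exact: d.
Qed.

Lemma asymp_shift k (G : compN) (U : open01 R) :
  is_asymptotic_open (pull (addn k) G) U <-> is_asymptotic_open G U.
Proof.
have d n : (0 < n)%N -> dist01 (Un R n (pull (addn k) G)) (Un R n G) <= k%:R / n%:R.
  by move=> n0; apply: dist01_pull => // p; have [] := count_lt_shift k n p.
split; apply: cvg_dist01_eq => n n0; first exact: d.
by rewrite dist01_sym; exact: d.
Qed.

End Un_geometry.

(** * Compositions read off from points and an open set *)

Section comp_of_open_geometry.
Variable R : realType.
Implicit Types U V : open01 R.

Lemma connected_component_itvP U (a b : R) : a <= b ->
  connected_component (oset U) a b <-> forall c, a <= c <= b -> oset U c.
Proof.
move=> ab; split=> [ab' c acb|abU].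
  have : connected_component (oset U) a c.
    by apply: component_between ab' _; rewrite acb.
  exact: connected_component_sub.
exists `[a, b]%classic; last by rewrite /= in_itv /= ab lexx.
split; first by rewrite /= in_itv /= lexx ab.
  by move=> c; rewrite /= in_itv; exact: abU.
exact: segment_connected.
Qed.

Lemma open_cle_ltP U (x : nat -> R) i j : x j < x i ->
  open_cle U x i j <-> forall c, x j <= c <= x i -> oset U c.
Proof.
move=> ji; rewrite -connected_component_itvP ?ltW// /open_cle leNgt ji /=.
by split=> [/asboolP|?]; [|apply/asboolP]; exact: connected_component_sym.
Qed.

Lemma le_open_cle U (x : nat -> R) i j : x i <= x j -> open_cle U x i j.
Proof. by rewrite /open_cle => ->. Qed.

(** A deterministic statement: e bounds the discrepancy of the points, with no reference to U. A
    complement point y of U is matched with the down-set of the points at most y. Conversely a cut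
    #D/n is matched with a point separating an element of D from an element outside D, both near the
    cut. *)
Lemma dist01_empirical U (x : nat -> R) n e : (0 < n)%N ->
  (forall t, t \in `[0, 1] -> `|(count_lt n (fun j => x j <= t))%:R / n%:R - t| <= e) ->
  dist01 (Un R n (comp_of_open U x)) U <= e.
Proof.
move=> n0 xe; have n0' : (0 : R) < n%:R by rewrite ltr0n.
have e0 : 0 <= e.
  by apply: le_trans (xe 0 _) => //; rewrite in_itv /= lexx ler01.
apply/ler_addgt0Pr => e1 e10; have : e < e + e1 by lra.
move: (e + e1) => h eh; apply: dist01_hausdorff => y; last first.
  move=> [y01 Uy]; exists ((count_lt n (fun j => x j <= y))%:R / n%:R).
    apply: count_lt_compl_Un => a b /= xb ab; rewrite leNgt; apply/negP => ya.
    have ba : x b < x a by apply: le_lt_trans ya.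
    by apply: Uy; apply: (open_cle_ltP U ba).1 => //; rewrite xb ltW.
  by rewrite distrC; apply: le_trans (xe _ y01) (ltW eh).
move=> /(compl_Un_count_lt n0)[D dD ->].
set z := _ / _.
have z01 : 0 <= z <= 1.
  rewrite divr_ge0//= ler_pdivrMr// mul1r ler_nat; exact: count_lt_leq.
have [zh|zh] := ltP (z - h) 0.
  by exists 0; [exact: compl01_0|rewrite subr0 ger0_norm; lra].
have [hz|hz] := ltP 1 (z + h).
  exists 1; last by rewrite ler0_norm; lra.
  split; first by rewrite /= in_itv /= ler01 lexx.
  by move=> /oset_sub; rewrite /= in_itv /= ltxx andbF.
(* Otherwise every point of D is at most z - h, and the proportion of such points is at most z - h +
   e < z. *)
have [j [jn Dj xj]] : exists j, [/\ (j < n)%N, D j & z - h < x j].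
  apply: contrapT => nj.
  have : (count_lt n D)%:R / n%:R <= (count_lt n (fun j => x j <= z - h))%:R / n%:R :> R.
    apply: ler_wpM2r; first by rewrite invr_ge0 ltW.
    rewrite ler_nat; apply: count_lt_sub => j jn Dj; rewrite leNgt; apply/negP => xj.
    by apply: nj; exists j.
  have := xe (z - h); rewrite in_itv /= zh -/z ler_norml => /(_ ltac:(lra)); lra.
have [l [ln Dl xl]] : exists l, [/\ (l < n)%N, ~~ D l & x l <= z + h].
  apply: contrapT => nl.
  have : (count_lt n (fun j => x j <= z + h))%:R / n%:R <= (count_lt n D)%:R / n%:R :> R.
    apply: ler_wpM2r; first by rewrite invr_ge0 ltW.
    rewrite ler_nat; apply: count_lt_sub => l ln xl; apply/negPn/negP => Dl.
    by apply: nl; exists l.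
  have := xe (z + h); rewrite in_itv /= hz -/z ler_norml => /(_ ltac:(lra)); lra.
have lj : ~~ open_cle U x l j by apply: contra Dl; exact: dD.
have jl : x j < x l by rewrite ltNge; apply: contra lj; exact: le_open_cle.
have : ~ forall c, x j <= c <= x l -> oset U c.
  by move=> /(open_cle_ltP U jl); rewrite (negbTE lj).
move=> /existsNP[c /not_implyP[/andP[jc cl] Uc]].
exists c; last by rewrite ler_norml; lra.
by split => //; rewrite /= in_itv /=; lra.
Qed.

Lemma downset_nth (G : compN) (D : pred nat) s k : pairwise G s ->
  downset G D -> (k < size s)%N -> D (nth 0%N s k) = (k < count D s)%N.
Proof.
move=> + dD; elim: s k => // y s IH k /= /andP[ys ps].
have [Dy|Dy] := boolP (D y); first by case: k => [|k] /=; rewrite ?Dy//= ltnS => /IH ->.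
have Ds z : z \in s -> ~~ D z.
  by move=> /(allP ys) yz; apply: contra Dy => Dz; exact: dD yz.
have -> : count D s = 0%N.
  by apply/eqP; rewrite eqn0Ngt -has_count; apply/hasPn.
case: k => [|k] /=; first by rewrite (negbTE Dy).
by rewrite ltnS => ks; apply/negbTE/Ds/mem_nth.
Qed.

Definition rank_seq n (G : compN) : seq nat := sort G (iota 0 n).

Lemma perm_rank_seq n (G : compN) : perm_eq (rank_seq n G) (iota 0 n).
Proof. by rewrite /rank_seq perm_sort. Qed.

Lemma size_rank_seq n G : size (rank_seq n G) = n.
Proof. by rewrite size_sort size_iota. Qed.

Lemma downset_rank n (G : compN) (D : pred nat) k : downset G D -> (k < n)%N ->
  D (nth 0%N (rank_seq n G) k) = (k < count_lt n D)%N.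
Proof.
move=> dD kn; rewrite (@downset_nth G)// ?size_rank_seq//.
  by have /seq.permP -> := perm_rank_seq n G.
rewrite -sorted_pairwise; last by move=> ? ? ?; exact: cle_trans.
by apply: sort_sorted => i j; exact: cle_total.
Qed.

(** Cuts #D/n are multiples of 1/n, so they fall between cells: x_j < x_i are separated exactly when
    a down-set of G contains the element of rank k j and not the one of rank k i. *)
Lemma open_cle_Un n (G : compN) (x : nat -> R) (k : nat -> nat) i j :
  (k i < n)%N -> (k j < n)%N ->
  (k i)%:R / n%:R < x i < (k i).+1%:R / n%:R ->
  (k j)%:R / n%:R < x j < (k j).+1%:R / n%:R ->
  open_cle (Un R n G) x i j =
  G (nth 0%N (rank_seq n G) (k i)) (nth 0%N (rank_seq n G) (k j)).
Proof.
move=> kin kjn /andP[xi1 xi2] /andP[xj1 xj2].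
have n0 : (0 < n)%N by lia.
have n0' : (0 : R) < n%:R by rewrite ltr0n.
have frac a b : (a%:R / n%:R < b%:R / n%:R :> R) = (a < b)%N.
  by rewrite ltr_pM2r ?invr_gt0// ltr_nat.
have fracle a b : (a%:R / n%:R <= b%:R / n%:R :> R) = (a <= b)%N.
  by rewrite ler_pM2r ?invr_gt0// ler_nat.
set q := nth _ _.
have qmono a b : (a <= b)%N -> (b < n)%N -> G (q a) (q b).
  move=> ab bn; have dD : downset G (fun l => G l (q b)).
    by move=> u v /= vb uv; exact: cle_trans uv vb.
  have := downset_rank dD bn; rewrite -/q cle_refl => /esym bD.
  by rewrite -/((fun l => G l (q b)) (q a)) (downset_rank dD) -/q; lia.
have [ij|ji] := leP (x i) (x j).
  rewrite le_open_cle// qmono//.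
  by have := lt_le_trans xi1 (le_trans ij (ltW xj2)); rewrite frac.
have kji : (k j <= k i)%N by have := lt_trans xj1 (lt_trans ji xi2); rewrite frac.
apply/idP/idP => [/(open_cle_ltP _ ji) all|Gij].
  apply/negPn/negP => Gij.
  have dD : downset G (fun l => G l (q (k j))).
    by move=> u v /= vb uv; exact: cle_trans uv vb.
  have := downset_rank dD kjn; rewrite -/q cle_refl => /esym c1.
  have := downset_rank dD kin; rewrite -/q (negbTE Gij) => /esym/negbT; rewrite -leqNgt => c2.
  have [_ + ] := count_lt_compl_Un R n dD; apply; apply: all.
  rewrite (le_trans (ltW xj2)) ?fracle//=.
  by apply: le_trans (ltW xi1); rewrite fracle.
apply/(open_cle_ltP _ ji) => c /andP[jc ci].
have c01 : 0 <= c <= 1.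
  apply/andP; split; first by apply: le_trans jc; apply: le_trans (ltW xj1); rewrite divr_ge0.
  apply: le_trans ci _; apply: le_trans (ltW xi2) _.
  by rewrite ler_pdivrMr// mul1r ler_nat.
apply: contrapT => Uc.
have [D dD cD] : exists2 D : pred nat, downset G D & c = (count_lt n D)%:R / n%:R.
  by apply: compl_Un_count_lt => //; split.
have kjD : (k j < count_lt n D)%N by have := lt_le_trans xj1 jc; rewrite cD frac.
have kiD : (count_lt n D < (k i).+1)%N by have := le_lt_trans ci xi2; rewrite cD frac.
have := downset_rank dD kjn; rewrite kjD => Dj.
by have := dD _ _ Dj Gij; rewrite (downset_rank dD kin) ltnNge -ltnS kiD.
Qed.

End comp_of_open_geometry.

(** * The law of the composition of an open set *)

Section comp_of_open_law.
Context d (Omega : measurableType d) (R : realType) (P : probability Omega R).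
Variable X : nat -> {RV P >-> R}.
Implicit Types U : open01 R.

Definition sample_comp U (w : Omega) : compN := comp_of_open U (fun i => X i w).

(** A compact segment inside the open set extends to one with rational ends. This writes the
    relation as a countable union of events on [x i] and [x j], which gives measurability of
    [sample_comp]. *)
Lemma open_cle_rat U (x : nat -> R) i j : open_cle U x i j <->
  x i <= x j \/ exists p q : rat, [/\ ratr p < x j, x i < ratr q &
    forall c, ratr p <= c <= ratr q -> oset U c].
Proof.
have [ij|ji] := leP (x i) (x j).
  by split => [_|_]; [left|exact: le_open_cle].
rewrite open_cle_ltP//; split=> [all|[//|[p [q [pj iq all]]]] c /andP[jc ci]].
  right.
  have nb c : x j <= c <= x i -> exists2 e, 0 < e & ball c e `<=` oset U.
    move=> /all Uc; have /nbhs_ballP[e /= e0 eU] : nbhs c (oset U).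
      by apply: open_nbhs_nbhs; split => //; exact: oset_open.
    by exists e.
  have [e1 e10 e1U] := nb (x j) ltac:(by rewrite lexx ltW).
  have [e2 e20 e2U] := nb (x i) ltac:(by rewrite lexx ltW).
  have [p] := rat_in_itvoo (ltac:(lra) : x j - e1 < x j).
  rewrite in_itv /= => /andP[p1 p2].
  have [q] := rat_in_itvoo (ltac:(lra) : x i < x i + e2).
  rewrite in_itv /= => /andP[q1 q2].
  exists p, q; split => // c /andP[pc cq].
  have [jc|cj] := leP (x j) c; last first.
    by apply: e1U; rewrite /ball /= ltr_norml; lra.
  have [ci|ic] := leP c (x i); first by apply: all; rewrite jc.
  by apply: e2U; rewrite /ball /= ltr_norml; lra.
by apply: all; rewrite (le_trans (ltW pj) jc) (le_trans ci (ltW iq)).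
Qed.

Lemma measurable_RV i (B : set R) : measurable B -> measurable (X i @^-1` B).
Proof. by move=> mB; rewrite -[X in measurable X]setTI; exact: measurable_funP. Qed.

Lemma measurable_sample_comp U : measurable_fun setT (sample_comp U).
Proof.
have mle i j : measurable [set w | sample_comp U w i j].
  have -> : [set w | sample_comp U w i j] = [set w | X i w <= X j w] `|`
    \bigcup_p \bigcup_q (if pselect (forall c, ratr p <= c <= ratr q -> oset U c)
     then X j @^-1` `]ratr p, +oo[ `&` X i @^-1` `]-oo, ratr q[ else set0).
    apply/seteqP; split => w /=.
      move=> /open_cle_rat[|[p [q [pj iq all]]]]; [by left|right].
      exists p => //; exists q => //; case: pselect => //= _.
      by split; rewrite /= in_itv //= pj.
    move=> [|[p _ [q _]]]; first by move=> ?; apply/open_cle_rat; left.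
    case: pselect => //= all [/=]; rewrite !in_itv /= andbT => pj iq.
    by apply/open_cle_rat; right; exists p, q.
  apply: measurableU.
    rewrite -[X in measurable X]setTI.
    exact: (measurable_fun_le measurableT (measurable_funP (X i)) (measurable_funP (X j))).
  apply: countable_bigcupT_measurable; first exact: countableP.
  move=> p; apply: countable_bigcupT_measurable; first exact: countableP.
  move=> q; case: pselect => //= _.
  by apply: measurableI; apply: measurable_RV; exact: measurable_itv.
apply: (measurability [set A | exists n, finitary n A]).
  exact: measurable_finitaryE.
move=> _ [A [n fA] <-]; rewrite setTI (finitary_bigcup fA) preimage_bigcup.
apply: fin_bigcup_measurable; first exact: finite_finset.
move=> x _; have -> : sample_comp U @^-1` [set G | cle_mat n G = x] =
    \bigcap_(p in [set: 'I_n * 'I_n]) (if x p then [set w | sample_comp U w p.1 p.2]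
       else ~` [set w | sample_comp U w p.1 p.2]).
  apply/seteqP; split => w /=.
    move=> <- p _; rewrite ffunE; case: ifPn => //.
    by move=> /negP.
  move=> all; apply/ffunP => p; rewrite ffunE; have := all p I.
  by case: (x p) => //= /negP/negbTE.
apply: fin_bigcap_measurable; first exact: finite_finset.
by move=> p _; case: (x p) => //; exact: measurableC.
Qed.

Lemma measurable_sample_comp_pre U A : measurable A ->
  measurable (sample_comp U @^-1` A).
Proof.
by move=> mA; rewrite -[X in measurable X]setTI; exact: measurable_sample_comp.
Qed.

Lemma law_open_le1 U A : measurable A -> (law_open X U A <= 1)%E.
Proof.
by move=> mA; apply: probability_le1; exact: measurable_sample_comp_pre.
Qed.

Lemma law_open_ge0 U A : (0 <= law_open X U A)%E.
Proof. exact: measure_ge0. Qed.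

Lemma law_open0 U : law_open X U set0 = 0%E.
Proof. by rewrite /law_open; exact: measure0. Qed.

Lemma law_openT U : law_open X U setT = 1%E.
Proof. by rewrite /law_open; exact: probability_setT. Qed.

Lemma law_openC U A : measurable A -> law_open X U (~` A) = (1 - law_open X U A)%E.
Proof.
by move=> mA; rewrite -probability_setC//; exact: measurable_sample_comp_pre.
Qed.

Lemma law_open_bigcup U (F : (set compN)^nat) : (forall n, measurable (F n)) ->
  trivIset setT F ->
  law_open X U (\bigcup_n F n) = (\sum_(n <oo) law_open X U (F n))%E.
Proof.
move=> mF tF; pose G n := sample_comp U @^-1` F n.
have mG n : measurable (G n) by exact: measurable_sample_comp_pre.
have -> : law_open X U (\bigcup_n F n) = P (\bigcup_n G n).
  by congr (P _); apply/seteqP; split => w [n _ Fn]; exists n.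
apply/esym/cvg_lim => //; apply: measure_sigma_additive => //.
move=> m n _ _ [w [/= Fm Fn]]; apply: tF => //.
by exists (sample_comp U w).
Qed.

End comp_of_open_law.

Section uniform_iid.
Context d (Omega : measurableType d) (R : realType) (P : probability Omega R).
Variable X : nat -> {RV P >-> R}.
Hypothesis iidX : iid_uniform X.

Lemma uniform_probE (B : set R) : measurable B ->
  uniform_prob (@ltr01 R) B = lebesgue_measure (B `&` `[0, 1]).
Proof.
move=> mB; rewrite /uniform_prob integral_uniform_pdf.
rewrite (eq_integral (fun=> 1%E)); last first.
  by move=> x /set_mem[_ /=]; rewrite in_itv /= /uniform_pdf => ->; rewrite subr0 invr1.
by rewrite integral_cst ?mul1e//; exact: measurableI.
Qed.

Lemma iid_prob i (B : set R) : measurable B ->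
  P (X i @^-1` B) = lebesgue_measure (B `&` `[0, 1]).
Proof. by move=> mB; rewrite -uniform_probE//; case: iidX => _ /(_ i B mB) <-. Qed.

Lemma iid_itv i (a b : R) : 0 <= a <= b -> b <= 1 ->
  P (X i @^-1` `]a, b[) = (b - a)%:E.
Proof.
move=> /andP[a0 ab] b1; rewrite iid_prob// setIidl.
  rewrite lebesgue_measure_itv /= lte_fin.
  by have [->|ab'] := eqVneq a b; [rewrite ltxx subrr|rewrite lt_neqAle ab' ab].
by move=> x /=; rewrite !in_itv /=; lra.
Qed.

Lemma iid_prod m (B : nat -> set R) : (forall i, measurable (B i)) ->
  P (\bigcap_(i in `I_m) (X i @^-1` B i)) = (\prod_(i < m) P (X i @^-1` B i))%E.
Proof.
move=> mB; case: iidX => /(_ [fset x in iota 0 m]%fset B mB) + _.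
have -> : [set` [fset x in iota 0 m]%fset] = `I_m.
  by apply/seteqP; split => i /=; rewrite !inE mem_iota.
move=> ->; rewrite -(big_mkord xpredT (fun i => P (X i @^-1` B i))).
apply: perm_big; apply: uniq_perm; rewrite ?fset_uniq ?iota_uniq//.
by move=> i; rewrite !inE /index_iota subn0.
Qed.

End uniform_iid.

(** * Sampling *)

Lemma finperm_comp f g : finperm f -> finperm g -> finperm (f \o g).
Proof.
move=> [fI [N fN]] [gI [M gM]]; split; first exact: inj_comp.
by exists (maxn N M) => n nNM /=; rewrite gM ?fN//; lia.
Qed.

Definition swap (a b i : nat) : nat :=
  if i == a then b else if i == b then a else i.

Lemma swapK a b : involutive (swap a b).
Proof.
move=> i; rewrite /swap; case: (eqVneq i a) => [->|ia].
  by rewrite eqxx; case: eqVneq.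
by case: (eqVneq i b) => [->|ib]; rewrite ?eqxx// (negbTE ia) (negbTE ib).
Qed.

Lemma finperm_swap a b : finperm (swap a b).
Proof.
split; first exact: inv_inj (swapK a b).
by exists (maxn a b).+1 => n nab; rewrite /swap !gtn_eqF//; lia.
Qed.

(** Induction on m: composing with the transposition of [f m] and [g m] corrects the value at m and
    leaves the smaller indices alone, whose images differ from both. *)
Lemma finperm_extend m (g : nat -> nat) :
  (forall i j, (i < m)%N -> (j < m)%N -> g i = g j -> i = j) ->
  exists2 f, finperm f & forall i, (i < m)%N -> f i = g i.
Proof.
elim: m => [|m IH] gI.
  by exists id => //; split => //; exists 0%N.
have [|f ff fg] := IH; first by move=> i j im jm; apply: gI; lia.
exists (swap (f m) (g m) \o f); first exact: finperm_comp (finperm_swap _ _) ff.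
move=> i; rewrite ltnS leq_eqVlt => /predU1P[->|im] /=; first by rewrite /swap eqxx.
have [fI _] := ff; rewrite /swap (inj_eq fI) (ltn_eqF im) fg//.
by case: eqP => // /gI; lia.
Qed.

Definition nat_ffun m n (k : {ffun 'I_m -> 'I_n}) (i : nat) : nat :=
  if insub i is Some j then k j else 0%N.

Lemma nat_ffunE m n (k : {ffun 'I_m -> 'I_n}) (i : 'I_m) : nat_ffun k i = k i.
Proof. by rewrite /nat_ffun valK. Qed.

(** Division-free form of: m draws from [n] with replacement contain a repetition with probability
    at most m^2 / n. *)
Lemma ffact_expn_bound n m : (n * n ^ m <= n * n ^_ m + m ^ 2 * n ^ m)%N.
Proof.
elim: m => [|m IH]; first by rewrite ffactn0 expn0 leq_addr.
have a : (n ^_ m <= n ^ m)%N.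
  elim: m {IH} => // m IH; rewrite ffactnSr expnSr; apply: leq_mul => //.
  exact: leq_subr.
rewrite ffactnSr expnSr.
have b : (n ^_ m * n <= n ^_ m * (n - m) + n ^_ m * m)%N.
  by rewrite -mulnDr leq_mul2l; lia.
have c : (n * (n ^_ m * n) <= n * (n ^_ m * (n - m)) + n * (n ^ m * m))%N.
  rewrite -mulnDr leq_mul2l; apply/orP; right; apply: leq_trans b _.
  by rewrite leq_add2l leq_mul2r a orbT.
have e : (n * n ^ m * n <= (n * n ^_ m + m ^ 2 * n ^ m) * n)%N.
  by rewrite leq_mul2r IH orbT.
nia.
Qed.

Lemma measure_bigcup_finType d (T : measurableType d) (R : realType)
    (mu : {measure set T -> \bar R}) (I : finType) (F : I -> set T) :
  (forall i, measurable (F i)) -> trivIset setT F ->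
  mu (\bigcup_i F i) = (\sum_i mu (F i))%E.
Proof.
move=> mF tF; rewrite measure_fin_bigcup//; last exact: finite_finset.
rewrite [RHS](@bigfs _ _ _ _ _ xpredT) ?index_enum_uniq//.
  by apply: eq_fsbigl; apply/seteqP.
by move=> i _; rewrite mem_index_enum.
Qed.

Section sampling.
Context d (Omega : measurableType d) (R : realType) (P : probability Omega R).
Variable X : nat -> {RV P >-> R}.
Hypothesis iidX : iid_uniform X.

(* X_i lies in the cell ](k i)/n, (k i + 1)/n[ when it selects the element of rank
   k i of [n] for G: P^(U_n) is sampling from [n] with replacement. *)
Lemma law_open_Un m n (G : compN) (A : set compN) : (0 < n)%N -> finitary m A ->
  law_open X (Un R n G) A =
  (\sum_(k : {ffun 'I_m -> 'I_n}) ((n%:R^-1 ^+ m) * \1_A (pull (nat_ffun k) G))%:E)%E.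
Proof.
move=> n0 fA; have n0' : (0 : R) < n%:R by rewrite ltr0n.
have mA := finitary_measurable fA.
pose cell i : set R := `]i%:R / n%:R, i.+1%:R / n%:R[%classic.
pose C (k : {ffun 'I_m -> 'I_n}) := \bigcap_(i in `I_m) (X i @^-1` cell (nat_ffun k i)).
have mcell i : measurable (cell i) by exact: measurable_itv.
have mC k : measurable (C k).
  by apply: bigcap_measurableType => i _; exact: measurable_RV.
have extn (k : {ffun 'I_m -> 'I_n}) i : (i < m)%N -> (nat_ffun k i < n)%N.
  by move=> im; rewrite (nat_ffunE k (Ordinal im)).
have frac a b : (a%:R / n%:R < b%:R / n%:R :> R) = (a < b)%N.
  by rewrite ltr_pM2r ?invr_gt0// ltr_nat.
have PC k : P (C k) = (n%:R^-1 ^+ m)%:E.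
  rewrite /C iid_prod//.
  rewrite (eq_bigr (fun _ => n%:R^-1%:E)); last first.
    move=> i _; rewrite (iid_itv iidX).
    - by rewrite -mulrBl -natrB// subSnn mul1r.
    - by rewrite divr_ge0//= ltW// frac.
    - by rewrite ler_pdivrMr// mul1r ler_nat extn.
  by rewrite prodEFin prodr_const card_ord.
have tC : trivIset setT C.
  move=> k l _ _ [w [Ck Cl]]; apply/ffunP => i.
  have := Ck i (ltn_ord i); have := Cl i (ltn_ord i).
  rewrite /cell /= !in_itv /= !nat_ffunE => /andP[l1 l2] /andP[k1 k2].
  have := lt_trans k1 l2; have := lt_trans l1 k2; rewrite !frac => ? ?.
  by apply/val_inj => /=; lia.
pose q i := nth 0%N (rank_seq n G) i.
have qn i : (i < n)%N -> (q i < n)%N.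
  move=> ni; have : q i \in rank_seq n G by rewrite mem_nth ?size_rank_seq.
  by rewrite (perm_mem (perm_rank_seq n G)) mem_iota.
pose E := sample_comp X (Un R n G) @^-1` A.
have mE : measurable E by exact: measurable_sample_comp_pre.
have EC k : P (E `&` C k) = ((n%:R^-1 ^+ m) * \1_A (pull (q \o nat_ffun k) G))%:E.
  have AC w : C k w -> agree m (sample_comp X (Un R n G) w) (pull (q \o nat_ffun k) G).
    move=> Ck i j im jm /=; rewrite (@open_cle_Un _ _ _ _ (nat_ffun k)) ?extn//.
      by have := Ck i im; rewrite /cell /= in_itv.
    by have := Ck j jm; rewrite /cell /= in_itv.
  rewrite indicE; case: (boolP (_ \in A)) => [/set_mem Ak|].
    rewrite mulr1 -(PC k); congr (P _); apply: setIidr => w /AC Cw.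
    exact: fA (agree_sym Cw) Ak.
  move=> /negP Ak; rewrite mulr0 [X in P X](_ : _ = set0) ?measure0//.
  by apply/seteqP; split => // w [Ew /AC/fA/(_ Ew) Aw]; apply: Ak; rewrite inE.
(* The products of open cells miss the cell boundaries, but their masses add up to 1, so the rest is
   null. *)
pose CU := \bigcup_(k in [set: {ffun 'I_m -> 'I_n}]) C k.
have mCU : measurable CU by apply: fin_bigcup_measurable => //; exact: finite_finset.
have PCU : P CU = 1%E.
  rewrite measure_bigcup_finType// (eq_bigr _ (fun k _ => PC k)) sumEFin.
  rewrite sumr_const card_ffun !card_ord.
  by rewrite exprVn -[X in X%:E]mulr_natr natrX mulVf// expf_neq0// lt0r_neq0.
have PE : P E = P (E `&` CU).
  rewrite [LHS](measureDI P mE mCU) [X in (X + _)%E](_ : _ = 0%E) ?add0e//.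
  apply/eqP; rewrite eq_le measure_ge0 andbT.
  apply: (@le_trans _ _ (P (~` CU))).
    by apply: le_measure; rewrite ?inE; [exact: measurableD|exact: measurableC|move=> w []].
  by rewrite probability_setC// PCU subee.
rewrite -[LHS]/(P E) PE setI_bigcupr measure_bigcup_finType//; last 2 first.
- by move=> k; exact: measurableI.
- by move=> k l _ _ [w [[_ Ck] [_ Cl]]]; apply: tC => //; exists w.
rewrite (eq_bigr _ (fun k _ => EC k)).
(* The map from ranks to elements is a bijection of [n], so summing over ranks or over elements is
   the same. *)
pose h (i : 'I_n) := Ordinal (qn i (ltn_ord i)).
have hI : injective h.
  move=> i j /(congr1 val) /= /eqP; rewrite nth_uniq ?size_rank_seq//.
    by move=> /eqP/val_inj.
  by rewrite (perm_uniq (perm_rank_seq n G)) iota_uniq.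
pose H (k : {ffun 'I_m -> 'I_n}) := [ffun i => h (k i)].
have HI : injective H.
  by move=> k l /ffunP kl; apply/ffunP => i; apply: hI; have := kl i; rewrite !ffunE.
rewrite [RHS](reindex H); last exact: onW_bij (injF_bij HI).
apply: eq_bigr => k _; congr ((_ * _)%:E); rewrite !indicE.
have kH : agree m (pull (q \o nat_ffun k) G) (pull (nat_ffun (H k)) G).
  move=> i j im jm /=.
  by rewrite !(nat_ffunE _ (Ordinal im)) !(nat_ffunE _ (Ordinal jm)) !ffunE.
suff -> : (pull (q \o nat_ffun k) G \in A) = (pull (nat_ffun (H k)) G \in A) by [].
by apply/idP/idP => /set_mem Ak; apply/mem_set;
  [exact: fA kH Ak|exact: fA (agree_sym kH) Ak].
Qed.

Section limit.
Variable lam : {measure set compN -> \bar R}.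
Hypothesis lam_fin : (lam setT < +oo)%E.
Hypothesis lam_pull : forall f n A, finperm f -> finitary n A ->
  lam (pull f @^-1` A) = lam A.

Let lamE A : measurable A -> lam A = (fine (lam A))%:E.
Proof.
move=> mA; rewrite fineK// ge0_fin_numE ?measure_ge0//.
by apply: le_lt_trans lam_fin; apply: le_measure; rewrite ?inE.
Qed.

Lemma integral_law_open_Un m n A : (0 < n)%N -> finitary m A ->
  (\int[lam]_G law_open X (Un R n G) A =
   (n%:R^-1 ^+ m * \sum_(k : {ffun 'I_m -> 'I_n}) fine (lam (pull (nat_ffun k) @^-1` A)))%:E)%E.
Proof.
move=> n0 fA; have mA := finitary_measurable fA.
have mpA k : measurable (pull (@nat_ffun m n k) @^-1` A).
  by rewrite -[X in measurable X]setTI; exact: measurable_pull.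
under eq_integral do rewrite (law_open_Un _ n0 fA).
rewrite ge0_integral_sum//; last first.
  move=> k; apply/measurable_EFinP; apply: measurable_funM => //.
  exact: (measurable_indic (mpA k)).
rewrite mulr_sumr -sumEFin; apply: eq_bigr => k _.
under eq_integral do rewrite EFinM.
rewrite ge0_integralZl ?lee_fin ?exprn_ge0//; last first.
  by apply/measurable_EFinP; exact: (measurable_indic (mpA k)).
rewrite EFinM -lamE//; congr (_ * _)%E.
by rewrite -[in RHS](setIT (pull _ @^-1` _)) -integral_indic.
Qed.

(* An injective k extends to a permutation, so sampling without replacement leaves
   lam invariant; only the non-injective k contribute to the error. *)
Lemma sampling_bound m n A : (0 < n)%N -> finitary m A ->
  `|fine (\int[lam]_G law_open X (Un R n G) A) - fine (lam A)| <=
  (m ^ 2)%:R / n%:R * fine (lam setT).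
Proof.
move=> n0 fA; have mA := finitary_measurable fA.
have n0' : (0 : R) < n%:R by rewrite ltr0n.
set T := fine (lam setT).
have le_T B : measurable B -> 0 <= fine (lam B) <= T.
  move=> mB; rewrite -!lee_fin -!lamE// measure_ge0/=.
  by apply: le_measure; rewrite ?inE.
rewrite (integral_law_open_Un n0 fA) /=.
pose S := [set k : {ffun 'I_m -> 'I_n} | injectiveb k]%SET.
have inj k : k \in S -> fine (lam (pull (nat_ffun k) @^-1` A)) = fine (lam A).
  rewrite inE => /injectiveP kI; congr fine.
  have [|f ff fk] := @finperm_extend m (nat_ffun k).
    move=> i j im jm; rewrite (nat_ffunE k (Ordinal im)) (nat_ffunE k (Ordinal jm)).
    by move=> /val_inj/kI/(congr1 val).
  rewrite -(lam_pull ff fA); congr (lam _).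
  have agr G : agree m (pull (nat_ffun k) G) (pull f G) by move=> i j im jm /=; rewrite !fk.
  by apply/seteqP; split => G; [exact: fA (agr G)|exact: fA (agree_sym (agr G))].
have cS : (#|S| = n ^_ m)%N by rewrite card_inj_ffuns !card_ord.
have cC : (#|~: S| = n ^ m - n ^_ m)%N.
  by have := cardsC S; rewrite card_ffun !card_ord cS; lia.
have -> : \sum_k fine (lam (pull (@nat_ffun m n k) @^-1` A)) =
    (n ^_ m)%:R * fine (lam A) + \sum_(k in ~: S) fine (lam (pull (nat_ffun k) @^-1` A)).
  rewrite (bigID (mem S)) /=; congr (_ + _); last first.
    by apply: eq_bigl => k; rewrite finset.in_setC.
  by rewrite (eq_bigr _ inj) sumr_const cS mulr_natl.
set r := \sum_(k in _) _.
have /andP[r0 rT] : 0 <= r <= (n ^ m - n ^_ m)%:R * T.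
  have mk k : measurable (pull (@nat_ffun m n k) @^-1` A).
    by rewrite -[X in measurable X]setTI; exact: measurable_pull.
  apply/andP; split; first by apply: sumr_ge0 => k _; case/andP: (le_T _ (mk k)).
  rewrite -cC mulr_natl -sumr_const; apply: ler_sum => k _.
  by case/andP: (le_T _ (mk k)).
have /andP[a0 aT] := le_T _ mA; set a := fine (lam A) in a0 aT *.
have nm0 : (0 : R) < n%:R ^+ m by rewrite exprn_gt0.
have ffle : (n ^_ m <= n ^ m)%N by have := max_card (mem S); rewrite card_ffun !card_ord cS.
set c := n%:R^-1 ^+ m; have c0 : 0 < c by rewrite exprn_gt0 ?invr_gt0.
have cn : c * (n ^ m)%:R = 1 by rewrite natrX /c exprVn mulVf// lt0r_neq0.
(* D counts the non-injective maps; c * D is their proportion, and the error is c * (r - D * a) with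
   both r and D * a in [0, D * T]. *)
set D : R := (n ^ m - n ^_ m)%:R in rT *.
have D0 : 0 <= D by exact: ler0n.
have De : (n ^_ m)%:R = (n ^ m)%:R - D :> R by rewrite /D natrB//; ring.
have cD : c * D <= (m ^ 2)%:R / n%:R.
  rewrite ler_pdivlMr// -[leRHS]mul1r -[X in _ <= X * _]cn -!mulrA ler_pM2l//.
  rewrite /D -!natrM ler_nat; have := ffact_expn_bound n m; nia.
have T0 : 0 <= T by apply: le_trans aT.
have -> : c * ((n ^_ m)%:R * a + r) - a = c * (r - D * a).
  rewrite De; transitivity (c * (n ^ m)%:R * a + c * (r - D * a) - a).
    by ring.
  by rewrite cn; ring.
rewrite normrM (gtr0_norm c0); apply: (@le_trans _ _ (c * (D * T))).
  rewrite ler_pM2l// ler_norml.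
  have := mulr_ge0 D0 a0; have := ler_wpM2l D0 aT; lra.
by rewrite mulrA ler_wpM2r.
Qed.

End limit.

End sampling.

(** * Law of large numbers *)

Section law_of_large_numbers.
Context d (Omega : measurableType d) (R : realType) (P : probability Omega R).
Variable X : nat -> {RV P >-> R}.
Hypothesis iidX : iid_uniform X.

Definition below (t : R) n (w : Omega) : nat := count_lt n (fun j => X j w <= t).

Let B t i : set Omega := X i @^-1` `]-oo, t].

Let mB t i : measurable (B t i).
Proof. by apply: measurable_RV; exact: measurable_itv. Qed.

Let belowE t n w : (below t n w)%:R = \sum_(i < n) \1_(B t i) w :> R.
Proof.
rewrite /below -card_count_lt -sum1_card natr_sum big_mkcond /=; apply: eq_bigr => i _.
rewrite indicE inE; have -> : (w \in B t i) = (X i w <= t).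
  apply/idP/idP => [/set_mem|Xt]; first by rewrite /B /= in_itv.
  by apply/mem_set; rewrite /B /= in_itv.
by case: ifP.
Qed.

Let PB (t : R) i : 0 <= t <= 1 -> P (B t i) = t%:E.
Proof.
move=> /andP[t0 t1]; rewrite (iid_prob iidX)//.
have -> : `]-oo, t] `&` `[0, 1] = `[0, t]%classic.
  by apply/seteqP; split => x /=; rewrite !in_itv /=; lra.
rewrite lebesgue_measure_itv /= lte_fin oppr0 addr0.
by have [->|t0'] := eqVneq t 0; [rewrite ltxx|rewrite lt_neqAle eq_sym t0' t0].
Qed.

Let PBB (t : R) i j : 0 <= t <= 1 -> P (B t i `&` B t j) =
  (if i == j then t else t ^+ 2)%:E.
Proof.
move=> t01; case: eqVneq => [->|ij]; first by rewrite setIid PB.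
case: iidX => /(_ [fset i; j]%fset (fun _ => `]-oo, t]%classic)) + _.
have -> : \bigcap_(k in [set` [fset i; j]%fset]) X k @^-1` `]-oo, t] = B t i `&` B t j.
  apply/seteqP; split => [w all|w [wi wj] k /=].
    by split; apply: all; rewrite /= !inE eqxx ?orbT.
  by rewrite !inE => /orP[] /eqP ->.
move=> -> //; rewrite big_fsetU1 ?inE//= big_seq_fset1.
by rewrite -!/(B t _) !PB// -EFinM expr2.
Qed.

Lemma measurable_below t n : measurable_fun setT (fun w => (below t n w)%:R : R).
Proof.
under eq_fun do rewrite belowE.
by apply: measurable_sum => i; exact: measurable_indic.
Qed.

(** Pairwise independence is enough: the square of the count is a sum over pairs, with mean t on the
    diagonal and t^2 off it. *)
Lemma below_variance (t : R) n : 0 <= t <= 1 ->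
  (\int[P]_w (((below t n w)%:R - n%:R * t) ^+ 2)%:E = (n%:R * (t - t ^+ 2))%:E)%E.
Proof.
move=> t01; have /andP[t0 t1] := t01.
have int1 : (\int[P]_w (below t n w)%:R%:E = (n%:R * t)%:E)%E.
  under eq_integral do rewrite belowE -sumEFin.
  rewrite ge0_integral_sum//; last first.
    by move=> i; apply/measurable_EFinP; exact: measurable_indic.
  rewrite (eq_bigr (fun=> t%:E)) => [|i _].
    by rewrite sumEFin sumr_const card_ord mulr_natl.
  by rewrite integral_indic// setIT; exact: PB.
have int2 : (\int[P]_w ((below t n w)%:R ^+ 2)%:E =
    (n%:R * t + n%:R * (n%:R - 1) * t ^+ 2)%:E)%E.
  transitivity (\int[P]_w \sum_(p : 'I_n * 'I_n) (\1_(B t p.1 `&` B t p.2) w)%:E)%E.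
    apply: eq_integral => w _; rewrite belowE expr2 mulr_suml sumEFin.
    rewrite -(pair_bigA _ (fun i j : 'I_n => \1_(B t i `&` B t j) w)) /=.
    congr (_%:E); apply: eq_bigr => i _; rewrite mulr_sumr; apply: eq_bigr => j _.
    by rewrite indicI.
  rewrite ge0_integral_sum//; last first.
    by move=> p; apply/measurable_EFinP; apply: measurable_indic; exact: measurableI.
  rewrite (eq_bigr (fun p : 'I_n * 'I_n =>
      (if p.1 == p.2 then t else t ^+ 2)%:E)); last first.
    move=> p _; rewrite integral_indic//; last exact: measurableI.
    by rewrite setIT; exact: PBB.
  rewrite sumEFin -(pair_bigA _ (fun i j : 'I_n => if i == j then t else t ^+ 2)) /=.
  rewrite (eq_bigr (fun=> t + (n%:R - 1) * t ^+ 2)) => [|i _].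
    by rewrite sumr_const card_ord; congr (_%:E); rewrite -[LHS]mulr_natl; ring.
  rewrite (bigD1 i)//= eqxx; congr (_ + _).
  rewrite (eq_bigr (fun=> t ^+ 2)) => [|j /negbTE ji]; last by rewrite eq_sym ji.
  rewrite sumr_const -[LHS]mulr_natl; congr (_ * _).
  have := cardC1 i; rewrite card_ord => ->.
  by rewrite -subn1 natrB//; exact: leq_ltn_trans (ltn_ord i).
(* The cross term is moved to the left, so that all four integrands are nonnegative and additivity
   applies without integrability conditions. *)
have : (\int[P]_w (((below t n w)%:R - n%:R * t) ^+ 2)%:E +
    \int[P]_w (2 * n%:R * t * (below t n w)%:R)%:E =
    \int[P]_w ((below t n w)%:R ^+ 2)%:E + \int[P]_w ((n%:R * t) ^+ 2)%:E)%E.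
  have mb := measurable_below t n.
  have m1 : measurable_fun setT (fun w => (((below t n w)%:R - n%:R * t) ^+ 2)%:E : \bar R).
    by apply/measurable_EFinP; apply: measurable_funX; exact: measurable_funB.
  have m2 : measurable_fun setT (fun w => (2 * n%:R * t * (below t n w)%:R)%:E : \bar R).
    by apply/measurable_EFinP; exact: measurable_funM.
  have m3 : measurable_fun setT (fun w => ((below t n w)%:R ^+ 2)%:E : \bar R).
    by apply/measurable_EFinP; exact: measurable_funX.
  have p1 w : setT w -> (0 <= (((below t n w)%:R - n%:R * t) ^+ 2)%:E :> \bar R)%E.
    by rewrite lee_fin sqr_ge0.
  have p2 w : setT w -> (0 <= (2 * n%:R * t * (below t n w)%:R)%:E :> \bar R)%E.
    by rewrite lee_fin !mulr_ge0.
  have p3 w : setT w -> (0 <= ((below t n w)%:R ^+ 2)%:E :> \bar R)%E.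
    by rewrite lee_fin sqr_ge0.
  have p4 (w : Omega) : setT w -> (0 <= ((n%:R * t) ^+ 2)%:E :> \bar R)%E.
    by rewrite lee_fin sqr_ge0.
  rewrite -(ge0_integralD _ _ p1 m1 p2 m2)// -(ge0_integralD _ _ p3 m3 p4)//.
  by apply: eq_integral => w _; rewrite -!EFinD; congr (_%:E); ring.
rewrite int2 integral_cst//= probability_setT mule1.
under [X in (_ + X)%E]eq_integral do rewrite EFinM.
rewrite ge0_integralZl ?lee_fin ?mulr_ge0//; last first.
  by apply/measurable_EFinP; exact: measurable_below.
rewrite int1 -EFinM -EFinD.
case: (\int[P]_w _)%E => [r| |]//; rewrite -EFinD => -[h]; congr (_%:E).
by rewrite -[LHS](addrK (2 * n%:R * t * (n%:R * t))) h; ring.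
Qed.

Lemma below_chebyshev (t : R) n (e : R) : 0 <= t <= 1 -> 0 < e -> (0 < n)%N ->
  (P [set w | (e * n%:R <= `|(below t n w)%:R - n%:R * t|)%R] <=
   (e ^- 2 * n%:R^-1)%:E)%E.
Proof.
move=> t01 e0 n0; have /andP[t0 t1] := t01.
have n0' : (0 : R) < n%:R by rewrite ltr0n.
have mf : measurable_fun setT (fun w => (((below t n w)%:R - n%:R * t) ^+ 2)%:E : \bar R).
  apply/measurable_EFinP; apply: measurable_funX; apply: measurable_funB => //.
  exact: measurable_below.
have := @le_integral_abse _ _ _ P setT measurableT _ ((e * n%:R) ^+ 2) mf.
move=> /(_ ltac:(by rewrite exprn_gt0// mulr_gt0)).
under eq_integral => w _ do rewrite gee0_abs ?lee_fin ?sqr_ge0//.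
rewrite below_variance// setTI => h.
rewrite -(@lee_pmul2l _ ((e * n%:R) ^+ 2)%:E)//; last by rewrite lte_fin exprn_gt0// mulr_gt0.
apply: le_trans (le_trans h _).
  rewrite le_eqVlt; apply/orP; left; apply/eqP; congr (_ * P _)%E.
  by apply/seteqP; split => w /=; rewrite lee_fin normrX ler_sqr ?nnegrE// mulr_ge0// ltW.
have -> : (((e * n%:R) ^+ 2)%:E * (e ^- 2 * n%:R^-1)%:E = n%:R%:E :> \bar R)%E.
  by rewrite -EFinM; congr (_%:E); field; rewrite !gt_eqF.
rewrite lee_fin ler_piMr//.
by have := sqr_ge0 t; lra.
Qed.

End law_of_large_numbers.

Lemma sqrt_floor n : exists k, (k ^ 2 <= n < k.+1 ^ 2)%N.
Proof.
elim: n => [|n [k /andP[kn nk]]]; first by exists 0%N.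
have [e|e] := eqVneq n.+1 (k.+1 ^ 2)%N; last by exists k; lia.
by exists k.+1; nia.
Qed.

Lemma sqrt_floor_gap k n : (n < k.+1 ^ 2)%N -> (n <= k ^ 2 + 2 * k)%N.
Proof. by rewrite -!mulnn; nia. Qed.

Section glivenko_cantelli.
Context d (Omega : measurableType d) (R : realType) (P : probability Omega R).
Variable X : nat -> {RV P >-> R}.
Hypothesis iidX : iid_uniform X.

Let bad (e t : R) k : set Omega :=
  [set w | e * (k ^ 2)%:R <= `|(below X t (k ^ 2) w)%:R - (k ^ 2)%:R * t|].

Let mbad e t k : measurable (bad e t k).
Proof.
rewrite -[X in measurable X]setTI; apply: measurable_fun_le => //.
apply: measurableT_comp => //; apply: measurable_funB => //.
exact: measurable_below.
Qed.

Let badN (e : R) r k0 n : set Omega :=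
  \big[setU/set0]_(l < r.+1) bad e (l%:R / r%:R) (k0 + n).+1.

(** Union bound over the r + 1 grid points, Chebyshev at each; then 1/(k+1)^2 <= 1/k - 1/(k+1) makes
    the sum over n telescope. *)
Let PbadN (e : R) r k0 n : 0 < e -> (0 < r)%N -> (0 < k0)%N ->
  (P (badN e r k0 n) <=
   (r.+1%:R * e ^- 2 * ((k0 + n)%:R^-1 - (k0 + n.+1)%:R^-1))%:E)%E.
Proof.
move=> e0 r0 k00; set k := (k0 + n)%N; rewrite addnS.
have k0n : (0 < k)%N by rewrite /k; lia.
have k0' : (0 : R) < k%:R by rewrite ltr0n.
have bm l : (l < r.+1)%N -> measurable (bad e (l%:R / r%:R) k.+1) by move=> _; exact: mbad.
apply: le_trans (Boole_inequality P bm) _.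
apply: (@le_trans _ _ (\sum_(l < r.+1) (e ^- 2 * (k.+1 ^ 2)%:R^-1)%:E)%E).
  apply: lee_sum => l _; apply: (below_chebyshev iidX) => //.
    rewrite divr_ge0//= ler_pdivrMr ?ltr0n// mul1r ler_nat -ltnS; exact: ltn_ord.
rewrite sumEFin lee_fin sumr_const card_ord -[leLHS]mulr_natl -mulrA ler_pM2l ?ltr0n//.
rewrite ler_pM2l ?invr_gt0 ?exprn_gt0//.
have -> : k%:R^-1 - k.+1%:R^-1 = (k%:R * k.+1%:R)^-1 :> R.
  by rewrite -natr1; field; rewrite natr1 !gt_eqF// ltr0n.
rewrite lef_pV2 ?posrE ?mulr_gt0 ?ltr0n ?expn_gt0//.
by rewrite -natrM ler_nat; lia.
Qed.

(* The Chebyshev bounds are summable along the squares, and between k^2 and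
   (k + 1)^2 the counts vary by at most 2k. *)
Lemma glivenko_cantelli (e eta : R) : 0 < e -> 0 < eta ->
  exists n0, exists D : set Omega, [/\ measurable D, (P D <= eta%:E)%E &
    forall w, ~ D w -> forall n t, (n0 <= n)%N -> t \in `[0, 1] ->
      `|(below X t n w)%:R / n%:R - t| <= e].
Proof.
move=> e0 eta0.
(* The error e is shared in three: grid mesh 1/r, deviation along the squares, and variation between
   consecutive squares. *)
pose r := (Num.bound (3 / e)).+1.
have r0 : (0 : R) < r%:R by rewrite ltr0n.
have r1 : r%:R^-1 <= e / 3.
  rewrite -(invf_div 3 e) lef_pV2 ?posrE ?divr_gt0//.
  apply: le_trans (ltW (archi_boundP _)) _; first by rewrite divr_ge0// ltW.
  by rewrite ler_nat.
have d0 : 0 < e / 3 by lra.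
pose c := r.+1%:R * (e / 3) ^- 2.
have c0 : 0 < c by rewrite mulr_gt0 ?ltr0n ?invr_gt0 ?exprn_gt0.
(* Two demands on k0: the telescoping tail c / k0 is at most eta, and 2k is at most a fraction e / 3
   of k^2 for k >= k0. *)
pose k0 := (Num.bound (c / eta) + Num.bound (6 / e)).+1.
have k00 : (0 : R) < k0%:R by rewrite ltr0n.
have ck0 : c / k0%:R <= eta.
  rewrite ler_pdivrMr// mulrC -ler_pdivrMr//.
  apply: le_trans (ltW (archi_boundP _)) _; first by rewrite divr_ge0// ltW.
  by rewrite ler_nat; apply: leqW; exact: leq_addr.
have ek0 : 2 / k0%:R <= e / 3.
  rewrite ler_pdivrMr// mulrC -ler_pdivrMr//.
  have -> : 2 / (e / 3) = 6 / e by field; rewrite gt_eqF.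
  apply: le_trans (ltW (archi_boundP _)) _; first by rewrite divr_ge0// ltW.
  by rewrite ler_nat; apply: leqW; exact: leq_addl.
have mN n : measurable (badN (e / 3) r k0 n).
  by apply: bigsetU_measurable => l _; exact: mbad.
exists (k0.+1 ^ 2)%N; exists (\bigcup_n badN (e / 3) r k0 n); split.
- exact: bigcupT_measurable.
- apply: le_trans (generalized_Boole_inequality _ _ _) _ => //.
    exact: bigcupT_measurable.
  apply: lime_le; first by apply: is_cvg_nneseries => n _ _; exact: measure_ge0.
  near=> N; apply: (@le_trans _ _ (c / k0%:R)%:E); last by rewrite lee_fin.
  apply: (@le_trans _ _ (\sum_(0 <= n < N) (c * ((k0 + n)%:R^-1 - (k0 + n.+1)%:R^-1))%:E)%E).
    by apply: lee_sum => n _; exact: PbadN.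
  rewrite sumEFin lee_fin -mulr_sumr ler_pM2l//.
  rewrite (eq_bigr (fun n => (- (k0 + n.+1)%:R^-1) - (- (k0 + n)%:R^-1))); last first.
    by move=> n _; ring.
  rewrite telescope_sumr// addn0 opprK addrC lerBlDr lerDl.
  by rewrite invr_ge0.
move=> w nD n t kn; rewrite in_itv /= => /andP[t0 t1].
have k0n : (0 < k0)%N by [].
clearbody k0 c r.
have n0 : (0 < n)%N by apply: leq_trans kn; rewrite expn_gt0.
have n0' : (0 : R) < n%:R by rewrite ltr0n.
have [k /andP[kn1 kn2]] := sqrt_floor n.
have k0k : (k0.+1 <= k)%N.
  by rewrite -ltnS -(@ltn_exp2r _ _ 2)//; exact: leq_ltn_trans kn kn2.
have kn3 : (n <= k ^ 2 + 2 * k)%N := sqrt_floor_gap kn2.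
have kpos : (0 < k)%N by exact: leq_ltn_trans k0k.
have good l : (l <= r)%N ->
    `|(below X (l%:R / r%:R) (k ^ 2) w)%:R - (k ^ 2)%:R * (l%:R / r%:R)| <
      e / 3 * (k ^ 2)%:R.
  move=> lr; rewrite ltNge; apply/negP => lb; apply: nD.
  exists (k - k0.+1)%N => //.
  rewrite /badN -(bigcup_mkord r.+1 (fun l => bad (e / 3) (l%:R / r%:R) _)).
  exists l => //=; rewrite /bad /=; by rewrite -addSn subnKC.
have Sle (s : R) : s <= t -> (below X s (k ^ 2) w <= below X t n w)%N.
  move=> st; rewrite -(subnKC kn1).
  rewrite /below /count_lt iotaD count_cat; apply: leq_trans (leq_addr _ _).
  by apply: sub_count => j /= /le_trans; exact.
have Sge (s : R) : t <= s -> (below X t n w <= below X s (k ^ 2) w + 2 * k)%N.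
  move=> ts; rewrite -(subnKC kn1).
  rewrite /below /count_lt iotaD count_cat; apply: leq_add.
    by apply: sub_count => j /= /le_trans; exact.
  by apply: leq_trans (count_size _ _) _; rewrite size_iota leq_subLR.
set b := below X t n w in Sle Sge *.
set K : R := (k ^ 2)%:R.
have Kn : K <= n%:R by rewrite ler_nat.
have nK : n%:R <= K + 2 * k%:R by rewrite /K -natrM -natrD ler_nat.
have kk : 2 * k%:R <= e / 3 * n%:R.
  apply: (@le_trans _ _ (e / 3 * K)); last by rewrite ler_pM2l.
  apply: (@le_trans _ _ (2 / k0%:R * K)); last by rewrite ler_pM2r// ltr0n expn_gt0 kpos.
  rewrite mulrAC ler_pdivlMr// -mulrA ler_pM2l// /K -natrM ler_nat.
  by rewrite -mulnn leq_mul2l; apply/orP; right; exact: ltnW.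
have K0 : 0 <= K by exact: ler0n.
have bn : b%:R <= n%:R :> R by rewrite ler_nat; exact: count_lt_leq.
have [l /andP[lt tl]] : exists l : nat, l%:R / r%:R <= t < l.+1%:R / r%:R.
  exists (Num.truncn (r%:R * t)).
  rewrite ler_pdivrMr// ltr_pdivlMr// mulrC.
  by apply: truncn_itv; rewrite mulr_ge0// ltW.
have lr : (l <= r)%N.
  by rewrite -(ler_nat R) -[leRHS]mul1r -ler_pdivrMr//; exact: le_trans t1.
have ll : l.+1%:R / r%:R = l%:R / r%:R + r%:R^-1 :> R by rewrite -natr1 mulrDl mul1r.
have goodl := good _ lr.
have lower : n%:R * (t - e) <= b%:R.
  have := Sle _ lt; rewrite -(ler_nat R) => bl.
  move: goodl; rewrite ltr_norml -/K => /andP[g1 _].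
  have : K * (t - e / 3 - e / 3) <= b%:R.
    have : K * (t - e / 3) <= K * (l%:R / r%:R) by apply: ler_wpM2l => //; lra.
    lra.
  have [neg|pos] := leP (t - e / 3 - e / 3) 0.
    have : n%:R * (t - e) <= 0 by apply: mulr_ge0_le0 => //; lra.
    have : (0 : R) <= b%:R by exact: ler0n.
    lra.
  have : (n%:R - K) * (t - e / 3 - e / 3) <= 2 * k%:R * 1 by apply: ler_pM; lra.
  lra.
have upper : b%:R <= n%:R * (t + e).
  (* For l = r the grid point l + 1 leaves [0, 1]; but then t >= 1 and the trivial bound b <= n
     suffices. *)
  have [lr'|rl] := ltnP l r; last first.
    have te : 1 <= t.
      apply: le_trans lt; rewrite ler_pdivlMr// mul1r ler_nat//.
    have := ler_wpM2l (ltW n0') te; have := mulr_gt0 n0' e0; lra.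
  have := good _ lr'; rewrite ltr_norml -/K => /andP[_ g2].
  have := Sge _ (ltW tl); rewrite -(ler_nat R) natrD natrM => bl.
  have : K * (l.+1%:R / r%:R) <= K * (t + e / 3) by apply: ler_wpM2l => //; lra.
  have : K * (t + e / 3 + e / 3) <= n%:R * (t + e / 3 + e / 3) by apply: ler_wpM2r => //; lra.
  lra.
have -> : b%:R / n%:R - t = (b%:R - n%:R * t) / n%:R :> R by field; rewrite gt_eqF.
rewrite normrM normfV (gtr0_norm n0') ler_pdivrMr// ler_norml; lra.
Unshelve. all: by end_near.
Qed.

End glivenko_cantelli.

(** * The asymptotic open set *)

Lemma measurable_finitary_fun d (T : measurableType d) n (f : compN -> T) :
  (forall G H, agree n G H -> f G = f H) -> measurable_fun setT f.
Proof.
move=> fn _ B mB; rewrite setTI; apply: (@finitary_measurable n) => G H GH /=.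
by rewrite (fn G H).
Qed.

Lemma Un_agree (R : realType) i n (G H : compN) : (i <= n)%N ->
  agree n G H -> Un R i G = Un R i H.
Proof.
move=> ij /(agree_leq ij) /restr_agree GH; apply: open01_ext => /=.
by rewrite /Un_set GH.
Qed.

Section asymptotic_open.
Variable R : realType.

Definition has_asymp_open : set compN :=
  [set G | exists U : open01 R, is_asymptotic_open G U].

Lemma dist01_ge0 (U V : open01 R) : 0 <= dist01 U V.
Proof.
apply: le_trans (dist01_ge U V (_ : 0 \in `[0, 1])); first exact: normr_ge0.
by rewrite in_itv /= lexx ler01.
Qed.

Lemma asymp_unique G (U V : open01 R) :
  is_asymptotic_open G U -> is_asymptotic_open G V -> U = V.
Proof.
move=> /cvg_dist01 GU /cvg_dist01 GV; apply: dist01_eq0.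
apply/eqP; rewrite eq_le dist01_ge0 andbT.
apply/ler_addgt0Pr => e e0; rewrite add0r.
have [N GN] := GU (e / 2) ltac:(lra); have [M GM] := GV (e / 2) ltac:(lra).
have := GN (maxn N M) (leq_maxl _ _); have := GM (maxn N M) (leq_maxr _ _).
have := dist01_triangle (Un R (maxn N M) G) U V.
rewrite (dist01_sym (Un R _ G) V); lra.
Qed.

(** U_Gamma as a total function, with default value ]0, 1[ where the limit does not exist. *)
Definition lim_open (G : compN) : open01 R :=
  xget (full01 R) [set U | is_asymptotic_open G U].

Lemma lim_openP G : has_asymp_open G -> is_asymptotic_open G (lim_open G).
Proof. by move=> cG; exact: (xgetPex _ cG). Qed.

Lemma lim_openE G (U : open01 R) : is_asymptotic_open G U -> lim_open G = U.
Proof. by move=> GU; apply: (asymp_unique _ GU); apply: lim_openP; exists U. Qed.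

Lemma lim_open_full G : ~ has_asymp_open G -> lim_open G = full01 R.
Proof. by move=> nG; apply: xgetPN => U GU; apply: nG; exists U. Qed.

Lemma asymp_fullE : asymp_full R = has_asymp_open `&` [set G | lim_open G = full01 R].
Proof.
apply/seteqP; split => [G fG|G [/lim_openP + /= GU]]; last by rewrite GU.
by split; [exists (full01 R)|exact: lim_openE].
Qed.

Lemma asymp_not_fullE :
  asymp_not_full R = has_asymp_open `&` [set G | lim_open G <> full01 R].
Proof.
apply/seteqP; split => [G [U GU U1]|G [/lim_openP GU U1]].
  by split; [exists U|rewrite /= (lim_openE GU)].
by exists (lim_open G).
Qed.

(** Completeness turns existence of the limit into a Cauchy condition, a countable combination of
    finitary events. *)
Lemma has_asymp_openE : has_asymp_open = \bigcap_k \bigcup_N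
  \bigcap_(m in [set m | (N <= m)%N])
  \bigcap_(n in [set n | (N <= n)%N])
    [set G | dist01 (Un R m G) (Un R n G) < k.+1%:R^-1].
Proof.
apply/seteqP; split => [G [U /cvg_dist01 GU] k _|G cG].
  have [|N GN] := GU (k.+1%:R^-1 / 2); first by rewrite divr_gt0// invr_gt0 ltr0n.
  exists N => // m Nm n Nn /=.
  have := dist01_triangle U (Un R m G) (Un R n G).
  have := GN m Nm; have := GN n Nn; rewrite (dist01_sym (Un R m G) U).
  by move: (k.+1%:R^-1) => x; lra.
apply: open01_complete => e e0; pose k := Num.bound e^-1.
have [N _ GN] := cG k I; exists N => m n Nm Nn.
apply: lt_trans (GN m Nm n Nn) _; rewrite invf_plt ?posrE ?ltr0n//.
apply: lt_trans (archi_boundP _) _; first by rewrite invr_ge0 ltW.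
by rewrite ltr_nat.
Qed.

Lemma measurable_dist01_Un m n e :
  measurable [set G | dist01 (Un R m G) (Un R n G) < e].
Proof.
apply: (@finitary_measurable (maxn m n)) => G H GH /=.
by rewrite -!(Un_agree R _ GH) ?leq_maxl ?leq_maxr.
Qed.

Lemma measurable_has_asymp_open : measurable has_asymp_open.
Proof.
rewrite has_asymp_openE; apply: bigcapT_measurable => k; apply: bigcupT_measurable => N.
apply: bigcap_measurableType => m _; apply: bigcap_measurableType => n _.
exact: measurable_dist01_Un.
Qed.

(** For B open, the limit lies in B exactly when, for some k, the ball of radius 1/(k+1) around U_n
    is contained in B for all large n; at each n this is finitary. *)
Lemma measurable_lim_open : measurable_fun setT lim_open.
Proof.
apply: (measurability (@open (open01 R))) => //.
move=> _ [B oB <-]; rewrite setTI.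
have -> : lim_open @^-1` B = (has_asymp_open `&` \bigcup_k \bigcup_N
    \bigcap_(n in [set n | (N <= n)%N])
      [set G | forall V, dist01 (Un R n G) V < k.+1%:R^-1 -> B V]) `|`
    (if pselect (B (full01 R)) then ~` has_asymp_open else set0).
  apply/seteqP; split => [G /= BG|G].
    have [cG|nG] := pselect (has_asymp_open G); last first.
      by right; move: BG; rewrite lim_open_full// => Of; case: pselect.
    left; split => //; have GU := lim_openP cG.
    have /nbhs_ballP[e /= e0 eB] : nbhs (lim_open G) B by exact: open_nbhs_nbhs.
    exists (Num.bound (e / 2)^-1) => //; set k := Num.bound _.
    have ke : k.+1%:R^-1 < e / 2.
      rewrite invf_plt ?posrE ?ltr0n ?divr_gt0//.
      apply: lt_trans (archi_boundP _) _; first by rewrite invr_ge0 ltW// divr_gt0.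
      by rewrite ltr_nat.
    have [N GN] := (cvg_dist01 _ _).1 GU (e / 2) ltac:(lra).
    exists N => // n Nn V nV; apply: eB; rewrite /ball /=.
    apply: le_lt_trans (dist01_triangle (Un R n G) _ _) _.
    have := GN n Nn; have := lt_trans nV ke; lra.
  move=> [[cG [k _ [N _ GN]]]|]; last first.
    by case: pselect => //= Of nG; rewrite lim_open_full.
  have k0 : (0 : R) < k.+1%:R^-1 by rewrite invr_gt0 ltr0n.
  have [M GM] := (cvg_dist01 _ _).1 (lim_openP cG) _ k0.
  apply: (GN (maxn N M)) => /=; first exact: leq_maxl.
  by rewrite dist01_sym; apply: GM; exact: leq_maxr.
apply: measurableU; last first.
  by case: pselect => //= _; apply: measurableC; exact: measurable_has_asymp_open.
apply: measurableI; first exact: measurable_has_asymp_open.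
apply: bigcupT_measurable => k; apply: bigcupT_measurable => N.
apply: bigcap_measurableType => n _; apply: (@finitary_measurable n) => G H GH /=.
by rewrite (Un_agree R (leqnn n) GH).
Qed.

Lemma measurable_full01 : measurable [set full01 R].
Proof.
have -> : [set full01 R] = \bigcap_k [set U | dist01 (full01 R) U < k.+1%:R^-1].
  apply/seteqP; split => [U -> k _ /=|U Uk].
    by rewrite dist01xx invr_gt0 ltr0n.
  apply/esym/dist01_eq0/eqP; rewrite eq_le dist01_ge0 andbT.
  apply/ler_addgt0Pr => e e0; rewrite add0r.
  apply: le_trans (ltW (Uk (Num.bound e^-1) I)) _; rewrite invf_ple ?posrE ?ltr0n//.
  apply: le_trans (ltW (archi_boundP _)) _; first by rewrite invr_ge0 ltW.
  by rewrite ler_nat.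
apply: bigcapT_measurable => k; apply: sub_sigma_algebra.
rewrite openE => U /= Uk; apply/nbhs_ballP.
exists (k.+1%:R^-1 - dist01 (full01 R) U) => /=; first by rewrite subr_gt0.
move=> V; rewrite /ball /= ltrBrDl; apply: le_lt_trans.
exact: dist01_triangle.
Qed.

Lemma measurable_asymp_full : measurable (asymp_full R).
Proof.
rewrite asymp_fullE; apply: measurableI; first exact: measurable_has_asymp_open.
rewrite -[X in measurable X]setTI.
exact: (measurable_lim_open measurableT measurable_full01).
Qed.

Lemma measurable_asymp_not_full : measurable (asymp_not_full R).
Proof.
rewrite asymp_not_fullE; apply: measurableI; first exact: measurable_has_asymp_open.
rewrite -[X in measurable X]setTI.
exact: (measurable_lim_open measurableT (measurableC measurable_full01)).
Qed.

End asymptotic_open.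

(** * Almost everywhere convergence for finite exchangeable measures *)

Section almost_everywhere_convergence.
Context d (Omega : measurableType d) (R : realType) (P : probability Omega R).
Variable X : nat -> {RV P >-> R}.
Hypothesis iidX : iid_uniform X.
Variable lam : {measure set compN -> \bar R}.
Hypothesis lam_fin : (lam setT < +oo)%E.
Hypothesis lam_pull : forall f n A, finperm f -> finitary n A ->
  lam (pull f @^-1` A) = lam A.

Lemma measurable_law_open_Un n A :
  measurable_fun setT (fun G => law_open X (Un R n G) A).
Proof.
by apply: (@measurable_finitary_fun _ _ n) => G H /(Un_agree R (leqnn n)) ->.
Qed.

Let finE B : measurable B -> lam B \is a fin_num.
Proof.
move=> mB; rewrite ge0_fin_numE ?measure_ge0//.
by apply: le_lt_trans lam_fin; apply: le_measure; rewrite ?inE.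
Qed.

Lemma sampling_cvg m A : finitary m A ->
  (\int[lam]_G law_open X (Un R n G) A)%E @[n --> \oo] --> lam A.
Proof.
move=> fA; have mA := finitary_measurable fA.
(* The term n = 0 is dropped: the sampling formula requires n > 0. *)
rewrite -(fineK (finE mA)) -(@cvg_shiftS _ (fun n => (\int[lam]_G law_open X (Un R n G) A)%E)).
have -> : (fun n => \int[lam]_G law_open X (Un R n.+1 G) A)%E =
    EFin \o (fun n => fine (\int[lam]_G law_open X (Un R n.+1 G) A)%E).
  by apply/funext => n /=; rewrite (integral_law_open_Un iidX lam_fin (ltn0Sn n) fA).
apply: cvg_EFin; first by near=> n.
set c := (m ^ 2)%:R * fine (lam setT).
have c0 : 0 <= c by rewrite mulr_ge0// fine_ge0.
apply/cvgrPdist_le => e e0; near=> n; rewrite distrC.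
apply: le_trans (sampling_bound iidX lam_fin lam_pull (ltn0Sn n) fA) _.
rewrite mulrAC -/c ler_pdivrMr ?ltr0n// mulrC -ler_pdivrMr//.
apply: le_trans (ltW (archi_boundP _)) _; first by rewrite divr_ge0// ltW.
rewrite ler_nat; apply: leqW; near: n; exact: nbhs_infty_ge.
Unshelve. all: by end_near.
Qed.

(** A uniform bound on P^U(A) survives averaging over U = U_n(Gamma) and then the limit in n,
    although nothing is yet known about the convergence of U_n. *)
Lemma sampling_le m A (e : R) : finitary m A ->
  (forall U, law_open X U A <= e%:E)%E -> (lam A <= e%:E * lam setT)%E.
Proof.
move=> fA Ae; have e0 : (0 <= e%:E)%E.
  by apply: le_trans (Ae (full01 R)); exact: law_open_ge0.
have cA := sampling_cvg fA; rewrite -(cvg_lim _ cA)//.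
apply: lime_le; first by apply/cvg_ex; exists (lam A).
near=> n; rewrite -integral_cst//.
by apply: ge0_le_integral => //; exact: measurable_law_open_Un.
Unshelve. all: by end_near.
Qed.

(** The factor 2 comes from the triangle inequality through U: both sets are within e of U on the
    good event. *)
Let osc (e : R) a n : set compN := [set G | exists i, [/\ (a <= i)%N, (i <= n)%N &
  2 * e < dist01 (Un R a G) (Un R i G)]].

Let osc_finitary e a n : finitary n (osc e a n).
Proof.
move=> G H GH [i [ai ni ei]]; exists i.
by rewrite -(Un_agree R (leq_trans ai ni) GH) -(Un_agree R ni GH).
Qed.

(* By [sampling_le], it suffices to control the oscillation of U_n under P^U, and
   there [dist01_empirical] bounds it by a quantity that does not depend on U. *)
Lemma has_asymp_open_ae : lam (~` has_asymp_open R) = 0%E.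
Proof.
pose osc_inf (e : R) := \bigcap_a \bigcup_n osc e a n.
have mosc e : measurable (osc_inf e).
  apply: bigcapT_measurable => a; apply: bigcupT_measurable => n.
  exact: finitary_measurable (@osc_finitary _ _ _).
have osc0 e : 0 < e -> lam (osc_inf e) = 0%E.
  move=> e0; apply/eqP; rewrite eq_le measure_ge0 andbT.
  apply/lee_addgt0Pr => eta eta0; rewrite add0e.
  pose T := fine (lam setT); have T0 : 0 <= T by rewrite fine_ge0.
  have d0 : 0 < eta / (T + 1) by rewrite divr_gt0//; lra.
  have [n0 [D [mD PD nD]]] := glivenko_cantelli iidX e0 d0.
  pose a := n0.+1.
  have bound n : (lam (osc e a n) <= (eta / (T + 1))%:E * lam setT)%E.
    apply: (sampling_le (@osc_finitary e a n)) => U.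
    apply: le_trans PD; apply: le_measure; rewrite ?inE//.
      by apply: measurable_sample_comp_pre; exact: finitary_measurable (@osc_finitary _ _ _).
    move=> w [i [ai ni ei]]; apply: contrapT => /nD Dw; move: ei.
    apply/negP; rewrite -leNgt.
    have close k : (a <= k)%N -> dist01 (Un R k (comp_of_open U (fun j => X j w))) U <= e.
      move=> ak; apply: dist01_empirical; first exact: leq_trans ak.
      by move=> t t01; apply: Dw => //; exact: leq_trans ak.
    apply: le_trans (dist01_triangle U _ _) _; rewrite (dist01_sym U).
    have := close _ (leqnn a); have := close _ ai; rewrite /sample_comp; lra.
  apply: (@le_trans _ _ (lam (\bigcup_n osc e a n))).
    apply: le_measure; rewrite ?inE//; last by move=> G; exact.
    apply: bigcupT_measurable => n.
    exact: finitary_measurable (@osc_finitary _ _ _).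
  have cvg_osc : lam (osc e a n) @[n --> \oo] --> lam (\bigcup_n osc e a n).
    apply: nondecreasing_cvg_mu.
    - by move=> n; exact: finitary_measurable (@osc_finitary _ _ _).
    - apply: bigcupT_measurable => n.
      exact: finitary_measurable (@osc_finitary _ _ _).
    - move=> n m nm; apply/subsetPset => G [i [ai ni ei]].
      by exists i; split => //; exact: leq_trans nm.
  rewrite -(cvg_lim _ cvg_osc)//.
  apply: lime_le; first by apply/cvg_ex; exists (lam (\bigcup_n osc e a n)).
  near=> n; apply: le_trans (bound n) _; rewrite -(fineK (finE measurableT)) -/T.
  rewrite -EFinM lee_fin mulrAC ler_pdivrMr; last by lra.
  by apply: ler_wpM2l; [exact: ltW|lra].
apply/eqP; rewrite eq_le measure_ge0 andbT.
apply: (@le_trans _ _ (lam (\bigcup_k osc_inf (k.+1%:R^-1)))).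
  apply: le_measure; rewrite ?inE.
  - by apply: measurableC; exact: measurable_has_asymp_open.
  - exact: bigcupT_measurable.
  move=> G nG; apply: contrapT => nosc; apply: nG; apply: open01_complete => e e0.
  (* Two sets each within 2/(k+1) of U_a are within 4/(k+1) < e of each other. *)
  pose k := Num.bound (4 / e).
  have ke : k.+1%:R^-1 < e / 4.
    rewrite invf_plt ?posrE ?ltr0n ?divr_gt0// invf_div.
    apply: lt_trans (archi_boundP _) _; first by rewrite ltW// divr_gt0.
    by rewrite ltr_nat.
  have [a na] : exists a, forall n, ~ osc k.+1%:R^-1 a n G.
    apply: contrapT => all; apply: nosc; exists k => // a _.
    apply: contrapT => na; apply: all; exists a => n on; apply: na.
    by exists n.
  exists a => m n am an.
  have close i : (a <= i)%N -> dist01 (Un R a G) (Un R i G) <= 2 * k.+1%:R^-1.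
    by move=> ai; rewrite leNgt; apply/negP => ei; apply: (na i); exists i.
  apply: le_lt_trans (dist01_triangle (Un R a G) _ _) _.
  rewrite (dist01_sym _ (Un R a G)).
  by have := close m am; have := close n an; move: ke; move: (k.+1%:R^-1) => x; lra.
apply: le_trans (generalized_Boole_inequality _ _ _) _ => //.
  exact: bigcupT_measurable.
rewrite eseries0// => k _ _; exact: osc0.
Unshelve. all: by end_near.
Qed.

End almost_everywhere_convergence.

(** * Continuity of the law in the open set *)

Section law_open_continuity.
Context d (Omega : measurableType d) (R : realType) (P : probability Omega R).
Variable X : nat -> {RV P >-> R}.
Hypothesis iidX : iid_uniform X.
Implicit Types U : open01 R.

(* End points of components of U: the only values of the X_i for which being in
   a common component may be unstable under small perturbations of U. *)
Let endl U (q : rat) : set R := [set x | [/\ x < ratr q, ~ oset U x &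
  forall y, x < y < ratr q -> oset U y]].

Let endr U (q : rat) : set R := [set x | [/\ ratr q < x, ~ oset U x &
  forall y, ratr q < y < x -> oset U y]].

Let subsingleton_null (B : set R) i : (forall x y, B x -> B y -> x = y) ->
  measurable (X i @^-1` B) /\ P (X i @^-1` B) = 0%E.
Proof.
move=> B1; have [->|/set0P[x Bx]] := eqVneq B set0.
  by rewrite preimage_set0; split => //; exact: measure0.
have -> : B = [set x] by apply/seteqP; split => [y By|y -> //]; exact: B1.
split; first exact: measurable_RV.
rewrite (iid_prob iidX)//; apply/eqP; rewrite eq_le measure_ge0 andbT.
rewrite -(lebesgue_measure_set1 x).
by apply: le_measure; rewrite ?inE//; exact: measurableI.
Qed.

Let endl1 U q x y : endl U q x -> endl U q y -> x = y.
Proof.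
move=> [xq Ux xU] [yq Uy yU]; have [xy|yx|//] := ltgtP x y.
  by exfalso; apply: Uy; apply: xU; rewrite xy.
by exfalso; apply: Ux; apply: yU; rewrite yx.
Qed.

Let endr1 U q x y : endr U q x -> endr U q y -> x = y.
Proof.
move=> [xq Ux xU] [yq Uy yU]; have [xy|yx|//] := ltgtP x y.
  by exfalso; apply: Ux; apply: yU; rewrite xq xy.
by exfalso; apply: Uy; apply: xU; rewrite yq yx.
Qed.

Let enum_rat (k : nat) : rat := odflt 0 (choice.unpickle k).

Let exc U : set Omega := \bigcup_i \bigcup_k
  (X i @^-1` endl U (enum_rat k) `|` X i @^-1` endr U (enum_rat k)).

Let exc_null U : P.-negligible (exc U).
Proof.
apply: negligible_bigcup => i; apply: negligible_bigcup => k.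
apply: negligibleU; (eexists; split; last exact: subset_refl).
- exact: (subsingleton_null i (@endl1 U (enum_rat k))).1.
- exact: (subsingleton_null i (@endl1 U (enum_rat k))).2.
- exact: (subsingleton_null i (@endr1 U (enum_rat k))).1.
- exact: (subsingleton_null i (@endr1 U (enum_rat k))).2.
Qed.

(** If the segment between the two points lies in U, it lies in all nearby sets. Otherwise, off
    [exc], some point strictly between them is missing from U, and nearby sets miss a point close to
    it, still strictly between. *)
Lemma open_cle_stable U (F : nat -> open01 R) w i j : F @ \oo --> U -> ~ exc U w ->
  \forall k \near \oo, sample_comp X (F k) w i j = sample_comp X U w i j.
Proof.
move=> /cvg_dist01 FU nw; pose x i := X i w.
have [ij|ji] := leP (x i) (x j).
  by near=> k; rewrite /sample_comp /= !le_open_cle.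
have [all|] := pselect (forall c, x j <= c <= x i -> oset U c).
  have [e e0 eU] := open01_itv_stable all; have [N FN] := FU e e0.
  exists N => // k /= Nk; rewrite /sample_comp /=.
  have -> : open_cle U (X ^~ w) i j by apply/open_cle_ltP.
  by apply/open_cle_ltP => // c cx; apply: (eU _ (FN k Nk)).
move=> nall; have -> : sample_comp X U w i j = false.
  by apply/negbTE/negP => /(open_cle_ltP _ ji).
(* If only [x j] or [x i] were missing from U, that value would be an end point of a component
   meeting ]x j, x i[, hence in [exc] via a rational q of that interval. *)
have [y yx Uy] : exists2 y, x j < y < x i & ~ oset U y.
  apply: contrapT => ny.
  have oo y : x j < y < x i -> oset U y.
    by move=> yx; apply: contrapT => Uy; apply: ny; exists y.
  have [q] := rat_in_itvoo ji; rewrite in_itv /= => /andP[jq qi].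
  apply: nall => c /andP[jc ci].
  have [cj|cj] := eqVneq c (x j).
    apply: contrapT => Uc; apply: nw; exists j => //; exists (choice.pickle q) => //.
    rewrite /enum_rat choice.pickleK /=; left.
    split; rewrite -?/(x j) -?cj//; first by rewrite cj.
    by move=> y /andP[cy yq]; apply: oo; rewrite -cj cy (lt_trans yq).
  have [ci'|ci'] := eqVneq c (x i).
    apply: contrapT => Uc; apply: nw; exists i => //; exists (choice.pickle q) => //.
    rewrite /enum_rat choice.pickleK /=; right.
    split; rewrite -?/(x i) -?ci'//; first by rewrite ci'.
    by move=> y /andP[cy yq]; apply: oo; rewrite -ci' yq (lt_trans jq).
  by apply: oo; rewrite !lt_neqAle jc ci ci' eq_sym cj.
have [y01|y01] := boolP (y \in `[0, 1]); last first.
  near=> k; apply/negbTE/negP => /(open_cle_ltP _ ji) all.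
  have /oset_sub := all y ltac:(by case/andP: yx => *; rewrite !ltW).
  by move=> /= yoo; move/negP: y01; apply; exact: subset_itv_oo_cc.
have /andP[jy yi] := yx.
have e0 : 0 < Num.min (y - x j) (x i - y) by rewrite lt_min !subr_gt0 jy.
have [N FN] := FU _ e0; exists N => // k /= Nk.
apply/negbTE/negP => /(open_cle_ltP _ ji) all.
have [z [_ Fz]] := dist01_near (FN k Nk) (conj y01 Uy).
rewrite lt_min !ltr_norml => /andP[/andP[z1 z2] /andP[z3 z4]].
by apply: Fz; apply: all; rewrite -/(x j) -/(x i); lra.
Unshelve. all: by end_near.
Qed.

(** Only finitely many comparisons matter, so the indicator of A is almost surely eventually
    constant; dominated convergence concludes. *)
Lemma law_open_cvg n A U (F : nat -> open01 R) : finitary n A ->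
  F @ \oo --> U -> law_open X (F k) A @[k --> \oo] --> law_open X U A.
Proof.
move=> fA FU; have mA := finitary_measurable fA.
pose f V w : \bar R := (\1_(sample_comp X V @^-1` A) w)%:E.
have mf V : measurable_fun setT (f V).
  apply/measurable_EFinP; apply: measurable_indic.
  exact: measurable_sample_comp_pre.
have lawE V : law_open X V A = (\int[P]_w f V w)%E.
  by rewrite integral_indic ?setIT//; exact: measurable_sample_comp_pre.
have fF : {ae P, forall w, setT w -> f (F k) w @[k --> \oo] --> f U w}.
  apply: negligibleS (exc_null U) => w /= nf; apply: contrapT => nw.
  apply: nf => _; apply: cvg_near_cst.
  have : \forall k \near \oo, forall p : 'I_n * 'I_n,
      sample_comp X (F k) w p.1 p.2 = sample_comp X U w p.1 p.2.
    by apply: filter_forall => p; exact: open_cle_stable.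
  apply: filterS => k kw; congr (_%:E); rewrite !indicE.
  have ag : agree n (sample_comp X (F k) w) (sample_comp X U w).
    by move=> i j ni nj; exact: (kw (Ordinal ni, Ordinal nj)).
  suff -> : (w \in sample_comp X (F k) @^-1` A) = (w \in sample_comp X U @^-1` A) by [].
  by apply/idP/idP => /set_mem Aw; apply/mem_set;
    [exact: fA ag Aw|exact: fA (agree_sym ag) Aw].
have [] := @dominated_convergence _ _ _ P setT measurableT (fun k => f (F k)) (f U)
  (cst 1%E) (fun k => mf (F k)) (mf U) fF.
- by apply: finite_measure_integrable_cst.
- apply: aeW => w k _; rewrite gee0_abs ?lee_fin// indicE; by case: (_ \in _).
by move=> _ _; rewrite -lawE; under eq_fun do rewrite -lawE.
Qed.

(** For finitary A the map is sequentially continuous, so its superlevel sets are open in the metric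
    space; Dynkin induction reaches all measurable A. *)
Lemma measurable_law_open A : measurable A ->
  measurable_fun setT (fun U => law_open X U A).
Proof.
rewrite measurable_finitaryE; move: A; apply: dynkin_induction.
- exact: measurable_finitaryE.
- move=> A B [n fA] [m fB]; exists (maxn n m).
  by apply: finitaryI; [apply: finitary_leq fA|apply: finitary_leq fB]; lia.
- by under eq_fun do rewrite law_openT; exact: measurable_cst.
- move=> A [n fA]; have mA := finitary_measurable fA.
  have fineE U : law_open X U A = (fine (law_open X U A))%:E.
    rewrite fineK// ge0_fin_numE ?law_open_ge0//.
    exact: le_lt_trans (law_open_le1 X U mA) (ltry _).
  rewrite (_ : (fun U => _) = EFin \o (fun U => fine (law_open X U A))); last first.
    by apply/funext => U; exact: fineE.
  apply/measurable_EFinP => _; apply: (measurability _ (RGenOInfty.measurableE R)) => //.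
  move=> _ [_ [c ->] <-]; rewrite setTI.
  suff oc : open [set U : open01 R | c < fine (law_open X U A)].
    apply: sub_sigma_algebra; move: oc; congr open.
    by apply/seteqP; split => U /=; rewrite in_itv /= andbT.
  rewrite openE => U /= cU; apply: contrapT => nU.
  have /choice[F FP] : forall k : nat, exists V, dist01 U V < k.+1%:R^-1 /\
      fine (law_open X V A) <= c.
    move=> k; apply: contrapT => nV; apply: nU; apply/nbhs_ballP.
    exists k.+1%:R^-1 => /=; first by rewrite invr_gt0 ltr0n.
    move=> V UV; rewrite /= ltNge; apply/negP => Vc.
    by apply: nV; exists V.
  have FU : F @ \oo --> U.
    apply/cvg_dist01 => e e0; exists (Num.bound e^-1) => k kb.
    apply: lt_trans (FP k).1 _; rewrite invf_plt ?posrE ?ltr0n//.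
    apply: lt_trans (archi_boundP _) _; first by rewrite invr_ge0 ltW.
    by rewrite ltr_nat ltnS.
  have cF := law_open_cvg fA FU.
  have : (law_open X U A <= c%:E)%E.
    rewrite -(cvg_lim _ cF)//; apply: lime_le; first by apply/cvg_ex; eexists; exact: cF.
    by near=> k; rewrite fineE lee_fin; exact: (FP k).2.
  by rewrite fineE lee_fin leNgt cU.
- move=> A mA IH; under eq_fun do rewrite law_openC//.
  apply: emeasurable_funB; [exact: measurable_cst|exact: IH].
- move=> F mF tF IH; under eq_fun do rewrite law_open_bigcup//.
  by apply: ge0_emeasurable_sum => // k U _ _; exact: law_open_ge0.
Unshelve. all: by end_near.
Qed.

End law_open_continuity.

(** * Fragmentation measures *)

Section mixture.
Context d (Omega : measurableType d) (R : realType) (P : probability Omega R).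
Variable X : nat -> {RV P >-> R}.
Hypothesis iidX : iid_uniform X.

Lemma measurable_law_lim_open A : measurable A ->
  measurable_fun setT (fun G => law_open X (lim_open R G) A).
Proof.
move=> mA; apply: (measurableT_comp (measurable_law_open iidX mA)).
exact: measurable_lim_open.
Qed.

Lemma law_mix_measure (nu : {measure set (open01 R) -> \bar R}) :
  exists m : {measure set compN -> \bar R}, forall A, m A = law_mix X nu A.
Proof.
have m0 : law_mix X nu set0 = 0%E.
  by rewrite /law_mix; under eq_integral do rewrite law_open0; rewrite integral0.
have mge0 A : (0 <= law_mix X nu A)%E.
  by apply: integral_ge0 => U _; exact: law_open_ge0.
have madd : semi_sigma_additive (law_mix X nu).
  move=> F mF tF mUF.
  have -> : law_mix X nu (\bigcup_n F n) = (\sum_(n <oo) law_mix X nu (F n))%E.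
    rewrite /law_mix -integral_nneseries//.
    - by apply: eq_integral => U _; exact: law_open_bigcup.
    - by move=> n; exact: measurable_law_open.
  have cv : cvgn (fun n => \sum_(0 <= i < n) law_mix X nu (F i))%E.
    apply: (@is_cvg_nneseries R (fun i => law_mix X nu (F i)) xpredT 0%N) => n _ _.
    exact: mge0.
  by move=> B /cv.
pose mix := isMeasure.Build _ _ _ (law_mix X nu) m0 mge0 madd.
pose m : {measure set compN -> \bar R} := HB.pack (law_mix X nu) mix.
by exists m.
Qed.

Lemma lim_open_law (mu : {measure set compN -> \bar R}) :
  exists2 nu : {measure set (open01 R) -> \bar R},
    forall B, nu B = mu (lim_open R @^-1` B) &
    forall A, measurable A ->
      law_mix X nu A = (\int[mu]_G law_open X (lim_open R G) A)%E.
Proof.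
have mlim := @measurable_lim_open R.
unshelve eexists; [refine (pushforward mu (lim_open R)); exact: mlim|by []|].
move=> A mA; rewrite /law_mix ge0_integral_pushforward//.
exact: measurable_law_open.
Qed.

Section finite.
Variable lam : {measure set compN -> \bar R}.
Hypothesis lam_fin : (lam setT < +oo)%E.
Hypothesis lam_pull : forall f n A, finperm f -> finitary n A ->
  lam (pull f @^-1` A) = lam A.

(** The integrals of P^(U_n)(A) have two limits that must agree: lam(A) by sampling, and the
    integral of P^(U_Gamma)(A) by dominated convergence. *)
Lemma finite_finitary_mixture n A : finitary n A ->
  lam A = (\int[lam]_G law_open X (lim_open R G) A)%E.
Proof.
move=> fA; have mA := finitary_measurable fA.
have fF : {ae lam, forall G, setT G ->
    law_open X (Un R k G) A @[k --> \oo] --> law_open X (lim_open R G) A}.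
  exists (~` has_asymp_open R); split.
    by apply: measurableC; exact: measurable_has_asymp_open.
    exact: (has_asymp_open_ae iidX lam_fin lam_pull).
  move=> G /= nG cG; apply: nG => _.
  exact: (law_open_cvg iidX fA (lim_openP cG)).
have [] := @dominated_convergence _ _ _ lam setT measurableT
  (fun k G => law_open X (Un R k G) A) (fun G => law_open X (lim_open R G) A)
  (cst 1%E) (fun k => @measurable_law_open_Un _ _ _ _ X k A) (measurable_law_lim_open mA) fF.
- apply/integrableP; split => //; under eq_integral do rewrite abse1.
  by rewrite integral_cst// mul1e.
- apply: aeW => G k _; rewrite gee0_abs ?law_open_ge0//; exact: law_open_le1.
move=> _ _ cv; have cs := sampling_cvg iidX lam_fin lam_pull fA.
exact: cvg_unique cs cv.
Qed.

Lemma finite_mixture A : measurable A ->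
  lam A = (\int[lam]_G law_open X (lim_open R G) A)%E.
Proof.
move=> mA.
have [nu _ nuE] := lim_open_law lam; have [m mE] := law_mix_measure nu.
have intE B : measurable B -> m B = (\int[lam]_G law_open X (lim_open R G) B)%E.
  by move=> mB; rewrite mE nuE.
rewrite -intE//; apply: (@measure_unique _ _ _ [set A | exists n, finitary n A]
  (fun=> setT)) => //.
- exact: measurable_finitaryE.
- move=> B C [n fB] [k fC]; exists (maxn n k).
  by apply: finitaryI; [apply: finitary_leq fB|apply: finitary_leq fC]; lia.
- by move=> _; exists 0%N.
- by apply/seteqP; split => // G _; exists 0%N.
- move=> B [n fB]; rewrite intE ?(finite_finitary_mixture fB)//.
  exact: finitary_measurable fB.
Qed.

End finite.

End mixture.

Lemma ge0_integral_mrestr d (T : measurableType d) (R : realType)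
    (mu : {measure set T -> \bar R}) (D : set T) (mD : measurable D)
    (f : T -> \bar R) :
  (forall x, (0 <= f x)%E) -> measurable_fun setT f ->
  (\int[mrestr mu mD]_x f x = \int[mu]_(x in D) f x)%E.
Proof.
move=> f0 mf; rewrite -(setvU D) ge0_integral_setU//.
- rewrite (eq_measure_integral mzero) => [|A mA AD]; last first.
    transitivity (mu (A `&` D)); first by [].
    rewrite (_ : A `&` D = set0) ?measure0//.
    by apply/seteqP; split => // x [/AD].
  rewrite integral_measure_zero add0e; apply: eq_measure_integral => A mA AD.
  transitivity (mu (A `&` D)); first by [].
  by rewrite setIidl.
- exact: measurableC.
- by rewrite setvU.
- by apply/disj_setPS => x [].
Qed.

Section fragmentation_limits.
Context d (Omega : measurableType d) (R : realType) (P : probability Omega R).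
Variable X : nat -> {RV P >-> R}.
Hypothesis iidX : iid_uniform X.
Variable mu : {measure set compN -> \bar R}.
Hypothesis fmu : fragmentation_measure mu.

Definition perm_invariant (D : set compN) : Prop :=
  forall f G, finperm f -> D (pull f G) <-> D G.

Lemma lim_open_shift k G : lim_open R (pull (addn k) G) = lim_open R G.
Proof.
have [cG|nG] := pselect (has_asymp_open R G).
  by apply: lim_openE; apply/asymp_shift; exact: lim_openP.
rewrite !lim_open_full// => -[U kU]; apply: nG; exists U.
exact: (asymp_shift k G U).1 kU.
Qed.

Lemma perm_invariantT : perm_invariant setT.
Proof. by []. Qed.

Lemma perm_invariant_full : perm_invariant (asymp_full R).
Proof. by move=> f G ff; exact: asymp_finperm. Qed.

Lemma perm_invariant_not_full : perm_invariant (asymp_not_full R).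
Proof.
by move=> f G ff; split => -[U GU U1]; exists U => //; apply/(asymp_finperm G U ff).
Qed.

Let mpull f A : measurable A -> measurable (pull f @^-1` A).
Proof. by move=> mA; rewrite -[X in measurable X]setTI; exact: measurable_pull. Qed.

(* The restriction of mu to [nontriv k] is finite, but only invariant under the
   permutations that fix the first k indices, hence the shift. *)
Lemma shifted_restriction D k : measurable D -> perm_invariant D ->
  exists lam : {measure set compN -> \bar R},
  [/\ forall A, lam A = mu (pull (addn k) @^-1` A `&` (nontriv k `&` D)),
      (lam setT < +oo)%E,
      forall f n A, finperm f -> finitary n A -> lam (pull f @^-1` A) = lam A &
      forall A, measurable A ->
        (\int[lam]_G law_open X (lim_open R G) A =
         \int[mu]_(G in nontriv k `&` D) law_open X (lim_open R G) A)%E].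
Proof.
move=> mD iD; have mE : measurable (nontriv k `&` D).
  by apply: measurableI => //; exact: nontriv_measurable.
have mk := measurable_pull (addn k).
unshelve eexists; [refine (pushforward (mrestr mu mE) (pull (addn k))); exact: mk|].
split => [//| |f n A ff fA|A mA].
- apply: le_lt_trans (frag_nontriv fmu k).
  apply: le_measure; rewrite ?inE//; last by move=> G [_ []].
    by apply: measurableI => //; exact: (mpull (addn k) measurableT).
  exact: nontriv_measurable.
- have mA := finitary_measurable fA.
  (* g acts as f on the indices beyond k and fixes the first k, hence preserves both [nontriv k] and
     D. *)
  pose g i := if (i < k)%N then i else (k + f (i - k))%N.
  have gk i : g (k + i)%N = (k + f i)%N by rewrite /g ltnNge leq_addr /= addKn.
  have fg : finperm g.
    have [fI [N fN]] := ff; split.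
      move=> i j; rewrite /g; case: ltnP => ik; case: ltnP => jk //; try lia.
      by move=> /addnI/fI; lia.
    exists (N + k)%N => i Ni; rewrite /g ltnNge (leq_trans _ Ni) ?leq_addl//= fN; lia.
  rewrite /pushforward /mrestr /=.
  rewrite -[RHS](frag_pull fmu fg); last by apply: measurableI => //; exact: mpull.
  congr (mu _); apply/seteqP.
  have gA G : pull f (pull (addn k) G) = pull (addn k) (pull g G).
    by apply: compN_ext => i j /=; rewrite !gk.
  have gE G : nontriv k (pull g G) <-> nontriv k G.
    by split => -[i [j [ik jk Gij]]]; exists i, j; split => //; move: Gij; rewrite /= /g ik jk.
  split => G [/= GA [Gk GD]]; split => /=.
  + by rewrite -gA.
  + by split; [apply/gE|apply/iD].
  + by rewrite gA.
  + by split; [apply/gE|apply/(iD g G fg)].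
- have f0 G : (0 <= law_open X (lim_open R G) A)%E by exact: law_open_ge0.
  rewrite ge0_integral_pushforward//; last exact: measurable_law_lim_open.
  rewrite preimage_setT -(ge0_integral_mrestr mu mE f0 (measurable_law_lim_open iidX mA)).
  by apply: eq_integral => G _ /=; rewrite lim_open_shift.
Qed.

(** The identity used on both parts: given what the first k indices show, the later ones are sampled
    from U_Gamma. *)
Lemma shifted_mixture D k A : measurable D -> perm_invariant D -> measurable A ->
  mu (pull (addn k) @^-1` A `&` (nontriv k `&` D)) =
  (\int[mu]_(G in nontriv k `&` D) law_open X (lim_open R G) A)%E.
Proof.
move=> mD iD mA; have [lam [lamE lam_fin lam_pull lam_int]] := shifted_restriction k mD iD.
by rewrite -lamE -lam_int//; exact: finite_mixture.
Qed.

Lemma frag_one : mu [set one_compN] = 0%E.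
Proof. by case: fmu. Qed.

Lemma frag_null A : measurable A -> (forall k, mu (A `&` nontriv k) = 0%E) ->
  mu A = 0%E.
Proof.
move=> mA A0; apply/eqP; rewrite eq_le measure_ge0 andbT.
have AE : A `<=` [set one_compN] `|` \bigcup_k (A `&` nontriv k).
  move=> G AG; have [->|/eqP G1] := eqVneq G one_compN; [by left|right].
  have : (~` [set one_compN]) G by [].
  by rewrite -bigcup_nontriv => -[k _ Gk]; exists k.
have mk k : measurable (A `&` nontriv k).
  by apply: measurableI => //; exact: nontriv_measurable.
have mU := bigcupT_measurable _ mk; have m1 := measurable_set1_compN one_compN.
apply: (@le_trans _ _ (mu ([set one_compN] `|` \bigcup_k (A `&` nontriv k)))).
  by apply: le_measure; rewrite ?inE//; exact: measurableU.
apply: le_trans (measureU2 _ m1 mU) _.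
rewrite [X in (X + _)%E](_ : _ = 0%E) ?add0e; last exact: frag_one.
apply: le_trans (generalized_Boole_inequality mu mk mU) _.
by rewrite eseries0.
Qed.

Lemma frag_has_asymp_open : mu (~` has_asymp_open R) = 0%E.
Proof.
have mc : measurable (~` has_asymp_open R).
  by apply: measurableC; exact: measurable_has_asymp_open.
apply: frag_null => // k.
have [lam [lamE lam_fin lam_pull _]] := shifted_restriction k measurableT perm_invariantT.
have := has_asymp_open_ae iidX lam_fin lam_pull; rewrite lamE setIT; congr (mu (_ `&` _) = _).
apply/seteqP; split => G /= nG [U GU]; apply: nG; exists U.
  by apply/asymp_shift; exact: GU.
exact: (asymp_shift k G U).1 GU.
Qed.

End fragmentation_limits.

(** * Compositions whose asymptotic open set is ]0, 1[ *)

(** If j is strictly before i, the other indices are pairwise equivalent and form one class. This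
    class contains i, and then j is alone in front, or j, and then i is alone at the end; otherwise
    two disjoint pairs would be separated. *)
Lemma pair_classes (G : compN) :
  (forall a b c e, uniq [:: a; b; c; e] -> G a b && G b a \/ G c e && G e c) ->
  G = one_compN \/ exists i, G = eps_l_point i \/ G = eps_r_point i.
Proof.
move=> pairs; have [G1|G1] := pselect (forall i j, G i j).
  by left; apply: compN_ext => i j; rewrite G1.
right; move: G1 => /existsNP[i /existsNP[j /negP Gij]].
have Gji : G j i by have := cle_total G i j; rewrite (negbTE Gij).
have ij : i != j by apply: contraNneq Gij => ->; rewrite cle_refl.
have others c e : c != i -> c != j -> e != i -> e != j -> G c e.
  move=> ci cj ei ej; have [->|ce] := eqVneq c e; first exact: cle_refl.
  have [|/andP[ij' _]|/andP[]//] := pairs i j c e; last by rewrite ij' in Gij.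
  by rewrite /= !inE !negb_or ij ce !(eq_sym i) !(eq_sym j) ci ei cj ej.
(* A representative of the class of the other indices. *)
pose l := (i + j).+1.
have li : l != i by rewrite /l; lia.
have lj : l != j by rewrite /l; lia.
have [Gli|nGli] := boolP (G l i && G i l).
  exists j; left; apply: compN_ext => a b /=; have /andP[G1 G2] := Gli.
  have [->|aj] := eqVneq a j.
    have [->|bj] := eqVneq b j; first exact: cle_refl.
    apply: (cle_trans Gji); have [->|bi] := eqVneq b i; first exact: cle_refl.
    exact: cle_trans G2 (others _ _ li lj bi bj).
  have [->|bj] := eqVneq b j => /=.
    apply/negbTE; apply: contra Gij => Gaj; apply: cle_trans Gaj.
    have [->|ai] := eqVneq a i; first exact: cle_refl.
    exact: cle_trans G2 (others _ _ li lj ai aj).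
  have [->|ai] := eqVneq a i; have [->|bi] := eqVneq b i.
  - exact: cle_refl.
  - exact: cle_trans G2 (others _ _ li lj bi bj).
  - exact: cle_trans (others _ _ ai aj li lj) G1.
  - exact: others.
have [Glj|nGlj] := boolP (G l j && G j l).
  exists i; right; apply: compN_ext => a b /=; have /andP[G1 G2] := Glj.
  have [->|bi] := eqVneq b i.
    rewrite orbT; have [->|ai] := eqVneq a i; first exact: cle_refl.
    apply: (cle_trans _ Gji); have [->|aj] := eqVneq a j; first exact: cle_refl.
    exact: cle_trans (others _ _ ai aj li lj) G1.
  have [->|ai] := eqVneq a i => /=.
    apply/negbTE; apply: contra Gij => Gib; apply: (cle_trans Gib).
    have [->|bj] := eqVneq b j; first exact: cle_refl.
    exact: cle_trans (others _ _ bi bj li lj) G1.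
  have [->|aj] := eqVneq a j; have [->|bj] := eqVneq b j.
  - exact: cle_refl.
  - exact: cle_trans G2 (others _ _ li lj bi bj).
  - exact: cle_trans (others _ _ ai aj li lj) G1.
  - exact: others.
(* If l is equivalent to neither, the disjoint pairs {i, l} and {l + 1, j} are both separated. *)
exfalso; have l1i : l.+1 != i by rewrite /l; lia.
have l1j : l.+1 != j by rewrite /l; lia.
have [||/andP[G1 G2]] := pairs l i l.+1 j.
- rewrite /= !inE !negb_or li lj ij l1j (eq_sym i l.+1) l1i !andbT.
  by apply/negP => /eqP; lia.
- by rewrite (negbTE nGli).
move: nGlj; rewrite (cle_trans (others _ _ li lj l1i l1j) G1).
by rewrite (cle_trans G2 (others _ _ l1i l1j li lj)).
Qed.

Lemma eps_l_point_inj : injective eps_l_point.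
Proof.
move=> i j ij; have := congr1 (fun G : compN => G j i) ij.
by rewrite /= eqxx orbF eqxx /= => /eqP.
Qed.

Lemma eps_r_point_inj : injective eps_r_point.
Proof.
move=> i j ij; have := congr1 (fun G : compN => G i j) ij.
by rewrite /= !eqxx orbT /= => /eqP.
Qed.

Lemma eps_l_r_point i j : eps_l_point i <> eps_r_point j.
Proof.
have ai : ((i + j).+1 == i) = false by lia.
have aj : ((i + j).+1 == j) = false by lia.
by move=> /(congr1 (fun G : compN => G (i + j).+1 i)); rewrite /= ai aj eqxx.
Qed.

Section full_part.
Variable R : realType.

Lemma one_full : asymp_full R one_compN.
Proof.
apply/cvg_dist01 => e e0; exists 1%N => n n0; rewrite (_ : Un R n _ = full01 R) ?dist01xx//.
apply: open01_ext; apply/seteqP; split => [x /oset_sub//|x /=].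
rewrite in_itv /= => x01; apply/Un_setP; exists 0%N => //.
rewrite (@count_lt_eq _ _ pred0)//= (@count_lt_eq _ (fun=> true) predT)//.
by rewrite /count_lt count_pred0 count_predT size_iota mul0r divff// pnatr_eq0 -lt0n.
Qed.

(** Beyond index i a single block remains, and the asymptotic open set does not see the first
    indices. *)
Lemma eps_l_full i : asymp_full R (eps_l_point i).
Proof.
apply: (asymp_shift i.+1 (eps_l_point i) (full01 R)).1.
have -> : pull (addn i.+1) (eps_l_point i) = one_compN.
  by apply: compN_ext => a b /=; lia.
exact: one_full.
Qed.

Lemma eps_r_full i : asymp_full R (eps_r_point i).
Proof.
apply: (asymp_shift i.+1 (eps_r_point i) (full01 R)).1.
have -> : pull (addn i.+1) (eps_r_point i) = one_compN.
  by apply: compN_ext => a b /=; lia.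
exact: one_full.
Qed.

Lemma measure_range_points (mu : {measure set compN -> \bar R}) (e : nat -> compN) (c : R) :
  injective e -> 0 <= c -> (forall i, mu [set e i] = c%:E) ->
  forall A, measurable A ->
    mu (A `&` range e) = (c%:E * mseries (fun i => @dirac _ compN (e i) R) 0 A)%E.
Proof.
move=> eI c0 ec A mA.
have -> : A `&` range e = \bigcup_i (A `&` [set e i]).
  apply/seteqP; split => [G [AG [i _ eG]]|G [i _ [AG eG]]]; first by exists i.
  by split => //; exists i.
have m1 i : measurable (A `&` [set e i]).
  by apply: measurableI => //; exact: measurable_set1_compN.
have t1 : trivIset setT (fun i => A `&` [set e i]).
  by move=> i j _ _ [G [[_ ->] [_ /eI]]].
transitivity (\sum_(i <oo) mu (A `&` [set e i]))%E.
  apply/esym/cvg_lim => //; apply: measure_sigma_additive => //.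
transitivity (\sum_(i <oo) (c%:E * \d_(e i) A))%E.
  apply: eq_eseriesr => i _; rewrite diracE.
  have [Ae|Ae] := pselect (A (e i)).
    by rewrite mem_set// mule1 -(ec i); congr (mu _); apply: setIidr => G ->.
  rewrite memNset// mule0 (_ : _ `&` _ = set0) ?measure0//.
  by apply/seteqP; split => // G [AG Ge]; apply: Ae; rewrite -Ge.
by rewrite nneseriesZl.
Qed.

Section fragmentation_full.
Context d (Omega : measurableType d) (P : probability Omega R).
Variable X : nat -> {RV P >-> R}.
Hypothesis iidX : iid_uniform X.
Variable mu : {measure set compN -> \bar R}.
Hypothesis fmu : fragmentation_measure mu.

Lemma law_open_full_nontriv n : law_open X (full01 R) (nontriv n) = 0%E.
Proof.
have mn := measurable_sample_comp_pre X (full01 R) (nontriv_measurable n).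
suff : P.-negligible (sample_comp X (full01 R) @^-1` nontriv n) by move/negligibleP; apply.
apply: (@negligibleS _ _ _ _ (\bigcup_i X i @^-1` (~` `]0, 1[))).
  move=> w [i [j [_ _ Gij]]]; apply: contrapT => nw; move/negP: Gij; apply.
  have x01 k : 0 < X k w < 1.
    by apply: contrapT => kw; apply: nw; exists k => //; rewrite /= in_itv.
  have [ij|ji] := leP (X i w) (X j w); first exact: le_open_cle.
  apply/(@open_cle_ltP _ _ (X ^~ w) _ _ ji) => c /andP[jc ci] /=; rewrite in_itv /=.
  by have := x01 i; have := x01 j; lra.
apply: negligible_bigcup => i; apply/negligibleP.
  by apply: measurable_RV; apply: measurableC; exact: measurable_itv.
transitivity (1 - P (X i @^-1` `](0 : R)%R, 1%R[%classic))%E.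
  by apply: probability_setC; apply: measurable_RV; exact: measurable_itv.
by rewrite (iid_itv iidX) ?subr0 ?subee// lexx ler01.
Qed.

(* When U_Gamma = ]0, 1[, the conditional law of two indices given the others is
   P^(]0, 1[), which puts them in the same block. *)
Lemma full_two_pairs a b c e : uniq [:: a; b; c; e] ->
  mu ([set G : compN | ~ (G a b && G b a) /\ ~ (G c e && G e c)] `&` asymp_full R) = 0%E.
Proof.
move=> abce; pose g i := nth 0%N [:: a; b; c; e] i.
have [|f ff fg] := @finperm_extend 4 g.
  by move=> i j i4 j4 /eqP; rewrite nth_uniq// => /eqP.
have mfull := measurable_asymp_full R.
(* The event that {0, 1} and {2, 3} are both separated; f carries 0, 1, 2, 3 to a, b, c, e. *)
pose N0 := pull (addn 2) @^-1` nontriv 2 `&` (nontriv 2 `&` asymp_full R).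
have mN0 : measurable N0.
  apply: measurableI; last by apply: measurableI => //; exact: nontriv_measurable.
  by rewrite -[X in measurable X]setTI; apply: measurable_pull => //; exact: nontriv_measurable.
have N00 : mu N0 = 0%E.
  rewrite (shifted_mixture iidX fmu) //; last 2 first.
  - exact: perm_invariant_full.
  - exact: nontriv_measurable.
  apply: integral0_eq => G [_ Gf]; rewrite (lim_openE Gf).
  exact: law_open_full_nontriv.
apply/eqP; rewrite eq_le measure_ge0 andbT -N00 -(frag_pull fmu ff mN0).
apply: le_measure; rewrite ?inE.
- apply: measurableI => //; apply: (@finitary_measurable (a + b + c + e).+1).
  by move=> G H GH /=; rewrite !GH//; lia.
- by rewrite -[X in measurable X]setTI; exact: measurable_pull.
move=> G [[/negP Gab /negP Gce] Gf].
have pairE i j : (i < 4)%N -> (j < 4)%N -> pull f G i j = G (g i) (g j).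
  by move=> i4 j4 /=; rewrite !fg.
split; last split.
- have [Gg|Gg] := boolP (G c e).
    exists 1%N, 0%N; split => //.
    by have /= -> := @pairE 3 2 isT isT; move: Gce; rewrite /g /= Gg.
  by exists 0%N, 1%N; split => //; have /= -> := @pairE 2 3 isT isT.
- have [Gg|Gg] := boolP (G a b).
    exists 1%N, 0%N; split => //.
    by have /= -> := @pairE 1 0 isT isT; move: Gab; rewrite /g /= Gg.
  by exists 0%N, 1%N; split => //; have /= -> := @pairE 0 1 isT isT.
- exact/asymp_finperm.
Qed.

Let eps_range := range eps_l_point `|` range eps_r_point.

Let range_measurable (e : nat -> compN) : measurable (range e).
Proof.
have -> : range e = \bigcup_i [set e i].
  by apply/seteqP; split => [G [i _ <-]|G [i _ ->]]; exists i.
by apply: bigcupT_measurable => i; exact: measurable_set1_compN.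
Qed.

Let eps_range_measurable : measurable eps_range.
Proof. by apply: measurableU; exact: range_measurable. Qed.

Lemma full_null : mu (asymp_full R `\` eps_range) = 0%E.
Proof.
pose Q (p : nat * nat * (nat * nat)) : set compN :=
  if uniq [:: p.1.1; p.1.2; p.2.1; p.2.2] then
    [set G : compN | ~ (G p.1.1 p.1.2 && G p.1.2 p.1.1) /\
       ~ (G p.2.1 p.2.2 && G p.2.2 p.2.1)] `&` asymp_full R
  else set0.
have mQ p : measurable (Q p).
  rewrite /Q; case: ifP => // _; apply: measurableI; last exact: measurable_asymp_full.
  apply: (@finitary_measurable (p.1.1 + p.1.2 + p.2.1 + p.2.2).+1).
  by move=> G H GH /=; rewrite !GH//; lia.
have Q0 p : mu (Q p) = 0%E.
  by rewrite /Q; case: ifP => [/full_two_pairs//|_]; rewrite measure0.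
have m1 := measurable_set1_compN one_compN.
have mE : measurable (asymp_full R `\` eps_range).
  by apply: measurableD => //; exact: measurable_asymp_full.
suff : mu.-negligible (asymp_full R `\` eps_range) by move/negligibleP; apply.
apply: (@negligibleS _ _ _ _ ([set one_compN] `|`
    \bigcup_k (if choice.unpickle k is Some p then Q p else set0))).
  move=> G [Gf Ge]; have [pairs|] := pselect (forall a b c e,
      uniq [:: a; b; c; e] -> G a b && G b a \/ G c e && G e c).
    left; have [//|[i [Gi|Gi]]] := pair_classes pairs.
      by exfalso; apply: Ge; left; exists i.
    by exfalso; apply: Ge; right; exists i.
  move=> /existsNP[a /existsNP[b /existsNP[c /existsNP[e]]]].
  move=> /not_implyP[abce /not_orP[Gab Gce]]; right.
  exists (choice.pickle ((a, b), (c, e))) => //.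
  by rewrite choice.pickleK /Q ifT.
apply: negligibleU.
  by apply/negligibleP => //; exact: frag_one fmu.
apply: negligible_bigcup => k; move: (choice.unpickle k) => [p|].
  by apply/negligibleP => //; exact: Q0.
exact: negligible_set0.
Qed.

(** A transposition carries [e 0] to [e i], so all these atoms have one mass, finite because [e 0]
    lies in [nontriv 2]. *)
Let frag_point (e : nat -> compN) :
  (forall f i, finperm f -> pull f (e (f i)) = e i) ->
  (forall i, nontriv i.+2 (e i)) ->
  exists2 c : R, 0 <= c & forall i, mu [set e i] = c%:E.
Proof.
move=> fe ne; exists (fine (mu [set e 0%N])); first exact: fine_ge0.
have fin0 : mu [set e 0%N] \is a fin_num.
  rewrite ge0_fin_numE ?measure_ge0//; apply: le_lt_trans (frag_nontriv fmu 2).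
  apply: le_measure; rewrite ?inE; [exact: measurable_set1_compN|exact: nontriv_measurable|].
  by move=> G ->; exact: ne.
move=> i; rewrite fineK//.
rewrite -(frag_pull fmu (finperm_swap 0 i) (measurable_set1_compN (e 0%N))).
congr (mu _); apply/seteqP; split => G /=.
  by move=> ->; exact: (fe _ 0%N (finperm_swap 0 i)).
move=> fG; rewrite -(fe _ i (finperm_swap 0 i)).
have -> : swap 0 i i = 0%N by rewrite /swap eqxx; case: eqVneq.
by rewrite -fG pull_comp; apply: compN_ext => a b /=; rewrite !swapK.
Qed.

Lemma full_part : exists c_l c_r : R, [/\ 0 <= c_l, 0 <= c_r &
  forall A, measurable A -> mu (A `&` asymp_full R) =
    (c_l%:E * eps_l R A + c_r%:E * eps_r R A)%E].
Proof.
have [|i|c_l cl0 clE] := @frag_point eps_l_point.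
- by move=> f i [fI _]; apply: compN_ext => a b /=; rewrite !(inj_eq fI).
- by exists i.+1, i; split => //=; rewrite eqxx orbF; lia.
have [|i|c_r cr0 crE] := @frag_point eps_r_point.
- by move=> f i [fI _]; apply: compN_ext => a b /=; rewrite !(inj_eq fI).
- by exists i, i.+1; split => //=; rewrite eqxx /=; lia.
exists c_l, c_r; split => // A mA.
rewrite -(measure_range_points eps_l_point_inj cl0 clE mA).
rewrite -(measure_range_points eps_r_point_inj cr0 crE mA).
have mf := measurable_asymp_full R.
rewrite -measureU.
- rewrite -setIUr -/eps_range.
  rewrite (measureDI mu (measurableI _ _ mA mf) eps_range_measurable).
  rewrite [X in (X + _)%E](_ : _ = 0%E) ?add0e.
    congr (mu _); rewrite -setIA; congr (A `&` _); apply: setIidr.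
    by move=> G [[i _ <-]|[i _ <-]]; [exact: eps_l_full|exact: eps_r_full].
  apply/eqP; rewrite eq_le measure_ge0 andbT -full_null; apply: le_measure; rewrite ?inE.
  + by apply: measurableD => //; exact: measurableI.
  + exact: measurableD.
  + by move=> G [[_ Gf] Ge].
- by apply: measurableI => //; exact: range_measurable.
- by apply: measurableI => //; exact: range_measurable.
- apply/seteqP; split => // G [[_ [i _ <-]] [_ [j _ ji]]].
  exact: (@eps_l_r_point i j).
Qed.

End fragmentation_full.

End full_part.

(** * Compositions whose asymptotic open set is not ]0, 1[ *)

Section not_full_part.
Context d (Omega : measurableType d) (R : realType) (P : probability Omega R).
Variable X : nat -> {RV P >-> R}.
Hypothesis iidX : iid_uniform X.
Variable mu : {measure set compN -> \bar R}.
Hypothesis fmu : fragmentation_measure mu.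

Let mnf := measurable_asymp_not_full R.

Let f0 A G : (0 <= law_open X (lim_open R G) A)%E.
Proof. exact: law_open_ge0. Qed.

Let mE k : measurable (nontriv k `&` asymp_not_full R).
Proof. by apply: measurableI => //; exact: nontriv_measurable. Qed.

Lemma shift_not_full k G : asymp_not_full R G -> pull (addn k) G <> one_compN.
Proof.
move=> [U GU U1] k1; apply: U1.
have : is_asymptotic_open (pull (addn k) G) U by apply/asymp_shift.
rewrite k1 => oneU.
exact: (asymp_unique oneU (@one_full R)).
Qed.

(** The first m indices can be ignored when exhausting A: this leaves room for an event on those
    indices, independently of the truncation at k. *)
Lemma bigcup_shift_nontriv m (A : set compN) : A `<=` asymp_not_full R ->
  A = \bigcup_k (A `&` pull (addn m) @^-1` nontriv k).
Proof.
move=> Anf; apply/seteqP; split => [G AG|G [k _ []]//].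
have : (~` [set one_compN]) (pull (addn m) G) by apply: shift_not_full; exact: Anf.
by rewrite -bigcup_nontriv => -[k _ Gk]; exists k.
Qed.

Lemma shifted_not_full k m A : finitary m A ->
  mu (pull (addn k) @^-1` A `&` (nontriv k `&` asymp_not_full R)) =
  mu (A `&` asymp_not_full R `&` pull (addn m) @^-1` nontriv k).
Proof.
(* f exchanges the first k indices with the next m ones *)
move=> fA; pose f i := if (i < m)%N then (k + i)%N else if (i < k + m)%N then (i - m)%N else i.
have ff : finperm f.
  split; last first.
    by exists (k + m)%N => n kn; rewrite /f !ltnNge kn (leq_trans (leq_addl _ _) kn).
  move=> i j; rewrite /f; have [im|im] := ltnP i m; have [jm|jm] := ltnP j m;
    have [ik|ik] := ltnP i (k + m); have [jk|jk] := ltnP j (k + m); lia.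
have mA := finitary_measurable fA.
rewrite -[RHS](frag_pull fmu ff); last first.
  apply: measurableI; first exact: measurableI.
  by rewrite -[X in measurable X]setTI; apply: measurable_pull => //; exact: nontriv_measurable.
congr (mu _).
have fk G : agree m (pull (addn k) G) (pull f G).
  by move=> i j im jm; rewrite /= /f im jm.
have fm G : agree k (pull (addn m) (pull f G)) G.
  move=> i j ik jk; rewrite /= /f !ltnNge !leq_addr /= !addKn.
  by rewrite ![(k + m <= _)%N]leqNgt ![(k + m)%N]addnC !ltn_add2l ik jk.
have nf G := @perm_invariant_not_full R f G ff.
apply/seteqP; split => G /=.
  move=> [GA [Gk Gn]]; split; first by split; [exact: fA (fk G) GA|apply/nf].
  exact: nontriv_finitary (agree_sym (fm G)) Gk.
move=> [[GA Gn] Gk]; split; first exact: fA (agree_sym (fk G)) GA.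
by split; [exact: nontriv_finitary (fm G) Gk|apply/nf].
Qed.

Lemma cvg_integral_not_full A : measurable A ->
  (\int[mu]_(G in nontriv k `&` asymp_not_full R) law_open X (lim_open R G) A)%E
    @[k --> \oo] -->
  (\int[mrestr mu mnf]_G law_open X (lim_open R G) A)%E.
Proof.
move=> mA; rewrite (ge0_integral_mrestr mu mnf (f0 A) (measurable_law_lim_open iidX mA)).
have e : \bigcup_k (nontriv k `&` asymp_not_full R) = asymp_not_full R.
  rewrite [RHS](@bigcup_shift_nontriv 0 (asymp_not_full R))//.
  by apply: eq_bigcupr => k _; rewrite setIC; congr (_ `&` _).
have := @ge0_nondecreasing_set_cvg_integral _ _ R
  (fun k => nontriv k `&` asymp_not_full R) (fun G => law_open X (lim_open R G) A) mu.
rewrite e; apply=> //.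
- by move=> k l kl; apply/subsetPset => G [/(nontriv_leq kl)].
- by move=> k; apply: measurable_funTS; exact: measurable_law_lim_open.
Qed.

(** For finitary A, [shifted_not_full] and [shifted_mixture] equate two sequences in k. One
    increases to mu(A, U_Gamma <> ]0,1[), the other to the integral defining [law_mix]. Uniqueness
    of measures extends this to all A. *)
Lemma not_full_part : exists nu : {measure set (open01 R) -> \bar R},
  nu [set full01 R] = 0%E /\
  forall A, measurable A -> mu (A `&` asymp_not_full R) = law_mix X nu A.
Proof.
have [nu nuE nuI] := lim_open_law iidX (mrestr mu mnf).
exists nu; split.
  rewrite nuE; transitivity (mu (lim_open R @^-1` [set full01 R] `&` asymp_not_full R)).
    by [].
  rewrite (_ : _ `&` _ = set0) ?measure0//; apply/seteqP; split => // G [/= Gf].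
  by rewrite asymp_not_fullE => -[_ /= /(_ Gf)].
have [m mE'] := law_mix_measure iidX nu.
have fin n A : finitary n A -> mu (A `&` asymp_not_full R) = law_mix X nu A.
  move=> fA; have mA := finitary_measurable fA; rewrite nuI//.
  have cI := cvg_integral_not_full mA.
  have mnt k : measurable (pull (addn n) @^-1` nontriv k).
    by rewrite -[X in measurable X]setTI; apply: measurable_pull => //; exact: nontriv_measurable.
  have mAn : measurable (A `&` asymp_not_full R) by exact: measurableI.
  have cM : mu (A `&` asymp_not_full R `&` pull (addn n) @^-1` nontriv k) @[k --> \oo] -->
      mu (\bigcup_k (A `&` asymp_not_full R `&` pull (addn n) @^-1` nontriv k)).
    apply: nondecreasing_cvg_mu.
    - by move=> k; exact: measurableI.
    - by apply: bigcupT_measurable => k; exact: measurableI.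
    - by move=> k l kl; apply/subsetPset => G [AG /(nontriv_leq kl)].
  rewrite -bigcup_shift_nontriv in cM; last by move=> G [].
  have E : (fun k => mu (A `&` asymp_not_full R `&` pull (addn n) @^-1` nontriv k)) =
      (fun k => \int[mu]_(G in nontriv k `&` asymp_not_full R)
                  law_open X (lim_open R G) A)%E.
    apply/funext => k; rewrite -(shifted_not_full k fA) (shifted_mixture iidX fmu)//.
    exact: perm_invariant_not_full.
  by rewrite E in cM; exact: cvg_unique cM cI.
(* Each truncated integral is the mass of compositions trivial beyond k, which [shift_not_full]
   excludes. *)
have one0 : law_mix X nu [set one_compN] = 0%E.
  have m1 := measurable_set1_compN one_compN; rewrite nuI//.
  apply: cvg_unique (cvg_integral_not_full m1) _ => //.
  apply: cvg_near_cst; near=> k.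
  rewrite -(shifted_mixture iidX fmu k mnf (@perm_invariant_not_full R) m1).
  rewrite (_ : _ `&` _ = set0) ?measure0//; apply/seteqP; split => // G [/= Gk [_ Gn]].
  exact: shift_not_full Gn Gk.
move=> A mA; rewrite -mE'; transitivity (mrestr mu mnf A); first by [].
apply: compN_measure_unique => //.
- by move=> n B fB; rewrite mE' -(fin n B fB).
- rewrite mE' one0; transitivity (mu ([set one_compN] `&` asymp_not_full R)) => //.
  apply/eqP; rewrite eq_le measure_ge0 andbT -(frag_one fmu); apply: le_measure; rewrite ?inE.
  + by apply: measurableI => //; exact: measurable_set1_compN.
  + exact: measurable_set1_compN.
  + by move=> G [].
- apply: le_lt_trans (_ : (mu [set one_compN] < +oo)%E); last by rewrite (frag_one fmu) ltry.
  apply: le_measure; rewrite ?inE; [|exact: measurable_set1_compN|by move=> G []].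
  by apply: measurableI => //; exact: measurable_set1_compN.
- move=> n; apply: le_lt_trans (frag_nontriv fmu n).
  apply: le_measure; rewrite ?inE; [|exact: nontriv_measurable|by move=> G []].
  by apply: measurableI => //; exact: nontriv_measurable.
Unshelve. all: by end_near.
Qed.

End not_full_part.

(** * Dislocation measures *)

Section dislocation.
Context d (Omega : measurableType d) (R : realType) (P : probability Omega R).
Variable X : nat -> {RV P >-> R}.
Hypothesis iidX : iid_uniform X.
Implicit Types U : open01 R.

Lemma measurable_component U x : measurable (connected_component (oset U) x).
Proof.
apply: is_interval_measurable; apply/connected_intervalP.
exact: component_connected.
Qed.

Lemma component_sub01 U x : connected_component (oset U) x `<=` `]0, 1[.
Proof. by move=> y /connected_component_sub /oset_sub. Qed.

Lemma largest_component_le1 U : (largest_component U <= 1)%E.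
Proof.
apply: ge_ereal_sup => _ [x _ <-].
have -> : 1%E = lebesgue_measure (`]0, 1[%classic : set R).
  by rewrite lebesgue_measure_itv /= lte_fin ltr01 oppr0 addr0.
apply: le_measure; rewrite ?inE; last exact: component_sub01.
- exact: measurable_component.
- exact: measurable_itv.
Qed.

Let two_cells (B0 B1 : set R) U : measurable B0 -> measurable B1 ->
  (forall x y, B0 x -> B1 y -> exists2 z, x <= z <= y & ~ oset U z) ->
  (forall x y, B0 x -> B1 y -> x < y) ->
  (P (X 0 @^-1` B0) * P (X 1 @^-1` B1) <= law_open X U (nontriv 2))%E.
Proof.
move=> m0 m1 gap lt01; pose B i := if i == 0%N then B0 else B1.
have mB i : measurable (B i) by rewrite /B; case: ifP.
have := iid_prod iidX 2 mB; rewrite big_ord_recl big_ord1 /= => <-.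
apply: le_measure; rewrite ?inE.
- by apply: bigcap_measurableType => i _; exact: measurable_RV.
- by apply: measurable_sample_comp_pre; exact: nontriv_measurable.
move=> w Bw; have w0 := Bw 0%N isT; have w1 := Bw 1%N isT.
exists 1%N, 0%N; split => //; apply/negP.
have x01 := lt01 _ _ w0 w1.
have [z zx Uz] := gap _ _ w0 w1.
by move=> /(@open_cle_ltP _ _ (X ^~ w) _ _ x01) /(_ z zx).
Qed.

(* With p := P^U(Gamma_[2] <> 1_2), the interval ]2p, 1 - 2p[ lies in U: if c is
   not in U, then X_0 < c < X_1 separates 0 and 1. *)
Lemma largest_component_bound U :
  (1 - largest_component U <= 4%:E * law_open X U (nontriv 2))%E.
Proof.
have mn := measurable_sample_comp_pre X U (nontriv_measurable 2).
have pE : law_open X U (nontriv 2) = (fine (law_open X U (nontriv 2)))%:E.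
  rewrite fineK// ge0_fin_numE ?law_open_ge0//.
  exact: le_lt_trans (law_open_le1 X U (nontriv_measurable 2)) (ltry _).
have p0 : 0 <= fine (law_open X U (nontriv 2)) by rewrite fine_ge0// law_open_ge0.
rewrite pE; set p := fine _ in pE p0 *.
(* A gap of U between the cells ]a, b[ and ]c, e[ separates indices 0 and 1 whenever X_0 and X_1
   fall in them, which has probability (b - a)(e - c). *)
have cell (a b c e : R) : 0 <= a <= b -> b <= c -> c <= e -> e <= 1 ->
    (exists2 z, b <= z <= c & ~ oset U z) -> (b - a) * (e - c) <= p.
  move=> ab bc ce e1 [z zbc Uz]; have /andP[a0 ab'] := ab.
  rewrite -lee_fin -pE EFinM -(iid_itv iidX 0 ab) ?(le_trans bc) ?(le_trans ce)//.
  rewrite -(@iid_itv _ _ _ _ _ iidX 1 c e)//; last first.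
    by rewrite ce (le_trans _ bc)// (le_trans a0).
  apply: two_cells; [exact: measurable_itv|exact: measurable_itv| |].
    by move=> x y; rewrite /= !in_itv /= => x1 y1; exists z => //; lra.
  by move=> x y; rewrite /= !in_itv /=; lra.
have [p1|p1] := leP (1 / 4) p.
  apply: (@le_trans _ _ 1%E); last by rewrite -EFinM lee_fin; lra.
  rewrite -[leRHS]sube0; apply: leeB => //.
  apply: (@le_trans _ _ (lebesgue_measure (connected_component (oset U) 0))) => //.
  by apply: ereal_sup_ubound; exists 0.
have half1 : 1 / 2 <= 1 :> R by lra.
have half0 : 0 <= (0 : R) <= 1 / 2 by lra.
(* A gap at c is tested against the half of [0, 1] on the other side of 1/2: for c <= 1/2 the cells
   ]0, c[ and ]1/2, 1[ give c / 2 <= p. *)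
have mid c : 2 * p < c < 1 - 2 * p -> oset U c.
  move=> /andP[c1 c2]; apply: contrapT => Uc; have [c3|c3] := leP c (1 / 2).
    have zc : exists2 z, c <= z <= 1 / 2 & ~ oset U z by exists c => //; rewrite lexx.
    have c0 : 0 <= (0 : R) <= c by lra.
    by have := @cell 0 c (1 / 2) 1 c0 c3 half1 (lexx 1) zc; lra.
  have zc : exists2 z, 1 / 2 <= z <= c & ~ oset U z by exists c => //; rewrite lexx ltW.
  have c1' : c <= 1 by lra.
  by have := @cell 0 (1 / 2) c 1 half0 (ltW c3) c1' (lexx 1) zc; lra.
have L : ((1 - 4 * p)%:E <= largest_component U)%E.
  apply: (@le_trans _ _ (lebesgue_measure (connected_component (oset U) (1 / 2)))); last first.
    by apply: ereal_sup_ubound; exists (1 / 2).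
  have -> : (1 - 4 * p)%:E = lebesgue_measure (`]2 * p, 1 - 2 * p[%classic : set R).
    rewrite lebesgue_measure_itv /= lte_fin ifT; last by lra.
    by rewrite -EFinB; congr (_%:E); lra.
  apply: le_measure; rewrite ?inE; [exact: measurable_itv|exact: measurable_component|].
  move=> c; rewrite /= in_itv /= => /andP[c1 c2].
  have [c3|c3] := leP c (1 / 2).
    apply: connected_component_sym; apply/connected_component_itvP => // y yc.
    by apply: mid; lra.
  by apply/connected_component_itvP; [exact: ltW|move=> y yc; apply: mid; lra].
apply: (@le_trans _ _ (1 - (1 - 4 * p)%:E)%E); first exact: leeB.
by rewrite -EFinB -EFinM lee_fin; lra.
Qed.

(** Monotonicity read off directly from the integral as a supremum over simple functions, so that it
    applies to 1 - s_1 without first establishing its measurability. *)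
Lemma ge0_le_integral_any d' (T : measurableType d') (mu : {measure set T -> \bar R})
    (f g : T -> \bar R) :
  (forall x, (0 <= f x)%E) -> (forall x, (f x <= g x)%E) ->
  (\int[mu]_x f x <= \int[mu]_x g x)%E.
Proof.
move=> f0 fg; have g0 x : (0 <= g x)%E by exact: le_trans (fg x).
rewrite !ge0_integralTE//; apply: le_ereal_sup => _ [h hf <-].
by exists h => // x; exact: le_trans (hf x) (fg x).
Qed.

Lemma dislocation_measureP (nu : {measure set (open01 R) -> \bar R}) :
  nu [set full01 R] = 0%E -> (law_mix X nu (nontriv 2) < +oo)%E ->
  dislocation_measure nu.
Proof.
move=> nu0 nufin; split => //.
apply: (@le_lt_trans _ _ (\int[nu]_U (4%:E * law_open X U (nontriv 2)))%E).
  apply: ge0_le_integral_any => U; last exact: largest_component_bound.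
  by rewrite subre_ge0 ?largest_component_le1.
have mn := nontriv_measurable 2.
rewrite ge0_integralZl ?lee_fin//; last exact: measurable_law_open.
by apply: lte_mul_pinfty; rewrite ?lee_fin.
Qed.

End dislocation.

Theorem theorem2p6 (R : realType)
    (d : measure_display) (Omega : measurableType d) (P : probability Omega R)
    (X : nat -> {RV P >-> R}) (iidX : iid_uniform X)
    (mu : {measure set compN -> \bar R}) (fmu : fragmentation_measure mu) :
  [/\ exchangeable (eps_l R), exchangeable (eps_r R) &
    exists (c_l c_r : R) (nu : {measure set (open01 R) -> \bar R}),
      [/\ 0 <= c_l, 0 <= c_r, dislocation_measure nu,
        forall A : set compN, measurable A ->
          mu A = (c_l%:E * eps_l R A + c_r%:E * eps_r R A + law_mix X nu A)%E &
        [/\ measurable (asymp_full R), measurable (asymp_not_full R),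
          forall A : set compN, measurable A ->
            mu (A `&` asymp_full R) =
            (c_l%:E * eps_l R A + c_r%:E * eps_r R A)%E &
          forall A : set compN, measurable A ->
            mu (A `&` asymp_not_full R) = law_mix X nu A]]].
Proof.
split; [exact: eps_l_exchangeable|exact: eps_r_exchangeable|].
have [c_l [c_r [cl0 cr0 fullE]]] := full_part iidX fmu.
have [nu [nu0 nfE]] := not_full_part iidX fmu.
have mf := measurable_asymp_full R; have mnf := measurable_asymp_not_full R.
exists c_l, c_r, nu; split => //.
  apply: (dislocation_measureP iidX nu0); rewrite -nfE; last exact: nontriv_measurable.
  apply: le_lt_trans (frag_nontriv fmu 2).
  apply: le_measure; rewrite ?inE; [|exact: nontriv_measurable|by move=> G []].
  by apply: measurableI => //; exact: nontriv_measurable.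
move=> A mA; rewrite -fullE// -nfE//.
have mc := measurable_has_asymp_open R.
(* The compositions without an asymptotic open set form a null set; on the others the two parts are
   complementary. *)
rewrite [LHS](measureDI mu mA mc) [X in (X + _)%E](_ : _ = 0%E) ?add0e; last first.
  apply/eqP; rewrite eq_le measure_ge0 andbT -(frag_has_asymp_open iidX fmu).
  apply: le_measure; rewrite ?inE; [exact: measurableD|exact: measurableC|by move=> G []].
rewrite -measureU.
- congr (mu _); rewrite -setIUr asymp_fullE asymp_not_fullE -setIUr.
  by congr (A `&` _); apply/seteqP; split => [G cG|G []//]; split => //; exact: EM.
- exact: measurableI.
- exact: measurableI.
- rewrite asymp_fullE asymp_not_fullE.
  by apply/seteqP; split => // G [[_ [_ /= Gf]] [_ [_ /(_ Gf)]]].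
Qed.
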